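(* Fix an integer $\ell\ge1$. The problem of deciding, given partitions $\lambda,\mu,\nu$ with $|\lambda|=|\mu|=|\nu|$ and $\ell(\lambda),\ell(\mu),\ell(\nu)\le\ell$ (parts given in binary), whether $g(\lambda,\mu,\nu)>0$ is in $\mathsf{P}$. Moreover, if $\lambda_1,\mu_1,\nu_1\le N$, there is an algorithm deciding whether $g(\lambda,\mu,\nu)>0$ in time $O(\log N)$ (the implied constant depending on $\ell$).
   Context: $\ell(\lambda)$ is the number of nonzero parts of $\lambda$. For partitions $\lambda,\mu,\nu\vdash n$, the Kronecker coefficient is $g(\lambda,\mu,\nu)=\frac{1}{n!}\sum_{\omega\in S_n}\chi^\lambda(\omega)\chi^\mu(\omega)\chi^\nu(\omega)$, where $\chi^\lambda$ is the irreducible character of $S_n$ indexed by $\lambda$. Running time is measured in arithmetic operations on integers of the size appearing in the input. *)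

(* Defs.v *)
From HB Require Import structures.
From mathcomp Require Import all_boot all_order all_algebra all_fingroup.
From mathcomp Require Import all_solvable all_field all_character.

Set Implicit Arguments.
Unset Strict Implicit.
Unset Printing Implicit Defensive.

Import Order.TTheory GRing.Theory Num.Theory.

Local Open Scope ring_scope.

(* A partition is the list of its nonzero parts, so that [size la] is its
   length, [sumn la] the number it partitions and [head 0 la] its largest
   part. *)
Definition is_partition (la : seq nat) : bool :=
  sorted geq la && (0%N \notin la).

(* The tableau is the row-by-row filling of the diagram of [la] with
   0, 1, ..., n - 1: the entry [i] lies in row [reshape_index la i] and in
   column [reshape_offset la i]. *)
Definition row_group (la : seq nat) (n : nat) : {set 'S_n} :=
  [set s : 'S_n |
    [forall i : 'I_n, reshape_index la (s i) == reshape_index la i]].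

Definition col_group (la : seq nat) (n : nat) : {set 'S_n} :=
  [set s : 'S_n |
    [forall i : 'I_n, reshape_offset la (s i) == reshape_offset la i]].

(* The Young symmetrizer, as a row vector of coordinates in the basis of the
   group algebra of 'S_n on which [regular_repr] acts by right
   multiplication. *)
Definition young_symmetrizer (la : seq nat) (n : nat) :
    'rV[algC]_#|[set: 'S_n]| :=
  \sum_(p in row_group la n) \sum_(q in col_group la n)
    (-1) ^+ q *: delta_mx 0 (gring_index [set: 'S_n]%G (p * q)%g).

(* The right ideal of the group algebra generated by the Young symmetrizer
   (the Specht module), with its action of 'S_n by right multiplication. *)
Definition specht_repr (la : seq nat) (n : nat) :=
  submod_repr (cyclic_mx_module (regular_repr algC [set: 'S_n]%G)
                                (young_symmetrizer la n)).

Definition chi (la : seq nat) (n : nat) : 'CF([set: 'S_n]) :=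
  cfRepr (specht_repr la n).

(* Only meaningful when [la], [mu] and [nu] are partitions of the same number.
   The value is a natural number, here as an element of [algC]. *)
Definition kronecker (la mu nu : seq nat) : algC :=
  let n := sumn la in
  (n`!%:R)^-1 *
    \sum_(w : 'S_n) chi la n w * chi mu n w * chi nu n w.

(* Deterministic multi-tape Turing machines; tapes are infinite in both
   directions. *)
Inductive move := MoveLeft | MoveRight | Stay.

(* A cell is blank ([None]), or holds an input symbol or a work symbol. *)
Definition cell (Sigma Gamma : finType) := option (Sigma + Gamma)%type.

(* [tape_left] is listed from the head outwards; all cells that are not listed
   are blank. *)
Record tape (A : Type) := Tape {
  tape_left : seq (option A);
  tape_head : option A;
  tape_right : seq (option A)
}.

Definition tape_of_word (A : Type) (w : seq A) : tape A :=
  if w is a :: w' then Tape [::] (Some a) [seq Some x | x <- w']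
  else Tape [::] None [::].

Definition tape_write (A : Type) (c : option A) (t : tape A) : tape A :=
  Tape (tape_left t) c (tape_right t).

Definition tape_move (A : Type) (m : move) (t : tape A) : tape A :=
  let: Tape l c r := t in
  match m with
  | MoveLeft =>
      if l is x :: l' then Tape l' x (c :: r) else Tape [::] None (c :: r)
  | MoveRight =>
      if r is x :: r' then Tape (c :: l) x r' else Tape (c :: l) None [::]
  | Stay => t
  end.

(* [tm_verdict q = Some b] means that [q] is a halting state, accepting if [b]
   is [true] and rejecting otherwise. The machine has [tm_tapes.+1] tapes. *)
Record tm (Sigma : finType) := TM {
  tm_tapes : nat;
  tm_work : finType;
  tm_state : finType;
  tm_start : tm_state;
  tm_verdict : tm_state -> option bool;
  tm_trans : tm_state -> {ffun 'I_tm_tapes.+1 -> cell Sigma tm_work} ->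
    tm_state * {ffun 'I_tm_tapes.+1 -> cell Sigma tm_work * move}
}.

Section TuringMachine.

Variables (Sigma : finType) (M : tm Sigma).

Record tm_config := TMConfig {
  tm_cur : tm_state M;
  tm_cont : {ffun 'I_(tm_tapes M).+1 -> tape (Sigma + tm_work M)%type}
}.

Definition tm_init (w : seq Sigma) : tm_config :=
  TMConfig (tm_start M)
    [ffun i => tape_of_word (if i == ord0 then [seq inl x | x <- w] else [::])].

Definition tm_step (c : tm_config) : tm_config :=
  if tm_verdict (tm_cur c) is Some _ then c else
  let: (q, act) :=
    tm_trans (tm_cur c) [ffun i => tape_head (tm_cont c i)] in
  TMConfig q
    [ffun i => tape_move (act i).2 (tape_write (act i).1 (tm_cont c i))].

Definition tm_decides_in_time (L : seq Sigma -> Prop) (T : nat -> nat) : Prop :=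
  forall w : seq Sigma, exists (t : nat) (b : bool),
    [/\ (t <= T (size w))%N,
        tm_verdict (tm_cur (iter t tm_step (tm_init w))) = Some b
      & b <-> L w].

End TuringMachine.

Definition in_P (Sigma : finType) (L : seq Sigma -> Prop) : Prop :=
  exists (M : tm Sigma) (c d : nat),
    tm_decides_in_time M L (fun n => c * (n ^ d).+1)%N.

(* [inl b] is a binary digit, [inr false] ends a part and [inr true] ends a
   partition. *)
Definition symbol : finType := (bool + bool)%type.

(* Most significant digit first, without leading zeros when [0 < n]. *)
Definition binary (n : nat) : seq bool :=
  rev (mkseq (fun i => odd (n %/ 2 ^ i)) (trunc_log 2 n).+1).

Definition encode_partition (la : seq nat) : seq symbol :=
  rcons (flatten [seq rcons [seq inl b | b <- binary p] (inr false) | p <- la])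
        (inr true).

Definition encode_triple (la mu nu : seq nat) : seq symbol :=
  encode_partition la ++ encode_partition mu ++ encode_partition nu.

Definition kronecker_instance (l : nat) (la mu nu : seq nat) : bool :=
  [&& [&& is_partition la, is_partition mu & is_partition nu],
      sumn la == sumn mu, sumn mu == sumn nu
    & [&& size la <= l, size mu <= l & size nu <= l]%N].

Definition kronecker_positivity (l : nat) (w : seq symbol) : Prop :=
  exists la mu nu : seq nat,
    [/\ kronecker_instance l la mu nu, w = encode_triple la mu nu
      & 0 < kronecker la mu nu].

(* Programs operating on integer registers, at unit cost per instruction. *)
Inductive arith_op := OpAdd | OpSub | OpMul | OpDiv.

(* [OpDiv] is Euclidean division, with [x / 0 = 0]. *)
Definition eval_op (o : arith_op) (x y : int) : int :=
  match o with
  | OpAdd => x + y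
  | OpSub => x - y
  | OpMul => x * y
  | OpDiv => (x %/ y)%Z
  end.

Inductive instr :=
| SetConst of nat & int                   (* R_i := z *)
| SetOp of nat & arith_op & nat & nat     (* R_i := R_j op R_k *)
| JumpPos of nat & nat                    (* if 0 < R_i then goto k *)
| Halt of bool.

Definition program := seq instr.

Record ram_config := RamConfig { ram_pc : nat; ram_reg : nat -> int }.

Definition set_reg (r : nat -> int) (i : nat) (z : int) : nat -> int :=
  fun j => if j == i then z else r j.

Definition ram_step (P : program) (c : ram_config) : ram_config :=
  let: RamConfig pc r := c in
  match onth P pc with
  | Some (SetConst i z) => RamConfig pc.+1 (set_reg r i z)
  | Some (SetOp i o j k) => RamConfig pc.+1 (set_reg r i (eval_op o (r j) (r k)))
  | Some (JumpPos i k) => RamConfig (if 0 < r i then k else pc.+1) r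
  | Some (Halt _) | None => c
  end.

Definition ram_verdict (P : program) (c : ram_config) : option bool :=
  if onth P (ram_pc c) is Some (Halt b) then Some b else None.

Definition ram_init (input : seq nat) : ram_config :=
  RamConfig 0 (fun i => (nth 0%N input i)%:Z).

(* From the given input, [P] halts with verdict [b] after at most [T]
   instructions, and no register ever exceeds [B] in absolute value. *)
Definition ram_run (P : program) (input : seq nat) (T B : nat) (b : bool) :
    Prop :=
  exists t : nat,
    [/\ (t <= T)%N,
        ram_verdict P (iter t (ram_step P) (ram_init input)) = Some b
      & forall s i : nat, (s <= t)%N ->
          (`|ram_reg (iter s (ram_step P) (ram_init input)) i| <= B)%N].

(* Each of the three partitions is padded with zeros to [l] parts. *)
Definition ram_input (l : nat) (la mu nu : seq nat) : seq nat :=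
  [seq nth 0%N p i | p <- [:: la; mu; nu], i <- iota 0 l].

(* Main.v *)
Require Import Defs.
From mathcomp Require Import all_boot all_order all_algebra all_fingroup.
From mathcomp Require Import all_solvable all_field all_character.
From mathcomp Require Import mpoly ring zify.

Set Implicit Arguments.
Unset Strict Implicit.
Unset Printing Implicit Defensive.

Import Order.TTheory GRing.Theory Num.Theory.
Local Open Scope ring_scope.

(* The Jacobi-Trudi formula expands the Specht character of [la] as the signed
   sum, over permutations [s] of the [l] rows, of the number of words with
   [la_i - i + s i] letters [i] that a permutation of the positions fixes.  By
   Burnside's lemma the Kronecker coefficient is then a signed sum of numbers
   of [l * l * l] arrays of natural numbers with prescribed margins, the
   margins being the three partitions up to bounded shifts.

   The numbers of arrays whose margins are [x + c], for [c] in a fixed finite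
   box of shifts, satisfy a linear recursion on the lowest binary digits of
   [x]: splitting every entry as [2 m' + s] with [s] a bit reduces the margins
   [2 x' + r + c] to [x' + (r + c - As) / 2], where [As] are the margins of the
   array of the bits.  So the coefficient is a product of matrices of bounded
   size, one for each digit, between two fixed vectors.  A register program
   evaluates it with boundedly many operations per digit, and a Turing machine
   with one sweep over the binary vectors per digit.

   Jacobi-Trudi itself holds because the Specht character [chi] and the signed
   sum [phi] are real with [<chi, chi> = <phi, phi> = <phi, chi> = 1]: the
   first and third products come from von Neumann's lemma on the Young
   symmetrizer, the second from the bialternant identity. *)

(** * Words and Burnside counting *)

(** The signs cause cancellation, so solvability of the linear systems does not decide positivity:
    the numbers of solutions themselves are needed. The digit recursion yields them because the
    discrepancy between the two sides of an equation, halved at every digit, stays in an interval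
    fixed by the coefficients alone; the sum of the entries of the vector grows at most by a
    constant factor per digit and hence stays polynomial in [N].

    The sign of the permutations is kept as part of the state, so that vectors and matrices have
    natural entries and only two totals are compared at the end. The conditions on the input are
    left to the linear system as well: margins with different totals admit no array, and unsorted
    parts are excluded by slack unknowns. A parser then has to check only the form of the word,
    never the order or the sum of the parts. *)

Lemma card_set_count (T : finType) (P : pred T) :
  #|[set x | P x]| = count P (enum T).
Proof.
by rewrite cardE -size_filter enumT; congr size; apply: eq_filter => x; rewrite !inE.
Qed.

Section Words.
Variables (n : nat) (K : finType).
Implicit Types (U V : {ffun 'I_n -> K}) (w : 'S_n).

Definition content U : {ffun K -> nat} :=
  [ffun k => #|[set i | U i == k]|].

Definition fixes w U := [forall i, U (w i) == U i].

Lemma content_le U k : (content U k <= n)%N.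
Proof. by rewrite ffunE -[X in (_ <= X)%N]card_ord max_card. Qed.

Lemma sum_content U : (\sum_k content U k)%N = n.
Proof.
rewrite -[RHS](card_ord n) -sum1_card (partition_big U predT) //=.
by apply: eq_bigr => k _; rewrite ffunE sum1dep_card.
Qed.

Definition word_perm U w : {ffun 'I_n -> K} := [ffun i => U (w i)].

Lemma word_permM U w w' : word_perm (word_perm U w) w' = word_perm U (w' * w).
Proof. by apply/ffunP => i; rewrite !ffunE permM. Qed.

Lemma word_perm1 U : word_perm U 1 = U.
Proof. by apply/ffunP => i; rewrite !ffunE perm1. Qed.

Lemma fixesE w U : fixes w U = (word_perm U w == U).
Proof.
apply/forallP/eqP => [h|/ffunP h i]; last by have := h i; rewrite ffunE => ->.
by apply/ffunP => i; rewrite ffunE; apply/eqP.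
Qed.

Lemma content_perm U w : content (word_perm U w) = content U.
Proof.
apply/ffunP => k; rewrite !ffunE -[RHS](card_preimset _ (@perm_inj _ w)).
by apply: eq_card => i; rewrite !inE ffunE.
Qed.

Lemma content_eq_perm U V : content U = content V ->
  exists w, U = word_perm V w.
Proof.
move=> eqUV; pose t (W : {ffun 'I_n -> K}) := [tuple W i | i < n].
have tE W k : count_mem k (t W) = content W k.
  by rewrite ffunE card_set_count /= /image_mem count_map.
have : perm_eq (t U) (t V) by apply/allP => k _ /=; rewrite !tE eqUV.
case/tuple_permP => p Ep; exists p; apply/ffunP => i.
have /(congr1 (fun s : n.-tuple K => tnth s i)) : t U = [tuple tnth (t V) (p i) | i < n].
  exact: val_inj.
by rewrite !tnth_mktuple ffunE.
Qed.

Lemma word_with_content (m : {ffun K -> nat}) :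
  (\sum_k m k)%N = n -> exists U, content U = m.
Proof.
move=> sm; pose s := flatten [seq nseq (m k) k | k <- enum K].
have ss : size s == n.
  rewrite size_flatten /shape -map_comp -sm sumnE big_map big_enum /=.
  by apply/eqP; apply: eq_bigr => k _; rewrite size_nseq.
exists [ffun i => tnth (Tuple ss) i]; apply/ffunP => k; rewrite ffunE.
have -> : #|[set i | [ffun i => tnth (Tuple ss) i] i == k]| = count_mem k s.
  rewrite -[s]/(tval (Tuple ss)) -[in RHS](map_tnth_enum (Tuple ss)) count_map.
  by rewrite card_set_count; apply: eq_count => i /=; rewrite ffunE.
rewrite count_flatten -map_comp sumnE big_map big_enum /=.
rewrite (bigD1 k) //= count_nseq /= eqxx mul1n big1 ?addn0 // => j /negPf jk.
by rewrite count_nseq /= jk.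
Qed.

(** Words of one content form an orbit, and the permutations carrying [U] to [V] are a coset of the
    stabiliser of [V], so the sum counts the whole group. *)
Lemma card_word_class U :
  (\sum_(V | content V == content U) #|[set w | fixes w V]| = n`!)%N.
Proof.
rewrite -card_Sn -sum1_card (partition_big (word_perm U)
  (fun V => content V == content U)) /=; last by move=> w _; rewrite content_perm.
apply: eq_bigr => V /eqP /content_eq_perm [v ->].
rewrite sum1dep_card -(card_preimset _ (@mulIg _ v)) /=.
apply: eq_card => w; rewrite !inE fixesE word_permM; reflexivity.
Qed.

(** Burnside: an orbit of words is a content, and each orbit contributes [n!]. The bound [N] makes
    the contents a finite type. *)
Lemma sum_fixed_words (N : nat) (Q : pred {ffun K -> nat}) : (n < N)%N ->
  (\sum_(w : 'S_n) #|[set U | fixes w U && Q (content U)]| =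
   n`! * #|[set m : {ffun K -> 'I_N} |
      (\sum_k m k == n)%N && Q [ffun k => m k : nat]]|)%N.
Proof.
move=> nN.
pose c U : {ffun K -> 'I_N} :=
  [ffun k => Ordinal (leq_ltn_trans (content_le U k) nN)].
have cE U : [ffun k => c U k : nat] = content U.
  by apply/ffunP => k; rewrite !ffunE.
rewrite (eq_bigr (fun w => \sum_(U | Q (content U)) (fixes w U : nat)))%N;
  last first.
  move=> w _; rewrite -sum1dep_card big_mkcondl /=.
  by apply: eq_bigr => U _; case: fixes.
rewrite exchange_big /= (partition_big c (fun m => (\sum_k m k == n)%N &&
  Q [ffun k => m k : nat])) /=; last first.
  move=> U QU; rewrite cE QU andbT; apply/eqP; rewrite -[RHS](sum_content U).
  by apply: eq_bigr => k _; rewrite !ffunE.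
rewrite -sum1dep_card big_distrr /= muln1; apply: eq_bigr => m /andP[/eqP sm Qm].
have [|U EU] := @word_with_content [ffun k => m k : nat].
  by under eq_bigr do rewrite ffunE.
rewrite -(card_word_class U); apply: eq_big => [V|V _].
  apply/andP/eqP => [[_ /eqP cV]|EV]; first by rewrite EU -cV cE.
  rewrite EV EU Qm; split=> //; apply/eqP/ffunP => k; apply: val_inj.
  by rewrite ffunE /= EV EU ffunE.
by rewrite -sum1dep_card [RHS]big_mkcond /=; apply: eq_bigr => w _; case: fixes.
Qed.
End Words.

(** * Young diagrams and the Young symmetrizer *)

Section Diagram.
Local Open Scope nat_scope.
Variables (la : seq nat) (n : nat).
Hypotheses (la_part : is_partition la) (sumn_la : sumn la = n).
Implicit Types (i j : 'I_n) (U : 'I_n -> nat).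

Definition cell_row (i : 'I_n) : nat := reshape_index la i.
(** The type ['I_n] allows sums over all columns, empty ones included. *)
Definition cell_col (i : 'I_n) : 'I_n :=
  Ordinal (leq_ltn_trans (leq_subr (sumn (take (cell_row i) la)) i)
    (ltn_ord i)).

Lemma cell_inj i j :
  cell_row i = cell_row j -> cell_col i = cell_col j -> i = j.
Proof.
move=> r /(congr1 val) c; apply: ord_inj.
by rewrite -(reshape_indexK la i) -(reshape_indexK la j); congr flatten_index.
Qed.

Lemma cell_colP i : cell_col i < nth 0 la (cell_row i).
Proof. by apply: reshape_offsetP; rewrite sumn_la. Qed.

Lemma cell_rowP i : cell_row i < size la.
Proof. by apply: reshape_indexP; rewrite sumn_la. Qed.

Lemma cell_exists r c : c < nth 0 la r ->
  exists i, cell_row i = r /\ cell_col i = c :> nat.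
Proof.
move=> rc; have lt_n : flatten_index la r c < n.
  by rewrite -sumn_la flatten_indexP.
exists (Ordinal lt_n); split; first exact: flatten_indexKl.
exact: flatten_indexKr.
Qed.

Lemma nth_part_anti r s : r <= s -> nth 0 la s <= nth 0 la r.
Proof.
case/andP: la_part => srt _; case: (ltnP s (size la)) => ss rs; last first.
  by rewrite [nth 0 la s]nth_default.
have gt : transitive geq by move=> x y z /= xy yz; apply: leq_trans yz xy.
have gr : reflexive geq by move=> x; apply: leqnn.
by apply: (sorted_leq_nth gt gr 0 srt) => //; apply: leq_ltn_trans ss.
Qed.

Lemma column_down i r : r <= cell_row i ->
  exists j, cell_row j = r /\ cell_col j = cell_col i.
Proof.
move=> ri; have [|j [jr jc]] := @cell_exists r (cell_col i).
  exact: leq_trans (cell_colP i) (nth_part_anti ri).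
by exists j; split=> //; apply: ord_inj.
Qed.

Lemma card_row r : #|[set i | cell_row i == r]| = nth 0 la r.
Proof.
have lt_n (c : 'I_(nth 0 la r)) : flatten_index la r c < n.
  by rewrite -sumn_la flatten_indexP.
pose f c := Ordinal (lt_n c).
have f_inj : injective f.
  by move=> c d /(congr1 val) /addnI /ord_inj.
rewrite -[RHS]card_ord -(card_imset _ f_inj); apply: eq_card => i.
rewrite inE; apply/eqP/imsetP => [ri|[c _ ->]]; last exact: flatten_indexKl.
have := cell_colP i; rewrite ri => ci.
exists (Ordinal ci) => //; apply: cell_inj; rewrite ?ri; last apply: ord_inj.
  by rewrite [RHS]flatten_indexKl.
by rewrite [RHS](flatten_indexKr ci).
Qed.

Definition column_injective U :=
  forall i j, cell_col i = cell_col j -> U i = U j -> i = j.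

Definition col_below U c k := [set i | (cell_col i == c) && (U i < k)].

(** An injective filling of a column has at most as many values below [k] as the column has cells,
    and at most [k] of them; the filling by row numbers attains the smaller of the two. *)
Lemma col_below_le U c k : column_injective U ->
  #|col_below U c k| <= #|col_below cell_row c k|.
Proof.
move=> injU; case: (boolP [forall i, (cell_col i == c) ==> (cell_row i < k)]).
  move/forallP => short; apply/subset_leq_card/subsetP => i.
  by rewrite !inE => /andP[ci _]; rewrite ci; apply: (implyP (short i)).
case: k => [|k]; first by rewrite [X in X <= _]eq_card0 // => i; rewrite inE ltn0 andbF.
case/forallPn => i0; rewrite negb_imply -leqNgt => /andP[/eqP ci0 ri0].
apply: (@leq_trans k.+1).
  have injI : {in col_below U c k.+1 &, injective (fun i => inord (U i) : 'I_k.+1)}.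
    move=> i j; rewrite !inE => /andP[/eqP ci Ui] /andP[/eqP cj Uj].
    move/(congr1 val); rewrite /= !inordK // => UU.
    by apply: injU UU; rewrite ci cj.
  by rewrite -(card_in_imset injI) -[X in _ <= X]card_ord max_card.
rewrite -[X in X <= _]card_ord.
apply: leq_trans (leq_imset_card (fun i => inord (cell_row i) : 'I_k.+1) _).
apply/subset_leq_card/subsetP => r _.
have [|j [jr jc]] := @column_down i0 r; first exact: ltnW (leq_trans _ ri0).
apply/imsetP; exists j; first by rewrite inE jc ci0 eqxx jr ltn_ord.
by rewrite jr inord_val.
Qed.

Lemma sum_col_below U k : \sum_c #|col_below U c k| = #|[set i | U i < k]|.
Proof.
rewrite -[RHS]sum1dep_card [RHS](partition_big cell_col predT) //=.
apply: eq_bigr => c _; rewrite sum1dep_card; apply: eq_card => i.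
by rewrite !inE andbC.
Qed.

Lemma column_injective_below_le U k : column_injective U ->
  #|[set i | U i < k]| <= #|[set i | cell_row i < k]|.
Proof.
by move=> injU; rewrite -!sum_col_below; apply: leq_sum => c _; apply: col_below_le.
Qed.

(** Equality in total forces equality in every column, since no column exceeds its bound. Taking
    differences in [k], the values in a column are its row numbers in some order. *)
Lemma column_injective_straighten U : column_injective U ->
  (forall k, #|[set i | U i < k]| = #|[set i | cell_row i < k]|) ->
  exists2 q : 'S_n, q \in col_group la n & forall i, U i = cell_row (q i).
Proof.
move=> injU eqU.
have eq_below c k : #|col_below U c k| = #|col_below cell_row c k|.
  have /eqP : \sum_c (#|col_below cell_row c k| - #|col_below U c k|) = 0.
    rewrite sumnB; last by move=> d _; apply: col_below_le.
    by rewrite !sum_col_below eqU subnn.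
  rewrite sum_nat_eq0 => /forallP /(_ c) /=; rewrite subn_eq0 => le.
  by apply/eqP; rewrite eqn_leq le col_below_le.
have eq_at V c k : #|col_below V c k.+1| =
    #|col_below V c k| + #|[set i | (cell_col i == c) && (V i == k)]|.
  rewrite -(cardsID [set i | V i < k] (col_below V c k.+1)).
  congr (_ + _); apply: eq_card => i; rewrite !inE ltnS.
    by case: (cell_col i == c) => //=; case: ltngtP.
  by rewrite andbC -andbA; congr (_ && _); case: ltngtP.
have preim i : exists j, (cell_row j == U i) && (cell_col j == cell_col i).
  have : #|[set j | (cell_col j == cell_col i) && (U j == U i)]| =
         #|[set j | (cell_col j == cell_col i) && (cell_row j == U i)]|.
    by apply: (@addnI #|col_below U (cell_col i) (U i)|); rewrite -eq_at !eq_below -eq_at.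
  move=> E; have : 0 < #|[set j | (cell_col j == cell_col i) && (cell_row j == U i)]|.
    by rewrite -E; apply/card_gt0P; exists i; rewrite inE !eqxx.
  by case/card_gt0P => j; rewrite inE andbC; exists j.
pose f i := xchoose (preim i).
have fP i : cell_row (f i) = U i /\ cell_col (f i) = cell_col i.
  by case/andP: (xchooseP (preim i)) => /eqP ? /eqP.
have f_inj : injective f.
  move=> i j fij; have [ri ci] := fP i; have [rj cj] := fP j.
  by apply: injU; rewrite -?ri -?ci fij.
exists (perm f_inj) => [|i]; last by rewrite permE; case: (fP i).
rewrite inE; apply/forallP => i; rewrite permE; apply/eqP.
by case: (fP i) => _ /(congr1 val).
Qed.

Lemma mem_row_group (s : 'S_n) :
  reflect (forall i, cell_row (s i) = cell_row i) (s \in row_group la n).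
Proof.
by rewrite inE; apply: (iffP forallP) => h i; apply/eqP; apply: h.
Qed.

Lemma mem_col_group (s : 'S_n) :
  reflect (forall i, cell_col (s i) = cell_col i) (s \in col_group la n).
Proof.
rewrite inE; apply: (iffP forallP) => h i.
  by apply: ord_inj; apply/eqP; apply: h.
by apply/eqP; apply: (congr1 val (h i)).
Qed.
End Diagram.

(** * Von Neumann's lemma and the character of the Specht module *)

Section YoungSymmetrizer.
Variables (la : seq nat) (n : nat).
Hypotheses (la_part : is_partition la) (sumn_la : sumn la = n).
Implicit Types (s t p q w : 'S_n).

Local Notation R := (row_group la n).
Local Notation C := (col_group la n).
Local Notation inR := (mem_row_group la).
Local Notation inC := (mem_col_group la).

(** The coefficient of [s] in the Young symmetrizer. As a function on the group it turns products in
    the group algebra into sums that can be reindexed. *)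
Definition young s : algC :=
  \sum_(p in R) \sum_(q in C) (-1) ^+ q * ((p * q)%g == s)%:R.

Lemma row_groupM p p' : p \in R -> p' \in R -> (p * p')%g \in R.
Proof. by move=> /inR hp /inR hp'; apply/inR => i; rewrite permM hp' hp. Qed.

Lemma row_groupV p : p \in R -> (p^-1)%g \in R.
Proof. by move=> /inR hp; apply/inR => i; rewrite -[in RHS](permKV p i) hp. Qed.

Lemma col_groupM q q' : q \in C -> q' \in C -> (q * q')%g \in C.
Proof. by move=> /inC hq /inC hq'; apply/inC => i; rewrite permM hq' hq. Qed.

Lemma col_groupV q : q \in C -> (q^-1)%g \in C.
Proof. by move=> /inC hq; apply/inC => i; rewrite -[in RHS](permKV q i) hq. Qed.

Lemma row_group1 : 1%g \in R.
Proof. by apply/inR => i; rewrite perm1. Qed.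

Lemma col_group1 : 1%g \in C.
Proof. by apply/inC => i; rewrite perm1. Qed.

Lemma row_groupMl p p' : p \in R -> ((p * p')%g \in R) = (p' \in R).
Proof.
move=> hp; apply/idP/idP => [h|]; last exact: row_groupM.
by rewrite -(mulKg p p'); apply: row_groupM h; apply: row_groupV.
Qed.

Lemma col_groupMr q q' : q' \in C -> ((q * q')%g \in C) = (q \in C).
Proof.
move=> hq; apply/idP/idP => [h|h]; last exact: col_groupM.
by rewrite -(mulgK q' q); apply: col_groupM => //; apply: col_groupV.
Qed.

Lemma young_rowl p s : p \in R -> young (p * s) = young s.
Proof.
move=> hp; rewrite /young (reindex_inj (mulgI p)) /=.
apply: eq_big => [p'|p' _]; first exact: row_groupMl.
by apply: eq_bigr => q _; rewrite -mulgA (inj_eq (mulgI p)).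
Qed.

Lemma young_colr q s : q \in C -> young (s * q) = (-1) ^+ q * young s.
Proof.
move=> hq; rewrite /young mulr_sumr; apply: eq_bigr => p _.
rewrite mulr_sumr (reindex_inj (mulIg q)) /=.
apply: eq_big => [q'|q' _]; first exact: col_groupMr.
by rewrite mulgA (inj_eq (mulIg q)) odd_permM signr_addb mulrA [_ * (-1) ^+ q]mulrC.
Qed.

Lemma young_real s : young s \is Num.real.
Proof.
apply: rpred_sum => p _; apply: rpred_sum => q _.
by rewrite rpredM ?rpredX ?rpredN ?rpred1 ?realn.
Qed.

Lemma row_col_trivial p q : p \in R -> q \in C -> (p * q == 1)%g =
  (p == 1%g) && (q == 1%g).
Proof.
move=> hp hq; apply/eqP/andP => [pq1|[/eqP -> /eqP ->]]; last by rewrite mulg1.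
have qE : q = (p^-1)%g by rewrite -(mulKg p q) pq1 mulg1.
have q1 : q = 1%g.
  apply/permP => i; rewrite perm1; apply: (@cell_inj la); last by move/inC: hq.
  by rewrite qE; move/row_groupV/inR: hp.
by rewrite q1 eqxx; split=> //; rewrite -pq1 q1 mulg1.
Qed.

Lemma young1 : young 1 = 1.
Proof.
rewrite /young (bigD1 1%g) ?row_group1 //= (bigD1 1%g) ?col_group1 //=.
rewrite mulg1 eqxx odd_perm1 mulr1 expr0 !big1 ?addr0 // => [p /andP[hp p1]|].
  rewrite big1 // => q hq; rewrite row_col_trivial // (negPf p1) mulr0 //.
by move=> q /andP[hq q1]; rewrite mul1g (negPf q1) mulr0.
Qed.

(* If no two points of a row are carried by [s] into one column, the rows
   of the images can be sorted within each column. *)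
Lemma row_col_dichotomy s :
  (exists2 q, q \in C & (s * q)%g \in R) \/
  exists t, [/\ t \in C, odd_perm t & (s * t * s^-1)%g \in R].
Proof.
pose U i := cell_row la ((s^-1)%g i).
case: (boolP [forall i, forall j, (cell_col la i == cell_col la j) ==>
   ((U i == U j) ==> (i == j))]) => [/forallP inj|].
  have injU : column_injective la U.
    move=> i j c r; have /forallP/(_ j) := inj i.
    by rewrite c r !eqxx /= => /eqP.
  have [|q hq qE] := column_injective_straighten la_part sumn_la injU.
    move=> k; rewrite -[RHS](card_preimset _ (@perm_inj _ (s^-1)%g)).
    by apply: eq_card => i; rewrite !inE.
  left; exists q => //; apply/inR => i.
  by rewrite permM -qE /U permK.
case/forallPn => i /forallPn [j]; rewrite !negb_imply.
case/and3P => /eqP cij /eqP rij ij; right; exists (tperm i j); split.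
- by apply/inC => k; case: tpermP => [->|->|].
- by rewrite odd_tperm.
apply/inR => k; rewrite !permM -[in RHS](permK s k).
by case: tpermP => [->|->|]; rewrite -/(U _) ?rij.
Qed.

(** By the dichotomy, either [s] lies in [R C], where the two symmetries determine [f s] from [f 1],
    or [s] conjugates an odd [t] of [C] into [R], which gives [f s = - f s]. *)
Lemma von_neumann (f : 'S_n -> algC) :
  (forall p s, p \in R -> f (p * s)%g = f s) ->
  (forall q s, q \in C -> f (s * q)%g = (-1) ^+ q * f s) ->
  forall s, f s = f 1%g * young s.
Proof.
move=> fR fC s; case: (row_col_dichotomy s) => [[q hq hp]|[t [ht odd_t hp]]].
  have signK x : (-1) ^+ q * ((-1) ^+ q * x) = x :> algC.
    by rewrite mulrA -signr_addb addbb mul1r.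
  rewrite -[f s]signK -[young s]signK -fC // -young_colr //.
  by rewrite -[(s * q)%g]mulg1 fR // young_rowl // young1 mulr1 mulrC.
have zero g : (forall p s, p \in R -> g (p * s)%g = g s) ->
    (forall q s, q \in C -> g (s * q)%g = (-1) ^+ q * g s) -> g s = 0 :> algC.
  move=> gR gC; have := gC _ s ht; rewrite odd_t mulN1r.
  rewrite -[(s * t)%g](mulgKV s) gR // => /eqP.
  by rewrite -subr_eq0 opprK -mulr2n mulrn_eq0 => /eqP.
rewrite (zero f fR fC) (zero young) ?mulr0 // => [p u up|q u uq].
  exact: young_rowl.
exact: young_colr.
Qed.

(** The coefficient of the identity in the square of the Young symmetrizer, classically [n!] divided
    by the dimension of the Specht module. *)
Definition young_scalar : algC := \sum_t young t * young t^-1.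
Local Notation c := young_scalar.

(** With [e] the symmetrizer, the left side is the coefficient of [s] in [e z^-1 e]. As a function
    of [s] it has both symmetries of [young], so von Neumann's lemma applies. *)
Lemma young_sandwich z s :
  \sum_t young t * young (z * t^-1 * s) =
  (\sum_t young t * young (z * t^-1)) * young s.
Proof.
pose f s := \sum_t young t * young (z * t^-1 * s).
rewrite -[LHS]/(f s) (@von_neumann f) => [|p {}s hp|q {}s hq]; last 2 first.
- rewrite /f (reindex_inj (mulgI p)); apply: eq_bigr => t _ /=.
  by rewrite young_rowl // invMg -!mulgA mulKg.
- by rewrite /f mulr_sumr; apply: eq_bigr => t _; rewrite mulgA young_colr // mulrCA.
by congr (_ * _); apply: eq_bigr => t _; rewrite mulg1.
Qed.

Lemma young_mul s : \sum_t young t * young (t^-1 * s) = c * young s.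
Proof.
have := young_sandwich 1 s.
by under eq_bigr do rewrite mul1g; under [in RHS]eq_bigr do rewrite mul1g.
Qed.

Lemma sum_young_scale (V : lmodType algC) (f : 'S_n -> V) :
  \sum_t young t *: f t =
  \sum_(p in R) \sum_(q in C) (-1) ^+ q *: f (p * q)%g.
Proof.
rewrite /young; under eq_bigr do rewrite scaler_suml.
rewrite exchange_big /=; apply: eq_bigr => p _.
under eq_bigr do rewrite scaler_suml.
rewrite exchange_big /=; apply: eq_bigr => q _.
rewrite (bigD1 (p * q)%g) //= eqxx mulr1 big1 ?addr0 // => t tpq.
by rewrite eq_sym (negPf tpq) mulr0 scale0r.
Qed.

Lemma sum_young (f : 'S_n -> algC) : \sum_t young t * f t =
  \sum_(p in R) \sum_(q in C) (-1) ^+ q * f (p * q)%g.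
Proof. exact: (@sum_young_scale algC^o). Qed.

Lemma row_groupVE p : ((p^-1)%g \in R) = (p \in R).
Proof. by apply/idP/idP => /row_groupV; rewrite ?invgK. Qed.

Lemma col_groupVE q : ((q^-1)%g \in C) = (q \in C).
Proof. by apply/idP/idP => /col_groupV; rewrite ?invgK. Qed.

Lemma young_scalarE :
  c = \sum_(q in C) \sum_(p in R) (-1) ^+ q * young (q * p).
Proof.
rewrite /young_scalar sum_young exchange_big /= (reindex_inj invg_inj) /=.
apply: eq_big => [q|q _]; first exact: col_groupVE.
rewrite (reindex_inj invg_inj) /=; apply: eq_big => [p|p _]; first exact: row_groupVE.
by rewrite invMg !invgK odd_permV.
Qed.

(* The coefficients of [a b a], where [a] is the sum of [R] and [young]
   is [a b]. *)
Let h s := \sum_(p in R) young (s * p).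

(** Inversion fixes [a] and [b] and reverses products, so it fixes [a b a]. *)
Lemma young_aba_inv s : h s^-1 = h s.
Proof.
rewrite /h /young exchange_big /=.
apply: eq_bigr => p hp; apply: eq_bigr => p' hp'.
rewrite (reindex_inj invg_inj) /=.
apply: eq_big => [q|q _]; first by rewrite col_groupVE.
rewrite odd_permV; congr (_ * _%:R).
rewrite -(inj_eq (mulgI s)) mulgA mulKVg -(inj_eq (mulIg q)) mulgKV.
by rewrite eq_sym.
Qed.

(** The definition of [c] is not visibly a sum of squares, because it pairs [t] with its inverse.
    The element [a b a] is fixed by inversion, so the coefficient of the identity in its square is a
    sum of real squares; it equals [|R|^2 c] and has the nonzero term [|R|^2]. *)
Lemma young_scalar_gt0 : 0 < c.
Proof.
have hR s : h s \is Num.real by apply: rpred_sum => p _; apply: young_real.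
have h1 : h 1%g = #|R|%:R.
  rewrite /h -sum1_card natr_sum; apply: eq_bigr => p hp.
  by rewrite mul1g -[p]mulg1 young_rowl ?young1.
have R0 : (0 < #|R|)%N by apply/card_gt0P; exists 1%g; apply: row_group1.
have : \sum_s h s ^+ 2 = #|R|%:R ^+ 2 * c.
  under eq_bigr => s _ do rewrite expr2 -{2}young_aba_inv {1}/h mulr_suml.
  rewrite exchange_big /= (eq_bigr (fun p => #|R|%:R * c)).
    by rewrite sumr_const -mulrnAl -mulr_natr -expr2.
  move=> p hp; rewrite (reindex_inj (mulIg p^-1)%g) /=.
  rewrite (eq_bigr (fun s => \sum_(p' in R) young s * young (s^-1 * p'))).
    rewrite exchange_big /= mulr_natl -sumr_const; apply: eq_bigr => p' hp'.
    by rewrite young_mul -[p']mulg1 young_rowl // young1 mulr1.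
  move=> s _; rewrite mulgKV /h mulr_sumr; apply: eq_bigr => p' _.
  by rewrite invMg invgK -mulgA young_rowl.
move=> E; rewrite -(pmulr_rgt0 _ (_ : 0 < #|R|%:R ^+ 2)) ?exprn_gt0 ?ltr0n // -E.
rewrite (bigD1 1%g) //= h1 ltr_wpDr ?exprn_gt0 ?ltr0n //.
by apply: sumr_ge0 => s _; rewrite real_exprn_even_ge0.
Qed.

Local Notation G := [set: 'S_n].
Local Notation rG := (regular_repr algC G).
Let d s : 'rV[algC]_#|G| := delta_mx 0 (gring_index G s).

Lemma d_inj s t : (d s 0 (gring_index G t)) = (t == s)%:R.
Proof.
rewrite mxE eqxx /=; congr (_%:R).
by rewrite -(inj_eq (@enum_val_inj _ _)) !gring_indexK ?inE.
Qed.

Lemma d_regular s t : d s *m rG t = d (s * t)%g.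
Proof. by rewrite -rowE rowK gring_indexK ?inE. Qed.

Lemma d_row m (A B : 'M[algC]_(#|G|, m)) : (forall s, d s *m A = d s *m B) -> A = B.
Proof.
by move=> AB; apply/row_matrixP => i; rewrite !rowE -(gring_valK i) AB.
Qed.

(** Left multiplication by the symmetrizer. It commutes with the right action and becomes, after
    division by [c], an equivariant projection onto the Specht module. *)
Definition young_mx : 'M[algC]_#|G| :=
  \matrix_i (\sum_s young s *: d (s * enum_val i)%g).
Local Notation L := young_mx.

Lemma d_young s : d s *m L = \sum_t young t *: d (t * s)%g.
Proof. by rewrite -rowE rowK gring_indexK ?inE. Qed.

Lemma young_mx_comm t : L *m rG t = rG t *m L.
Proof.
apply: d_row => s; rewrite !mulmxA d_regular !d_young mulmx_suml.
by apply: eq_bigr => u _; rewrite -scalemxAl d_regular mulgA.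
Qed.

Lemma young_mx_sqr : L *m L = c *: L.
Proof.
apply: d_row => s; rewrite mulmxA d_young mulmx_suml -scalemxAr d_young.
under eq_bigr => t _ do rewrite -scalemxAl d_young scaler_sumr
  (reindex_inj (mulIg t^-1)%g).
rewrite exchange_big /= scaler_sumr; apply: eq_bigr => u _.
rewrite scalerA -young_mul scaler_suml.
have injt : injective (fun t => u * t^-1)%g.
  by move=> t t' /mulgI /invg_inj.
rewrite [RHS](reindex_inj injt) /=; apply: eq_bigr => t _.
by rewrite scalerA invMg invgK mulgKV mulrC !mulgA mulgKV.
Qed.

Lemma young_symmetrizerE : young_symmetrizer la n = d 1%g *m L.
Proof.
rewrite d_young sum_young_scale; apply: eq_bigr => p _.
by apply: eq_bigr => q _; rewrite mulg1.
Qed.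

Lemma cyclic_young : (cyclic_mx rG (young_symmetrizer la n) :=: L)%MS.
Proof.
apply/eqmxP/andP; split.
  apply: cyclic_mx_sub; last by rewrite young_symmetrizerE submxMl.
  by apply/mxmoduleP => t _; rewrite young_mx_comm submxMl.
apply/row_subP => i; rewrite rowE -(gring_valK i) -/(d _).
rewrite -[enum_val i]mul1g -d_regular -mulmxA -young_mx_comm mulmxA.
by rewrite -young_symmetrizerE (mxmodule_trans (cyclic_mx_module _ _)) ?inE ?cyclic_mx_id.
Qed.

(** An equivariant projection computes the trace on its image, so no basis of the submodule has to
    be chosen. *)
Lemma trace_submod (gT : finGroupType) (H : {group gT}) m
    (rH : mx_representation algC H m) (U P : 'M_m) (modU : mxmodule rH U) x :
  (U :=: P)%MS -> P *m P = P -> P *m rH x = rH x *m P ->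
  \tr (submod_mx modU x) = \tr (P *m rH x).
Proof.
move=> UP PP Px; rewrite /submod_mx in_submodE.
have PE : P *m (in_submod U 1%:M *m val_submod (U := U) 1%:M) = P.
  by rewrite mulmxA -in_submodE -val_submodE in_submodK // UP.
have VP : val_submod (U := U) 1%:M *m P = val_submod (U := U) 1%:M.
  have /submxP[X ->] : (val_submod (U := U) 1%:M <= P)%MS by rewrite val_submod1 UP.
  by rewrite -mulmxA PP.
move: (val_submod _) (in_submod U 1%:M) PE VP => V I PE VP.
by rewrite -VP -!mulmxA mxtrace_mulC -!mulmxA (mulmxA P) Px -!mulmxA PE.
Qed.

(** The diagonal entry at [s] of left multiplication by the symmetrizer followed by [w] is the
    coefficient of the [t] with [t s w = s]. *)
Lemma chi_young w : chi la n w = c^-1 * \sum_s young (s * w^-1 * s^-1).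
Proof.
have c0 : c != 0 by rewrite gt_eqF ?young_scalar_gt0.
rewrite /chi /cfRepr cfunE inE mulr1n (@trace_submod _ _ _ _ _ (c^-1 *: L)).
- rewrite -scalemxAl mxtraceZ; congr (_ * _).
  rewrite (eq_bigl (mem G)) => [|s]; last by rewrite /= inE.
  rewrite [RHS]big_enum_val /=; apply: eq_bigr => i _.
  have -> : (L *m rG w) i i = (d (enum_val i) *m L *m rG w) 0 (gring_index G (enum_val i)).
    by rewrite gring_valK -mulmxA -rowE gring_valK [in RHS]mxE.
  rewrite d_young mulmx_suml summxE (bigD1 (enum_val i * w^-1 * (enum_val i)^-1)%g) //=.
  rewrite -scalemxAl d_regular mxE d_inj !mulgKV eqxx mulr1 big1 ?addr0 // => t nt.
  rewrite -scalemxAl d_regular mxE d_inj; case: eqP => [E|]; rewrite ?mulr0 //.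
  by case/eqP: nt; rewrite {1}E !mulgK.
- apply: (eqmx_trans cyclic_young); apply: eqmx_sym.
  by apply: eqmx_scale; rewrite invr_eq0.
- by rewrite -scalemxAl -scalemxAr young_mx_sqr !scalerA -mulrA mulVf // mulr1.
by rewrite -scalemxAl -scalemxAr young_mx_comm.
Qed.

End YoungSymmetrizer.

(** * The Jacobi-Trudi formula *)

Section PermutationCharacters.
Variables l n : nat.

Definition has_content (a : 'I_l -> int) (m : {ffun 'I_l -> nat}) : bool :=
  [forall i, (m i)%:Z == a i].

(** The permutation character of ['S_n] on the words of a given content. The content is integral
    because Jacobi-Trudi weights may be negative, and the character is then zero, as the formula
    requires. *)
Definition word_char (a : 'I_l -> int) (w : 'S_n) : nat :=
  #|[set U : {ffun 'I_n -> 'I_l} | fixes w U && has_content a (content U)]|.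

Lemma word_charV a w : word_char a w^-1 = word_char a w.
Proof.
apply: eq_card => U; rewrite !inE; congr (_ && _).
apply/forallP/forallP => fU i.
  by have := fU (w i); rewrite permK eq_sym.
by have := fU (w^-1 i)%g; rewrite permKV eq_sym.
Qed.

Lemma word_charJ a w s : word_char a (s * w * s^-1)%g = word_char a w.
Proof.
have injs v : injective (fun U : {ffun 'I_n -> 'I_l} => word_perm U v).
  by move=> U V /(congr1 (fun W => word_perm W v^-1%g)); rewrite !word_permM mulVg !word_perm1.
rewrite -[RHS](card_imset _ (injs s)); apply: eq_card => U; rewrite !inE.
apply/idP/imsetP => [/andP[fU cU]|[V]].
  exists (word_perm U s^-1); last by rewrite word_permM mulgV word_perm1.
  rewrite inE content_perm cU andbT; move: fU; rewrite !fixesE => /eqP fU.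
  rewrite word_permM -[in X in _ == X]fU word_permM.
  by rewrite -!mulgA mulKg.
rewrite inE !fixesE => /andP[/eqP fV cV] ->; rewrite content_perm cV andbT.
by rewrite word_permM mulgKV -word_permM fV.
Qed.
End PermutationCharacters.

(** Once [s] fixes everything below [j], the inequality at [j + 1] gives [s j <= j], and the smaller
    values are already taken. *)
Lemma perm_le_id l (s : 'S_l) :
  (forall k : nat, \sum_(j < l | j < k) s j <= \sum_(j < l | j < k) j)%N ->
  s = 1%g.
Proof.
move=> le_s; suff fix_s (k : nat) (j : 'I_l) : (j < k)%N -> s j = j.
  by apply/permP => j; rewrite perm1 (fix_s l).
elim: k j => // k IHk j; rewrite ltnS leq_eqVlt => /predU1P[jk|]; last exact: IHk.
have le_sj : (s j <= j)%N.
  have := le_s j.+1; rewrite !(bigD1 j (P := fun i : 'I_l => (i < j.+1)%N)) //=.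
  suff -> : (\sum_(i < l | (i < j.+1) && (i != j)) s i =
             \sum_(i < l | (i < j.+1) && (i != j)) i)%N by rewrite leq_add2r.
  apply: eq_bigr => i /andP[ij nij]; rewrite IHk //.
  by rewrite -jk ltn_neqAle nij -ltnS.
case: (ltngtP (s j) j) le_sj => // [sj _|/ord_inj //].
by have /perm_inj : s (s j) = s j by apply: IHk; rewrite -jk.
Qed.

(** * Pairing the Specht character with permutation characters *)

Section JacobiTrudi.
Variables (l : nat) (la : seq nat) (n : nat).
Hypotheses (la_part : is_partition la) (sumn_la : sumn la = n).
Hypothesis size_la : (size la <= l)%N.
Implicit Types (s t w q : 'S_n) (U : {ffun 'I_n -> 'I_l}).

Local Notation c := (young_scalar la n).
Local Notation young := (young la).
Local Notation chi := (chi la n).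

Lemma chi_real w : chi w \is Num.real.
Proof.
rewrite chi_young // rpredM //; last by apply: rpred_sum => s _; apply: young_real.
by rewrite rpredV gtr0_real ?young_scalar_gt0.
Qed.

Lemma chiV w : chi (w^-1)%g = chi w.
Proof. by rewrite char_inv ?cfRepr_char // (CrealP _) ?chi_real. Qed.

(** Orthogonality without Schur's lemma: expanding one factor over its conjugates gives [n!] equal
    terms, and in each the convolution has the form [e z e], which [young_sandwich] and [young_mul]
    evaluate to [c * c]. *)
Lemma sum_chi_sqr : \sum_w chi w * chi w = n`!%:R.
Proof.
have c0 : c != 0 by rewrite gt_eqF ?young_scalar_gt0.
pose T w := \sum_s young (s * w^-1 * s^-1)%g.
have chiT w : chi w = c^-1 * T w by apply: chi_young.
under eq_bigr => w _ do rewrite -{2}chiV !chiT mulrACA.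
rewrite -mulr_sumr; suff -> : \sum_w T w * T (w^-1)%g = n`!%:R * (c * c).
  by rewrite mulrCA -invfM mulVf ?mulr1 // mulf_neq0.
under eq_bigr => w _ do rewrite {1}/T mulr_suml.
rewrite exchange_big /= (eq_bigr (fun=> c * c)).
  by rewrite sumr_const mulr_natl -card_Sn.
move=> g _; have injg : injective (fun w => g^-1 * w^-1 * g)%g.
  by move=> u v /mulIg /mulgI /invg_inj.
rewrite (reindex_inj injg) /=.
rewrite (eq_bigr (fun u => \sum_h young u * young (h * u^-1 * h^-1))); last first.
  move=> u _; rewrite !invMg !invgK !mulgA mulgK mulgV mul1g mulr_sumr.
  rewrite (reindex_inj (mulIg g)) /=; apply: eq_bigr => h _.
  by rewrite !invMg !invgK !mulgA !mulgK.
rewrite exchange_big /= (eq_bigr (fun h => (\sum_t young t * young (h * t^-1)) *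
   young (h^-1))) => [|h _]; last exact: young_sandwich.
under eq_bigr do rewrite mulr_suml.
rewrite exchange_big /= (eq_bigr (fun t => \sum_h young h * (young t * young (t^-1 * h^-1)))).
  rewrite exchange_big /=; under eq_bigr do rewrite -mulr_sumr young_mul // mulrCA.
  by rewrite -mulr_sumr.
move=> t _; rewrite (reindex_inj (mulIg t)) /=; apply: eq_bigr => h _.
by rewrite mulgK invMg mulrAC mulrC.
Qed.

(** As [word_char] is a class function, the [n!] conjugates in the formula for [chi] contribute
    equally. *)
Lemma sum_word_char_chi (a : 'I_l -> int) : \sum_(w : 'S_n) (word_char a w)%:R * chi w =
  n`!%:R * c^-1 * \sum_(w : 'S_n) young w * (word_char a w)%:R.
Proof.
under eq_bigr => w _ do rewrite chi_young // mulrCA mulr_sumr.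
rewrite -mulr_sumr exchange_big /= mulrAC mulrC; congr (_ * _).
rewrite (eq_bigr (fun=> \sum_(w : 'S_n) young w * (word_char a w)%:R)).
  by rewrite sumr_const mulr_natl -card_Sn.
move=> s _; have injs : injective (fun w => s^-1 * w^-1 * s)%g.
  by move=> u v /mulIg /mulgI /invg_inj.
rewrite (reindex_inj injs) /=; apply: eq_bigr => w _.
have -> : (s^-1 * w^-1 * s = s^-1 * w^-1 * (s^-1)^-1)%g by rewrite invgK.
by rewrite word_charJ word_charV mulrC !invMg !invgK !mulgA !mulgK mulgV mul1g.
Qed.

Let F U : algC := \sum_w young w * (fixes w U)%:R.

Lemma sum_young_word_char (a : 'I_l -> int) : \sum_(w : 'S_n) young w * (word_char a w)%:R =
  \sum_(U | has_content a (content U)) F U.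
Proof.
rewrite exchange_big /=; apply: eq_bigr => w _; rewrite -mulr_sumr; congr (_ * _).
rewrite -natr_sum /word_char -sum1dep_card big_mkcondl /=; congr (_%:R).
Qed.

(** Right multiplication by the transposition of [i] and [j] does not affect whether [U] is fixed,
    and it reverses the sign of [young]. *)
Lemma sum_young_fixes_eq0 U i j : i != j -> cell_col la i = cell_col la j ->
  U i = U j -> F U = 0.
Proof.
move=> ij cij Uij; have tC : tperm i j \in col_group la n.
  by apply/mem_col_group => k; case: tpermP => [->|->|].
have : F U = - F U.
  rewrite {1}/F (reindex_inj (mulIg (tperm i j))) /= -sumrN.
  apply: eq_bigr => w _; rewrite young_colr // odd_tperm ij mulN1r mulNr.
  congr (- (_ * _%:R)); congr (nat_of_bool _); apply: eq_forallb => k; rewrite permM.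
  by congr (_ == _); case: tpermP => // ->; rewrite Uij.
by move/eqP; rewrite -subr_eq0 opprK -mulr2n mulrn_eq0 => /eqP.
Qed.

Lemma row_lt_l (i : 'I_n) : (cell_row la i < l)%N.
Proof. exact: leq_trans (cell_rowP sumn_la i) size_la. Qed.

Definition row_word q : {ffun 'I_n -> 'I_l} := [ffun i => Ordinal (row_lt_l (q i))].

Lemma content_row_word q i : content (row_word q) i = nth 0%N la i.
Proof.
rewrite -(card_row sumn_la) ffunE -[RHS](card_preimset _ (@perm_inj _ q)).
by apply: eq_card => j; rewrite !inE ffunE.
Qed.

Lemma card_below U k : #|[set i | (U i < k)%N]| = (\sum_(j < l | j < k) content U j)%N.
Proof.
rewrite -sum1dep_card (partition_big U (fun j : 'I_l => (j < k)%N)) //=.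
apply: eq_bigr => j jk; rewrite ffunE sum1dep_card; apply: eq_card => i.
by rewrite !inE andb_idl // => /eqP ->.
Qed.

Lemma card_row_below k : #|[set i : 'I_n | (cell_row la i < k)%N]| =
  (\sum_(j < l | (j < k)%N) nth 0%N la j)%N.
Proof.
rewrite (eq_bigr (content (row_word 1))) => [|i _]; last by rewrite content_row_word.
by rewrite -card_below; apply: eq_card => i; rewrite !inE ffunE perm1.
Qed.

Definition jt_weight (s : 'S_l) (i : 'I_l) : int :=
  (nth 0%N la i)%:Z - i%:Z + (s i)%:Z.

(** A column-injective word obeys the dominance bound on its letters below [k]. For the content
    [la_j - j + s j] this says that the first [k] values of [s] have at most the sum of those of the
    identity. *)
Lemma column_injective_jt (s : 'S_l) U : has_content (jt_weight s) (content U) ->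
  column_injective la (fun i => U i) -> s = 1%g.
Proof.
move=> /forallP cU injU; apply: perm_le_id => k.
have := column_injective_below_le la_part sumn_la k injU.
rewrite card_below card_row_below -(leq_add2r (\sum_(j < l | (j < k)%N) j)).
rewrite -big_split /= (eq_bigr (fun j : 'I_l => nth 0%N la j + s j)%N).
  by rewrite big_split leq_add2l.
move=> j _; have /eqP := cU j; rewrite /jt_weight.
by move/(congr1 (fun z => z + j%:Z)); rewrite addrAC subrK -!PoszD => -[].
Qed.

(** Words repeating a letter in a column cancel. The others force [s = 1] and are then the row words
    moved by column permutations, whose contributions form the expression [young_scalarE] for
    [c]. *)
Lemma sum_young_jt (s : 'S_l) :
  \sum_(w : 'S_n) young w * (word_char (jt_weight s) w)%:R = if s == 1%g then c else 0.
Proof.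
rewrite sum_young_word_char (bigID (fun U : {ffun 'I_n -> 'I_l} => [forall i,
  [forall j, (cell_col la i == cell_col la j) ==> ((U i == U j) ==> (i == j))]])) /=.
rewrite [X in _ + X]big1 ?addr0; last first.
  move=> U /andP[_ /forallPn[i /forallPn[j]]]; rewrite !negb_imply.
  by case/and3P => /eqP cij /eqP Uij ij; apply: sum_young_fixes_eq0 Uij.
have injP U : reflect (column_injective la (fun i => U i)) [forall i,
    [forall j, (cell_col la i == cell_col la j) ==> ((U i == U j) ==> (i == j))]].
  apply: (iffP forallP) => [h i j cij /ord_inj Uij|h i].
    by have /forallP/(_ j) := h i; rewrite cij Uij !eqxx => /eqP.
  apply/forallP => j; apply/implyP => /eqP cij; apply/implyP => /eqP Uij.
  by apply/eqP/h; rewrite ?Uij.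
case: (s =P 1%g) => [->|ns]; last first.
  by rewrite big1 // => U /andP[cU /injP /(column_injective_jt cU) /ns].
rewrite (eq_bigl (mem (row_word @: col_group la n))); last first.
  move=> U; apply/andP/imsetP => [[/forallP cU /injP injU]|[q qC ->]].
    have cUE j : content U j = nth 0%N la j.
      by have /eqP := cU j; rewrite /jt_weight perm1 subrK => -[].
    have [|q qC qE] := column_injective_straighten la_part sumn_la injU.
      by move=> k; rewrite card_below card_row_below; apply: eq_bigr.
    by exists q => //; apply/ffunP => i; apply: ord_inj; rewrite ffunE /= qE.
  split; first by apply/forallP => i; rewrite content_row_word /jt_weight perm1 subrK.
  apply/injP => i j cij; rewrite !ffunE /= => rij; apply: (@perm_inj _ q).
  by apply: cell_inj rij _; rewrite !((mem_col_group _ _) qC).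
rewrite big_imset /=; last first.
  move=> q q' /mem_col_group qC /mem_col_group qC' /ffunP eqq; apply/permP => i.
  by have /(congr1 val) := eqq i; rewrite !ffunE /= => /cell_inj; apply; rewrite qC qC'.
rewrite young_scalarE //; apply: eq_bigr => q qC.
rewrite /F -mulr_sumr.
(* Conjugation by [q] turns the stabiliser of [row_word q] into the row group. *)
have injq : injective (fun w => q * w * q^-1)%g by move=> u v /mulIg /mulgI.
rewrite (reindex_inj injq) /= mulr_sumr [RHS]big_mkcond /=; apply: eq_bigr => w _.
rewrite young_colr ?col_groupV // odd_permV.
have -> : fixes (q * w * q^-1)%g (row_word q) = (w \in row_group la n).
  apply/forallP/mem_row_group => [h i|h i].
    by have /eqP/(congr1 val) := h (q^-1 i)%g; rewrite !ffunE /= !permM !permKV.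
  by apply/eqP/ord_inj; rewrite !ffunE /= !permM permKV h.
by case: ifP; rewrite ?mulr1 ?mulr0.
Qed.
End JacobiTrudi.

(** * The bialternant identity *)

Section Bialternant.
Variables (K : comNzRingType) (l N : nat) (y : 'I_l -> K).

(** The generating polynomial of the complete symmetric functions, correct below degree [N]:
    truncated geometric series take the place of power series. *)
Definition hgen : {poly K} := \prod_k \poly_(m < N) y k ^+ m.

Definition hshift (a r : nat) : K := if (r <= a)%N then hgen`_(a - r) else 0.

(** Its coefficients are, up to sign, the elementary symmetric functions of the variables other than
    [y j]. *)
Let P j : {poly K} := \prod_(k | k != j) (1 - y k *: 'X).

Lemma size_P j : (size (P j) <= l)%N.
Proof.
apply: leq_trans (size_poly_prod_leq _ _) _.
have szF k : (size ((1 - y k *: 'X)%R : {poly K}) <= 2)%N.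
  rewrite (leq_trans (size_polyD _ _)) // geq_max size_poly1 /= size_polyN.
  by rewrite (leq_trans (size_scale_leq _ _)) ?size_polyX.
apply: (@leq_trans ((\sum_(k | k != j) 2).+1 - #|[pred k | k != j]|)%N).
  by apply: leq_sub2r; rewrite ltnS leq_sum.
rewrite sum_nat_const mulnS muln1 subSn ?leq_addr // addnK.
by rewrite (cardC1 j) card_ord; case: (l) j => [[]|].
Qed.

Lemma geom_mul (c : K) :
  (1 - c *: 'X) * \poly_(m < N) c ^+ m = 1 - c ^+ N *: 'X^N :> {poly K}.
Proof.
rewrite poly_def (eq_bigr (fun m : 'I_N => (c *: 'X) ^+ m)).
  by rewrite -exprZn -[RHS]opprB subrX1 -mulNr opprB.
by move=> m _; rewrite exprZn.
Qed.

(** Multiplication by [P j] cancels every geometric factor except that of [y j], up to terms of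
    degree at least [N]. *)
Lemma hgen_P j : exists Z, P j * hgen = (\poly_(m < N) y j ^+ m) * (1 + 'X^N * Z).
Proof.
have [Z ZE] : exists Z, \prod_(k | k != j) (1 - y k ^+ N *: 'X^N) = 1 + 'X^N * Z.
  elim/big_ind: _ => [|p q [Zp ->] [Zq ->]|k _].
  - by exists 0; rewrite mulr0 addr0.
  - exists (Zp + Zq + Zp * ('X^N * Zq)).
    by ring.
  by exists (- (y k ^+ N)%:P); rewrite mulrN mulrC mul_polyC.
exists Z; rewrite -ZE /hgen (bigD1 j) //= mulrCA -big_split /=.
by congr (_ * _); apply: eq_bigr => k _; rewrite geom_mul.
Qed.

(** The coefficient of degree [a] in [hgen_P]. The point is that the factors [(P j)_r] do not depend
    on [a]. *)
Lemma power_hshift a j : (a < N)%N ->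
  y j ^+ a = \sum_(r < l) hshift a r * (P j)`_r.
Proof.
move=> aN; have [Z ZE] := hgen_P j.
have : (P j * hgen)`_a = y j ^+ a.
  by rewrite ZE mulrDr mulr1 coefD coef_poly aN mulrCA coefXnM aN addr0.
move <-; rewrite coefM.
pose M := maxn a.+1 l.
have trunc (F : nat -> K) k : (k <= M)%N -> (forall r, (k <= r)%N -> F r = 0) ->
    \sum_(r < k) F r = \sum_(r < M) F r.
  move=> kM F0; rewrite (big_ord_widen M F kM) [RHS](bigID (fun r : 'I_M => (r < k)%N)) /=.
  by rewrite [X in _ = _ + X]big1 ?addr0 // => r; rewrite -leqNgt; apply: F0.
pose F r := hshift a r * (P j)`_r.
rewrite (eq_bigr (fun r : 'I_a.+1 => F r)) => [|r _].
  rewrite (trunc F a.+1) ?leq_maxl // => [|r ar]; last first.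
    by rewrite /F /hshift leqNgt ar mul0r.
  rewrite (trunc F l) ?leq_maxr // => r lr.
  by rewrite /F nth_default ?mulr0 // (leq_trans (size_P j)).
by rewrite /F /hshift -ltnS ltn_ord mulrC.
Qed.

Definition alternant (a : 'I_l -> nat) : K := \det (\matrix_(i, k) y k ^+ a i).

Lemma hgen0 : (0 < N)%N -> hgen`_0 = 1.
Proof.
move=> N0; rewrite -horner_coef0 horner_prod big1 // => k _.
by rewrite horner_coef0 coef_poly N0.
Qed.

(** The matrix of powers is a matrix of complete functions times a matrix [C] independent of the
    exponents. For the Vandermonde exponents the first factor is triangular with unit diagonal, so
    the determinant of [C] is the Vandermonde alternant. *)
Lemma bialternant (a : 'I_l -> nat) : (l <= N)%N -> (forall i, a i < N)%N ->
  alternant a = \det (\matrix_(i, j) hshift (a i) (rev_ord j)) *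
                alternant (fun i => rev_ord i).
Proof.
move=> lN aN; pose C := \matrix_(r, k) (P k)`_(@rev_ord l r).
have factor (b : 'I_l -> nat) : (forall i, b i < N)%N -> \matrix_(i, k) y k ^+ b i =
    (\matrix_(i, j) hshift (b i) (rev_ord j)) *m C.
  move=> bN; apply/matrixP => i k; rewrite !mxE power_hshift //.
  by rewrite (reindex_inj rev_ord_inj); apply: eq_bigr => r _; rewrite !mxE.
have det1 : \det (\matrix_(i, j) hshift (rev_ord i) (@rev_ord l j)) = 1.
  rewrite -det_tr det_trig.
    rewrite big1 // => i _; rewrite !mxE /hshift leqnn subnn hgen0 //.
    exact: leq_trans (leq_ltn_trans _ (ltn_ord i)) lN.
  apply/is_trig_mxP => i j ij; rewrite !mxE /hshift leqNgt.
  by rewrite ltn_sub2l //= ?ltnS // (leq_ltn_trans _ (ltn_ord j)).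
rewrite /alternant !factor ?det_mulmx ?det1 ?mul1r // => i.
exact: leq_trans (ltn_ord _) lN.
Qed.
End Bialternant.

(** * Signed counts of two-dimensional arrays *)

Section ContingencyTables.
Variables (l N : nat).
Implicit Types a b : 'I_l -> nat.

Local Notation X := (fun k : 'I_l => 'X_k : {mpoly int[l]}).
Local Notation mono a := [multinom (a : 'I_l -> nat) k | k < l].

Lemma alternantE a : alternant X a =
  \sum_(s : 'S_l) (-1) ^+ s * 'X_[mono (fun k => a (s^-1 k)%g)].
Proof.
apply: eq_bigr => s _; congr (_ * _); rewrite mpolyXE_id.
rewrite [RHS](reindex_inj (@perm_inj _ s)); apply: eq_bigr => i _.
by rewrite mxE mnmE permK.
Qed.

Lemma mcoeff_sign (s : 'S_l) (p : {mpoly int[l]}) m :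
  ((-1) ^+ s * p)@_m = (-1) ^+ s * p@_m.
Proof. by case: (odd_perm s); rewrite ?expr1 ?expr0 ?mulN1r ?mul1r ?mcoeffN. Qed.

(** Injectivity of [a] makes the monomials of different permutations distinct. *)
Lemma mcoeff_alternant a : injective a -> (alternant X a)@_(mono a) = 1.
Proof.
move=> inja; rewrite alternantE raddf_sum /= (bigD1 1%g) //=.
rewrite mcoeff_sign mcoeffX odd_perm1 mul1r big1 ?addr0 => [|s ns].
  by case: eqP => // [[]]; apply/mnmP => k; rewrite !mnmE invg1 perm1.
rewrite mcoeff_sign mcoeffX; case: eqP => [/mnmP E|]; rewrite ?mulr0 //.
case/eqP: ns; apply/permP => k; rewrite perm1.
by have := E (s k); rewrite !mnmE -[X in (s^-1)%g X]/(s k) permK => /inja.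
Qed.

Lemma hshiftE (a r : nat) : hshift N X a r =
  \sum_(f : {ffun 'I_l -> 'I_N} | (\sum_k f k + r == a)%N) 'X_[mono (fun k => f k : nat)].
Proof.
have hE z : (hgen N X)`_z = \sum_(f : {ffun 'I_l -> 'I_N} | (\sum_k f k == z)%N)
    'X_[mono (fun k => f k : nat)].
  rewrite /hgen; under eq_bigr do rewrite poly_def.
  rewrite bigA_distr_bigA /= coef_sum [RHS]big_mkcond /=; apply: eq_bigr => f _.
  rewrite scaler_prod -expr_sum coefZ coefXn eq_sym.
  case: eqP => _; rewrite ?mulr0 // mulr1 mpolyXE_id.
  by apply: eq_bigr => k _; rewrite mnmE.
rewrite /hshift; case: leqP => ra; first by rewrite hE; apply: eq_bigl => f;
  rewrite -(eqn_add2r r) subnK.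
rewrite big_pred0 // => f; apply/negbTE; rewrite eq_sym neq_ltn.
by rewrite (leq_trans ra) ?leq_addl.
Qed.
(** Each factor expands over the possible rows of an array with prescribed row sum; the exponent of
    the product is then a condition on the column sums. *)
Lemma mcoeff_prod_hshift a (s t : 'S_l) :
  ((\prod_i hshift N X (a i) (rev_ord (s i))) *
     'X_[mono (fun k => rev_ord (t k))])@_(mono a) =
  #|[set F : {ffun 'I_l * 'I_l -> 'I_N} |
      [forall i, \sum_j F (i, j) + rev_ord (s i) == a i]%N &&
      [forall j, \sum_i F (i, j) + rev_ord (t j) == a j]%N]|%:R.
Proof.
under eq_bigr do rewrite hshiftE.
rewrite bigA_distr_big_dep mulr_suml raddf_sum /= -sum1dep_card natr_sum.
under eq_bigr => F _ do rewrite mprodXE -mpolyXD mcoeffX.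
pose curry (F : {ffun 'I_l * 'I_l -> 'I_N}) :
    {ffun 'I_l -> {ffun 'I_l -> 'I_N}} := [ffun i => [ffun j => F (i, j)]].
pose uncurry (F : {ffun 'I_l -> {ffun 'I_l -> 'I_N}}) :
    {ffun 'I_l * 'I_l -> 'I_N} :=
  [ffun p : 'I_l * 'I_l => F p.1 p.2].
rewrite (reindex_onto curry uncurry) /=; last first.
  by move=> F _; apply/ffunP => i; apply/ffunP => j; rewrite !ffunE.
rewrite big_mkcond [RHS]big_mkcond; apply: eq_bigr => F _ /=.
have -> : uncurry (curry F) == F by apply/eqP/ffunP => -[i j]; rewrite !ffunE.
rewrite andbT; have -> : (curry F \in family (fun i (f : {ffun 'I_l -> 'I_N}) =>
    \sum_k f k + rev_ord (s i) == a i)%N) =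
    [forall i, \sum_j F (i, j) + rev_ord (s i) == a i]%N.
  have E i : (\sum_k curry F i k = \sum_k F (i, k))%N by under eq_bigr do rewrite !ffunE.
  apply/familyP/forallP => h i; first by rewrite -E; apply: h.
  by rewrite unfold_in /= E; apply: h.
case: [forall i, _] => //=; set b := (X in (nat_of_bool X)%:R).
suff -> : b = [forall j, \sum_i F (i, j) + rev_ord (t j) == a j]%N by case: ifP.
have E j : (\sum_i mono (fun k => curry F i k : nat) + mono (fun k => rev_ord (t k) : nat))%MM j =
    (\sum_i F (i, j) + rev_ord (t j))%N.
  by rewrite mnmDE mnm_sumE mnmE; under eq_bigr do rewrite mnmE !ffunE.
apply/idP/forallP => [/eqP/mnmP h j|h]; first by rewrite -E h mnmE.
by apply/eqP/mnmP => j; rewrite E mnmE; apply/eqP.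
Qed.

(** This compares the coefficients of the monomial with exponents [a] in the bialternant identity,
    the determinant of complete functions being expanded over [s] and the Vandermonde alternant over
    [t]. *)
Lemma alternating_tables a : injective a -> (l <= N)%N -> (forall i, a i < N)%N ->
  \sum_(s : 'S_l) \sum_(t : 'S_l) (-1) ^+ s * ((-1) ^+ t *
    #|[set F : {ffun 'I_l * 'I_l -> 'I_N} |
      [forall i, \sum_j F (i, j) + rev_ord (s i) == a i]%N &&
      [forall j, \sum_i F (i, j) + rev_ord (t j) == a j]%N]|%:R) = 1 :> int.
Proof.
move=> inja lN aN; rewrite -[RHS](mcoeff_alternant inja) (bialternant X lN aN).
rewrite alternantE mulr_suml raddf_sum /=.
apply: eq_bigr => s _; rewrite -mulrA mcoeff_sign mulr_sumr raddf_sum mulr_sumr /=.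
rewrite [RHS](reindex_inj invg_inj); apply: eq_bigr => t _; congr (_ * _).
rewrite odd_permV invgK mulrCA mcoeff_sign; congr (_ * _).
rewrite -mcoeff_prod_hshift; congr (mcoeff _ (_ * _)).
by apply: eq_bigr => i _; rewrite mxE.
Qed.
End ContingencyTables.

(** * Words over a product alphabet *)

Section ProductWords.
Variables (n : nat) (K1 K2 : finType).

Definition marginal1 (m : {ffun K1 * K2 -> nat}) : {ffun K1 -> nat} :=
  [ffun i => \sum_j m (i, j)]%N.
Definition marginal2 (m : {ffun K1 * K2 -> nat}) : {ffun K2 -> nat} :=
  [ffun j => \sum_i m (i, j)]%N.

Lemma content_marginal1 (W : {ffun 'I_n -> K1 * K2}) :
  content [ffun x => (W x).1] = marginal1 (content W).
Proof.
apply/ffunP => i; rewrite !ffunE -sum1dep_card.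
rewrite (partition_big (fun x => (W x).2) predT) //=; apply: eq_bigr => j _.
rewrite sum1dep_card ffunE; apply: eq_card => x; rewrite !inE ffunE.
by case: (W x).
Qed.

Lemma content_marginal2 (W : {ffun 'I_n -> K1 * K2}) :
  content [ffun x => (W x).2] = marginal2 (content W).
Proof.
apply/ffunP => i; rewrite !ffunE -sum1dep_card.
rewrite (partition_big (fun x => (W x).1) predT) //=; apply: eq_bigr => j _.
rewrite sum1dep_card ffunE; apply: eq_card => x; rewrite !inE ffunE andbC.
by case: (W x).
Qed.

(** A pair of words is one word over the product alphabet, and its content is an array whose margins
    are the two contents. Products of permutation characters thus become single ones, ready for
    Burnside. *)
Lemma card_fixed_product (Q1 : pred {ffun K1 -> nat}) (Q2 : pred {ffun K2 -> nat})
    (w : 'S_n) :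
  (#|[set U : {ffun 'I_n -> K1} | fixes w U && Q1 (content U)]| *
   #|[set V : {ffun 'I_n -> K2} | fixes w V && Q2 (content V)]| =
   #|[set W : {ffun 'I_n -> K1 * K2} | fixes w W &&
       (Q1 (marginal1 (content W)) && Q2 (marginal2 (content W)))]|)%N.
Proof.
rewrite -cardsX; pose f (p : {ffun 'I_n -> K1} * {ffun 'I_n -> K2}) :=
  [ffun x => (p.1 x, p.2 x)].
have f1 p : [ffun x => (f p x).1] = p.1 by apply/ffunP => x; rewrite !ffunE.
have f2 p : [ffun x => (f p x).2] = p.2 by apply/ffunP => x; rewrite !ffunE.
have injf : injective f.
  by move=> p q E; rewrite [p]surjective_pairing -f1 -f2 E f1 f2 -surjective_pairing.
have fixf p : fixes w (f p) = fixes w p.1 && fixes w p.2.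
  apply/forallP/andP => [h|[/forallP h1 /forallP h2] x].
    split; apply/forallP => x; have := h x; rewrite !ffunE => /eqP[E1 E2];
    by rewrite ?E1 ?E2.
  by rewrite !ffunE (eqP (h1 x)) (eqP (h2 x)).
have mem p : (f p \in [set W : {ffun 'I_n -> K1 * K2} | fixes w W &&
       (Q1 (marginal1 (content W)) && Q2 (marginal2 (content W)))]) =
   (p \in setX [set U : {ffun 'I_n -> K1} | fixes w U && Q1 (content U)]
      [set V : {ffun 'I_n -> K2} | fixes w V && Q2 (content V)]).
  rewrite !inE -content_marginal1 -content_marginal2 f1 f2 fixf; exact: andbACA.
rewrite -(card_imset _ injf); apply: eq_card => W; apply/imsetP/idP => [[p hp ->]|hW].
  by rewrite mem.
have WE : W = f ([ffun x => (W x).1], [ffun x => (W x).2]).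
  by apply/ffunP => x; rewrite !ffunE; case: (W x).
by exists ([ffun x => (W x).1], [ffun x => (W x).2]); rewrite -?mem -?WE.
Qed.
End ProductWords.

(** * Identification of the Specht character *)

Section CharacterFormula.
Variables (l : nat) (la : seq nat) (n : nat).
Hypotheses (la_part : is_partition la) (sumn_la : sumn la = n).
Hypothesis size_la : (size la <= l)%N.
Implicit Types (s t u : 'S_l) (w : 'S_n).

Definition jt_char w : algC :=
  \sum_(s : 'S_l) (-1) ^+ s * (word_char (jt_weight la s) w)%:R.

Lemma sum_parts : (\sum_(i < l) nth 0%N la i = n)%N.
Proof.
rewrite -sumn_la sumnE (big_nth 0%N) big_mkord (big_ord_widen _ _ size_la).
rewrite [RHS]big_mkcond; apply: eq_bigr => i _.
by case: ltnP => // h; rewrite nth_default.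
Qed.

Lemma sum_jt_weight s : \sum_i jt_weight la s i = n%:Z.
Proof.
rewrite big_split sumrB /= [X in _ - X](reindex_inj (@perm_inj _ s)) /= subrK.
by rewrite -sum_parts -(raddf_sum Posz).
Qed.

Lemma sum_jt_char_sqr : \sum_w jt_char w * jt_char w = n`!%:R.
Proof.
(* The exponents are the partition plus the staircase, strictly decreasing and hence injective; [N]
   exceeds all of them. *)
pose N := (n + l).+1; pose a (i : 'I_l) := (nth 0%N la i + rev_ord i)%N.
have le_n i : (nth 0%N la i <= n)%N.
  case: (ltnP i l) => il; last by rewrite nth_default ?(leq_trans size_la).
  by rewrite -sum_parts (bigD1 (Ordinal il)) //= leq_addr.
have inja : injective a.
  move=> i j; rewrite /a /= => E; apply: ord_inj; case: (ltngtP i j) => // ij.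
    by have := nth_part_anti la_part (ltnW ij); have := ltn_ord i; have := ltn_ord j; lia.
  by have := nth_part_anti la_part (ltnW ij); have := ltn_ord i; have := ltn_ord j; lia.
have lN : (l <= N)%N by rewrite /N; lia.
have aN i : (a i < N)%N by rewrite /a /N /=; have := le_n i; have := ltn_ord i; lia.
have mE s i (z : nat) : (z + rev_ord (s i) == a i)%N = (z%:Z == jt_weight la s i).
  rewrite /a /jt_weight /=; have := ltn_ord i; have := ltn_ord (s i).
  by move=> ? ?; apply/eqP/eqP => h; lia.
have := alternating_tables inja lN aN => /(congr1 (fun z : int => n`!%:R * z%:~R : algC)).
rewrite mulr1 => <-.
under eq_bigr do rewrite mulr_suml.
rewrite exchange_big rmorph_sum mulr_sumr /=; apply: eq_bigr => s _.
under eq_bigr do rewrite mulr_sumr.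
rewrite exchange_big rmorph_sum mulr_sumr /=; apply: eq_bigr => t _.
rewrite !rmorphM !rmorph_sign rmorph_nat.
under eq_bigr do rewrite mulrACA -natrM card_fixed_product.
rewrite -mulr_sumr -natr_sum (@sum_fixed_words _ _ N (fun m =>
  has_content (jt_weight la s) (marginal1 m) &&
  has_content (jt_weight la t) (marginal2 m))) ?natrM; last by rewrite /N; lia.
rewrite !mulrA [_ * n`!%:R]mulrC !mulrA; congr (_ * _ * _ * _%:R).
apply: eq_card => m; rewrite !inE.
have -> : has_content (jt_weight la s) (marginal1 [ffun k => m k : nat]) =
    [forall i, \sum_j m (i, j) + rev_ord (s i) == a i]%N.
  by apply: eq_forallb => i; rewrite mE ffunE; under eq_bigr do rewrite ffunE.
have -> : has_content (jt_weight la t) (marginal2 [ffun k => m k : nat]) =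
    [forall i, \sum_j m (j, i) + rev_ord (t i) == a i]%N.
  by apply: eq_forallb => i; rewrite mE ffunE; under eq_bigr do rewrite ffunE.
(* The total [n] of the array is already forced by its row sums. *)
rewrite andb_idl // => /andP[/forallP h _].
have -> : (\sum_k m k = \sum_i \sum_j m (i, j))%N.
  by rewrite pair_bigA; apply: eq_bigr => -[].
rewrite -eqz_nat -(sum_jt_weight s).
rewrite (raddf_sum Posz) /=; apply/eqP/eq_bigr => i _.
by apply/eqP; rewrite -mE h.
Qed.

Lemma chi_jt w : chi la n w = jt_char w.
Proof.
have real_jt v : jt_char v \is Num.real.
  by apply: rpred_sum => s _; rewrite rpredM ?rpredX ?rpredN ?rpred1 ?realn.
have real_chi v : chi la n v \is Num.real := chi_real la_part sumn_la v.
have c0 : young_scalar la n != 0 by rewrite gt_eqF ?young_scalar_gt0.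
(* By [sum_young_jt] only the identity permutation contributes, and its factor [c] cancels the one
   in [sum_word_char_chi]. *)
have cross : \sum_v jt_char v * chi la n v = n`!%:R.
  under eq_bigr do rewrite mulr_suml.
  rewrite exchange_big (bigD1 1%g) //= [X in _ + X]big1 ?addr0 => [|s ns].
    under eq_bigr do rewrite -mulrA.
    rewrite -mulr_sumr sum_word_char_chi // sum_young_jt // eqxx odd_perm1 mul1r.
    by rewrite mulfVK.
  under eq_bigr do rewrite -mulrA.
  by rewrite -mulr_sumr sum_word_char_chi // sum_young_jt // (negPf ns) !mulr0.
(* The three products give [n! + n! - 2 n! = 0], and the summands are squares of real numbers. *)
have : \sum_v (jt_char v - chi la n v) ^+ 2 = 0.
  rewrite (eq_bigr (fun v => jt_char v * jt_char v + chi la n v * chi la n v -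
    (jt_char v * chi la n v) *+ 2)); last by move=> v _; ring.
  rewrite sumrB big_split /= sum_jt_char_sqr sum_chi_sqr // sumrMnl cross.
  by rewrite mulr2n subrr.
move/eqP; rewrite psumr_eq0 => [/allP/(_ w)|v _]; last first.
  by rewrite real_exprn_even_ge0 // rpredB.
by rewrite mem_index_enum => /(_ isT); rewrite /= sqrf_eq0 subr_eq0 eq_sym => /eqP.
Qed.
End CharacterFormula.

(** * Kronecker coefficients and linear systems in binary *)

Section KroneckerTables.
Variables (l N : nat).

Definition table_count (la mu nu : seq nat) (s t u : 'S_l) : nat :=
  #|[set m : {ffun 'I_l * 'I_l * 'I_l -> 'I_N} |
      let m' := [ffun k => m k : nat] in
      [&& has_content (jt_weight la s) (marginal1 (marginal1 m')),
          has_content (jt_weight mu t) (marginal2 (marginal1 m'))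
        & has_content (jt_weight nu u) (marginal2 m')]]|.

(** The product of three permutation characters is one on words over triples, and Burnside replaces
    its average by a number of three-dimensional arrays. Entries are at most [sumn la], hence below
    [N]. *)
Lemma kronecker_tables la mu nu : kronecker_instance l la mu nu ->
  (sumn la < N)%N ->
  kronecker la mu nu =
  (\sum_(s : 'S_l) \sum_(t : 'S_l) \sum_(u : 'S_l) (-1) ^+ s * ((-1) ^+ t * ((-1) ^+ u *
     (table_count la mu nu s t u)%:R)) : int)%:~R.
Proof.
case/and4P => /and3P[pla pmu pnu] /eqP Emu /eqP Enu /and3P[zla zmu znu].
rewrite /kronecker; set n := sumn la => nN.
have n0 : n`!%:R != 0 :> algC by rewrite pnatr_eq0 -lt0n fact_gt0.
rewrite -[RHS](mulKf n0); congr (_ * _).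
under eq_bigr => w _ do rewrite (chi_jt pla erefl zla)
  (chi_jt pmu (esym Emu) zmu) (chi_jt pnu (etrans (esym Enu) (esym Emu)) znu) /jt_char !mulr_suml.
rewrite exchange_big rmorph_sum mulr_sumr /=; apply: eq_bigr => s _.
under eq_bigr => w _ do rewrite -mulrA mulr_suml mulr_sumr.
rewrite exchange_big rmorph_sum mulr_sumr /=; apply: eq_bigr => t _.
under eq_bigr => w _ do rewrite !mulr_sumr.
rewrite exchange_big rmorph_sum mulr_sumr /=; apply: eq_bigr => u _.
rewrite !rmorphM !rmorph_sign rmorph_nat.
pose Q12 (m : {ffun 'I_l * 'I_l -> nat}) :=
  has_content (jt_weight la s) (marginal1 m) && has_content (jt_weight mu t) (marginal2 m).
pose Q (m : {ffun 'I_l * 'I_l * 'I_l -> nat}) :=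
  Q12 (marginal1 m) && has_content (jt_weight nu u) (marginal2 m).
rewrite (eq_bigr (fun w : 'S_n => (-1) ^+ s * ((-1) ^+ t * ((-1) ^+ u *
  #|[set W : {ffun 'I_n -> 'I_l * 'I_l * 'I_l} | fixes w W && Q (content W)]|%:R)))); last first.
  move=> w _; rewrite -(card_fixed_product Q12 (has_content (jt_weight nu u))).
  rewrite natrM -(card_fixed_product (has_content (jt_weight la s)) (has_content (jt_weight mu t))).
  rewrite natrM /word_char.
  move: (_%:R) (_%:R) (_%:R) ((-1) ^+ s) ((-1) ^+ t) ((-1) ^+ u) => x y z a b c.
  ring.
rewrite -!mulr_sumr -natr_sum (sum_fixed_words Q nN) natrM.
rewrite (mulrCA ((-1) ^+ u)) (mulrCA ((-1) ^+ t)) (mulrCA ((-1) ^+ s)).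
congr (_ * (_ * (_ * (_ * _%:R)))).
apply: eq_card => m; rewrite !inE /Q /Q12 -andbA andb_idl // => /and3P[/forallP h _ _].
have -> : (\sum_k m k = \sum_i marginal1 (marginal1 [ffun k => m k : nat]) i)%N.
  under [RHS]eq_bigr do rewrite ffunE; under [RHS]eq_bigr do under eq_bigr do rewrite ffunE.
  rewrite pair_bigA /= pair_bigA /=; apply: eq_bigr => -[[i j] k] _; by rewrite ffunE.
rewrite -eqz_nat (raddf_sum Posz) /= (eq_bigr _ (fun i _ => eqP (h i))).
by rewrite (sum_jt_weight erefl).
Qed.
End KroneckerTables.

(** * Digit recursion for linear systems [A m = B x + c] *)

Section BinarySystem.
Variables (V E X : finType) (A : V -> E -> int) (B : X -> E -> int).
Implicit Types (x : X -> nat) (r : {ffun X -> bool}) (s : {ffun V -> bool}).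

Definition solves (x : X -> int) (c : E -> int) (m : V -> int) : bool :=
  [forall e, \sum_v A v e * m v == \sum_i B i e * x i + c e].

Definition solution_count k x (c : E -> int) : nat :=
  #|[set m : {ffun V -> 'I_(2 ^ k)} |
     solves (fun i => (x i)%:Z) c (fun v => (m v)%:Z)]|.

Definition carry_rel r s (c c' : E -> int) : bool :=
  [forall e, \sum_i B i e * (r i)%:Z + c e - \sum_v A v e * (s v)%:Z == c' e *+ 2].

Lemma sum_double (I : finType) (F : I -> int) (z : I -> nat) (b : I -> bool) :
  \sum_i F i * ((z i).*2%:Z + (b i)%:Z) =
  (\sum_i F i * (z i)%:Z) *+ 2 + \sum_i F i * (b i)%:Z.
Proof.
rewrite -sumrMnl -big_split /=; apply: eq_bigr => i _.
by rewrite -addnn PoszD; ring.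
Qed.

Lemma solves_double x r m s c c' : carry_rel r s c c' ->
  solves (fun i => (x i).*2%:Z + (r i)%:Z) c (fun v => (m v).*2%:Z + (s v)%:Z) =
  solves (fun i => (x i)%:Z) c' (fun v => (m v : nat)%:Z).
Proof.
move=> /forallP h; apply: eq_forallb => e; have /eqP := h e.
rewrite !sum_double; set a := \sum_v _; set b := \sum_i _; set a1 := \sum_v _; set b1 := \sum_i _.
by move=> Ec; apply/eqP/eqP; lia.
Qed.

Lemma solves_carry x r m s c :
  solves (fun i => (x i).*2%:Z + (r i)%:Z) c (fun v => (m v : nat).*2%:Z + (s v)%:Z) ->
  exists c', carry_rel r s c c'.
Proof.
move=> h.
exists (fun e => \sum_v A v e * (m v)%:Z - \sum_i B i e * (x i)%:Z).
apply/forallP => e; have /eqP := forallP h e.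
rewrite !sum_double; set a := \sum_v _; set b := \sum_i _; set a1 := \sum_v _; set b1 := \sum_i _.
by move=> Ec; apply/eqP; lia.
Qed.

Variable W : nat.
Hypothesis W_large : forall e, (\sum_v `|A v e| + \sum_i `|B i e| <= W)%N.

Definition carry_val (c : {ffun E -> 'I_(W.*2.+1)}) (e : E) : int := (c e)%:Z - W%:Z.

Definition carry_matrix r (c c' : {ffun E -> 'I_(W.*2.+1)}) : nat :=
  #|[set s | carry_rel r s (carry_val c) (carry_val c')]|.

(** A shift of size at most [W] and a contribution of the bits of size at most [W] have a sum whose
    half is again at most [W], so the box of shifts is closed under the recursion. *)
Lemma carry_bounded r s c (c' : E -> int) : carry_rel r s (carry_val c) c' ->
  exists d, c' =1 carry_val d.
Proof.
move=> /forallP h.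
have bit (I : finType) (F : I -> int) (b : I -> bool) :
    (`|(\sum_i F i * (b i)%:Z)%R| <= \sum_i `|F i|)%N.
  rewrite -lez_nat abszE (raddf_sum Posz) /=; apply: le_trans (ler_norm_sum _ _ _) _.
  by apply: ler_sum => i _; case: (b i); rewrite ?mulr1 ?mulr0 ?normr0 abszE.
have bound e : (`|c' e| <= W)%N.
  have /eqP := h e; have := W_large e; have := bit _ (A^~ e) s; have := bit _ (B^~ e) r.
  rewrite /carry_val; have := ltn_ord (c e).
  set a := \sum_v _; set b := \sum_i _; lia.
have lt e : (`|(c' e + W%:Z)%R| < W.*2.+1)%N by have := bound e; lia.
exists [ffun e => Ordinal (lt e)] => e; rewrite /carry_val ffunE /=.
by have := bound e; lia.
Qed.

Lemma carry_val_inj c d : carry_val c =1 carry_val d -> c = d.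
Proof.
by move=> h; apply/ffunP => e; apply: ord_inj; have := h e; rewrite /carry_val; lia.
Qed.

(** Writing [m = 2 m' + s] is a bijection, and [c], [r], [s] admit at most one carry [c'], so the
    sum over [c'] counts each solution once. *)
Lemma solution_count_double k x r c :
  solution_count k.+1 (fun i => (x i).*2 + r i)%N (carry_val c) =
  (\sum_c' carry_matrix r c c' * solution_count k x (carry_val c'))%N.
Proof.
have ltd (m : 'I_(2 ^ k)) (b : bool) : (m.*2 + b < 2 ^ k.+1)%N.
  by rewrite expnS; have := ltn_ord m; case: b; lia.
have lth (m : 'I_(2 ^ k.+1)) : (m./2 < 2 ^ k)%N.
  by have := ltn_ord m; have := expnS 2 k; lia.
pose f (p : {ffun V -> 'I_(2 ^ k)} * {ffun V -> bool}) : {ffun V -> 'I_(2 ^ k.+1)} :=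
  [ffun v => Ordinal (ltd (p.1 v) (p.2 v))].
pose g (m : {ffun V -> 'I_(2 ^ k.+1)}) : {ffun V -> 'I_(2 ^ k)} * {ffun V -> bool} :=
  ([ffun v => Ordinal (lth (m v))], [ffun v => odd (m v)]).
have gK : cancel g f.
  move=> m; apply/ffunP => v; apply: ord_inj; rewrite !ffunE /=.
  by rewrite addnC odd_double_half.
have fK : cancel f g.
  move=> [m s]; congr pair; apply/ffunP => v; rewrite !ffunE /=.
    by apply: ord_inj => /=; case: (s v); lia.
  by rewrite oddD odd_double oddb.
pose double (p : {ffun V -> 'I_(2 ^ k)} * {ffun V -> bool}) :=
  solves (fun i => (x i).*2%:Z + (r i)%:Z) (carry_val c)
    (fun v => (p.1 v : nat).*2%:Z + (p.2 v)%:Z).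
pose half (p : {ffun V -> 'I_(2 ^ k)} * {ffun V -> bool}) d :=
  carry_rel r p.2 (carry_val c) (carry_val d) &&
  solves (fun i => (x i)%:Z) (carry_val d) (fun v => (p.1 v)%:Z).
have doubleE p : (double p : nat) = (\sum_d half p d)%N.
  case: (boolP (double p)) => [dp|ndp]; last first.
    rewrite big1 // => d _; apply/eqP; rewrite eqb0; apply: contra ndp.
    by case/andP => hd hs; rewrite /double (solves_double x (fun v => p.1 v : nat) hd).
  have [c' hc'] := solves_carry dp; have [d dE] := carry_bounded hc'.
  have hd : carry_rel r p.2 (carry_val c) (carry_val d).
    by apply/forallP => e; rewrite -dE; apply: (forallP hc').
  rewrite (bigD1 d) //= /half hd -(solves_double x (fun v => p.1 v : nat) hd) -/(double p) dp.
  rewrite big1 // => d' nd.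
  apply/eqP; rewrite eqb0; apply: contra nd => /andP[/forallP hd' _].
  apply/eqP/carry_val_inj => e; have /eqP := hd' e; have /eqP := forallP hd e.
  by move=> -> /eqP; rewrite eqrMn2r //= => /eqP.
rewrite /solution_count -sum1dep_card (reindex f) /=; last first.
  by exists g => p _; rewrite ?gK ?fK.
rewrite big_mkcond (eq_bigr (fun p => \sum_d half p d)%N) => [|p _]; last first.
  rewrite -doubleE /double; set b1 := solves _ _ _; set b2 := solves _ _ _.
  suff -> : b1 = b2 by case: b2.
  apply: eq_forallb => e; congr (_ == _ + _); apply: eq_bigr => i _.
    by rewrite ffunE /= PoszD.
rewrite exchange_big /=; apply: eq_bigr => d _.
rewrite /carry_matrix -!sum1dep_card big_distrlr /= pair_big /= [RHS]big_mkcond.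
rewrite (reindex (fun q : {ffun V -> bool} * {ffun V -> 'I_(2 ^ k)} => (q.2, q.1))) /=.
  by apply: eq_bigr => -[s m] _; rewrite /half /=; case: ifP.
by exists (fun q => (q.2, q.1)) => -[].
Qed.

Lemma solution_count_eq k x x' c c' : x =1 x' -> c =1 c' ->
  solution_count k x c = solution_count k x' c'.
Proof.
move=> Ex Ec; apply: eq_card => m; rewrite !inE; apply: eq_forallb => e.
by rewrite Ec; congr (_ == _ + _); apply: eq_bigr => i _; rewrite Ex.
Qed.

(** Least significant letter first; a letter holds one binary digit of every coordinate. *)
Definition digits_value (ds : seq {ffun X -> bool}) (i : X) : nat :=
  foldr (fun r z => z.*2 + r i)%N 0%N ds.

Definition carry_step r (u : {ffun E -> 'I_(W.*2.+1)} -> nat) d : nat :=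
  (\sum_c u c * carry_matrix r c d)%N.

(** The [p] further places are those where the digits of [x] are exhausted while the unknowns may
    still have nonzero digits. *)
Lemma solution_count_digits p ds u :
  (\sum_c u c * solution_count (size ds + p) (digits_value ds) (carry_val c) =
   \sum_c foldl (fun v r => carry_step r v) u ds c *
           solution_count p (fun=> 0) (carry_val c))%N.
Proof.
elim: ds u => [|r ds IH] u //=.
under eq_bigr do rewrite -/(digits_value ds) solution_count_double big_distrr /=.
rewrite exchange_big -IH /=; apply: eq_bigr => d _.
by rewrite /carry_step big_distrl /=; apply: eq_bigr => c _; rewrite mulnA.
Qed.
End BinarySystem.

(** A weighted automaton over the natural numbers. Its two final vectors give the positive and the
    negative part of a signed count, so that no entry is ever negative. *)
Record counter (X : finType) := Counter {
  ct_state : finType;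
  ct_init : ct_state -> nat;
  ct_matrix : {ffun X -> bool} -> ct_state -> ct_state -> nat;
  ct_pos : ct_state -> nat;
  ct_neg : ct_state -> nat
}.

Definition ct_step X (D : counter X) (u : ct_state D -> nat) r (d : ct_state D) : nat :=
  (\sum_c u c * ct_matrix r c d)%N.

Definition ct_run X (D : counter X) ds : ct_state D -> nat :=
  foldl (@ct_step X D) (@ct_init X D) ds.

Arguments ct_run {X} D ds c.

Definition ct_accepts X (D : counter X) ds : bool :=
  (\sum_c ct_run D ds c * ct_neg c < \sum_c ct_run D ds c * ct_pos c)%N.

Section KroneckerCounter.
Variable l : nat.

Definition axis (p : 'I_l * 'I_l * 'I_l) (q : 'I_3) : 'I_l :=
  match val q with 0%N => p.1.1 | 1%N => p.1.2 | _ => p.2 end.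

Definition axis_perm (p : 'S_l * 'S_l * 'S_l) (q : 'I_3) : 'S_l :=
  match val q with 0%N => p.1.1 | 1%N => p.1.2 | _ => p.2 end.

(* Besides the entries of the table there is one unknown for each difference
   of consecutive parts, so that unsorted inputs have no solution. *)
Local Notation unknown := (('I_l * 'I_l * 'I_l) + ('I_3 * 'I_l))%type.
Local Notation equation := (('I_3 * 'I_l) + ('I_3 * 'I_l))%type.

Definition coefA (v : unknown) (e : equation) : int :=
  match v, e with
  | inl p, inl (q, a) => (axis p q == a)%:Z
  | inr d, inr d' => (d == d')%:Z
  | _, _ => 0
  end.

Definition coefB (i : 'I_3 * 'I_l) (e : equation) : int :=
  match e with
  | inl d => (i == d)%:Z
  | inr d => (i == d)%:Z - ((i.1 == d.1) && (i.2 == d.2.+1 :> nat))%:Z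
  end.

Definition shift (p : 'S_l * 'S_l * 'S_l) (e : equation) : int :=
  if e is inl (q, a) then (axis_perm p q a)%:Z - a%:Z else 0.

(** The summand [l] makes room for the initial shifts [s a - a]; the sum bounds the coefficients of
    every equation at once. *)
Definition carry_width : nat :=
  (l + \sum_e (\sum_v `|coefA v e| + \sum_i `|coefB i e|))%N.
Local Notation W := carry_width.
Local Notation carry := {ffun equation -> 'I_(W.*2.+1)}.

Lemma carry_width_large e : (\sum_v `|coefA v e| + \sum_i `|coefB i e| <= W)%N.
Proof. by rewrite /carry_width (bigD1 e) //= addnCA leq_addr. Qed.

Definition perm3_sign (p : 'S_l * 'S_l * 'S_l) : bool := p.1.1 (+) p.1.2 (+) p.2.

Definition shift_count (b : bool) (c : carry) : nat :=
  #|[set p | (perm3_sign p == b) && [forall e, carry_val c e == shift p e]]|.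

(** The unknowns get [l] places more than the parts: an array entry is at most the sum of [l] parts
    below [2 ^ k], which is less than [2 ^ (k + l)]. *)
Definition base_count (c : carry) : nat :=
  solution_count coefA coefB l (fun=> 0%N) (carry_val c).

(** The boolean is the sign of the triple of permutations, [true] for odd. The matrices preserve it,
    and the final vectors sort the counts by it. *)
Definition kronecker_counter : counter ('I_3 * 'I_l)%type :=
  @Counter _ (bool * carry)%type
    (fun bc => shift_count bc.1 bc.2)
    (fun r bc bc' => if bc.1 == bc'.1 then carry_matrix coefA coefB r bc.2 bc'.2 else 0%N)
    (fun bc => if bc.1 then 0%N else base_count bc.2)
    (fun bc => if bc.1 then base_count bc.2 else 0%N).

Lemma shift_carry p : exists c : carry, carry_val c =1 shift p.
Proof.
have bound e : (`|shift p e| <= W)%N.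
  rewrite /W; case: e => [[q a]|d] /=; last by [].
  have := ltn_ord a; have := ltn_ord (axis_perm p q a).
  set z := bigop _ _ _; lia.
have lt e : (`|(shift p e + W%:Z)%R| < W.*2.+1)%N by have := bound e; lia.
exists [ffun e => Ordinal (lt e)] => e; rewrite /carry_val ffunE /=.
by have := bound e; lia.
Qed.

Lemma sum_shift_count b k (x : 'I_3 * 'I_l -> nat) :
  (\sum_c shift_count b c * solution_count coefA coefB k x (carry_val c) =
   \sum_(p | perm3_sign p == b) solution_count coefA coefB k x (shift p))%N.
Proof.
under eq_bigr do rewrite /shift_count -sum1dep_card big_distrl big_mkcondr /=.
rewrite exchange_big /=; apply: eq_bigr => p _.
have [c cE] := shift_carry p; rewrite (bigD1 c) //= big1 ?addn0 => [|d nd].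
  have -> : [forall e, carry_val c e == shift p e] by apply/forallP => e; rewrite cE.
  by rewrite mul1n; apply: solution_count_eq.
case: ifP => // /forallP h; case/eqP: nd; apply: carry_val_inj => e.
by rewrite cE; apply/eqP.
Qed.

Lemma kronecker_counter_run ds b c : ct_run kronecker_counter ds (b, c) =
  foldl (fun v r => carry_step coefA coefB r v) (shift_count b) ds c.
Proof.
suff gen (u : bool * carry -> nat) v : (forall b c, u (b, c) = v b c) ->
    forall b c, foldl (@ct_step _ kronecker_counter) u ds (b, c) =
      foldl (fun v r => carry_step coefA coefB r v) (v b) ds c by exact: gen.
elim: ds u v => [|r ds IH] u v uv b' c' //=.
apply: (IH _ (fun b => carry_step coefA coefB r (v b))) => {}b' {}c'.
rewrite /ct_step /carry_step (eq_bigr (fun bc => u (bc.1, bc.2) *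
  (if bc.1 == b' then carry_matrix coefA coefB r bc.2 c' else 0)))%N => [|[] //].
rewrite -(pair_bigA _ (fun b0 c0 => u (b0, c0) *
  (if b0 == b' then carry_matrix coefA coefB r c0 c' else 0)))%N /=.
rewrite (bigD1 b') //= [X in (_ + X)%N]big1 ?addn0 => [|b0 /negPf nb].
  by apply: eq_bigr => c0 _; rewrite eqxx uv.
by rewrite big1 // => c0 _; rewrite nb muln0.
Qed.

Lemma kronecker_counter_accepts ds : ct_accepts kronecker_counter ds =
  (0 < \sum_p (-1) ^+ perm3_sign p *
     (solution_count coefA coefB (size ds + l) (digits_value ds) (shift p))%:Z).
Proof.
pose T b := (\sum_(p | perm3_sign p == b)
  solution_count coefA coefB (size ds + l) (digits_value ds) (shift p))%N.
have TE b : (\sum_c ct_run kronecker_counter ds (b, c) * base_count c = T b)%N.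
  under eq_bigr do rewrite kronecker_counter_run.
  by rewrite -(solution_count_digits carry_width_large) sum_shift_count.
have split (F : bool * carry -> nat) :
    (\sum_bc F bc = \sum_c F (true, c) + \sum_c F (false, c))%N.
  rewrite (eq_bigr (fun bc => F (bc.1, bc.2))) => [|[] //].
  by rewrite -(pair_bigA _ (fun b c => F (b, c))) /= big_bool.
rewrite /ct_accepts !split /= !TE.
rewrite [X in (_ + X < _)%N]big1 ?addn0 => [|c _]; last by rewrite muln0.
rewrite [X in (_ < X + _)%N]big1 ?add0n => [|c _]; last by rewrite muln0.
rewrite (bigID (fun p => perm3_sign p == false)) /= -ltz_nat -subr_gt0.
congr (0 < _ + _).
  rewrite /T (raddf_sum Posz) /=; apply: eq_bigr => p /eqP ->.
  by rewrite mul1r.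
rewrite /T (raddf_sum Posz) /= -sumrN; apply: eq_big => [p|p].
  by case: perm3_sign.
by move=> /eqP ->; rewrite mulN1r.
Qed.

(** * From the digits of the parts to the Kronecker coefficient *)

Section Input.
Variables la mu nu : seq nat.
Hypotheses (zla : (size la <= l)%N) (zmu : (size mu <= l)%N) (znu : (size nu <= l)%N).

Definition axis_part (q : 'I_3) : seq nat :=
  match val q with 0%N => la | 1%N => mu | _ => nu end.

Definition parts_value (i : 'I_3 * 'I_l) : nat := nth 0%N (axis_part i.1) i.2.

Lemma size_axis_part q : (size (axis_part q) <= l)%N.
Proof. by rewrite /axis_part; case: (val q) => [|[]]. Qed.

Definition nonincreasing (s : seq nat) : bool :=
  [forall a : 'I_l, nth 0%N s a.+1 <= nth 0%N s a]%N.

Lemma sum_delta (I : finType) (i0 : I) (F : I -> int) :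
  \sum_i (i == i0)%:Z * F i = F i0.
Proof.
rewrite (bigD1 i0) //= eqxx mul1r big1 ?addr0 // => i /negPf ->.
by rewrite mul0r.
Qed.

Lemma sum_coefB_part d : \sum_i coefB i (inl d) * (parts_value i)%:Z = (parts_value d)%:Z.
Proof. exact: sum_delta. Qed.

Lemma sum_coefB_diff d : \sum_i coefB i (inr d) * (parts_value i)%:Z =
  (parts_value d)%:Z - (nth 0%N (axis_part d.1) d.2.+1)%:Z.
Proof.
under eq_bigr do rewrite /= mulrBl.
rewrite sumrB sum_delta; congr (_ - _); case: d => q a /=.
case: (ltnP a.+1 l) => al.
  rewrite -[RHS](sum_delta (q, Ordinal al) (fun i => (parts_value i)%:Z)).
  apply: eq_bigr => -[q' a'] _ /=; congr (_ * _); congr Posz; congr nat_of_bool.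
(* After the last of the [l] rows the next part is the default zero, matching the absent term of
   [coefB]. *)
rewrite nth_default ?(leq_trans (size_axis_part _)) // big1 // => -[q' a'] _ /=.
by have := ltn_ord a'; case: eqP => [->|]; rewrite ?andbF ?mul0r //; lia.
Qed.
Lemma sum_fst (I J : finType) (F : I * J -> int) (P : I -> int) :
  \sum_p P p.1 * F p = \sum_i P i * \sum_j F (i, j).
Proof.
rewrite (eq_bigr (fun p => P p.1 * F (p.1, p.2))) => [|[] //].
rewrite -(pair_bigA _ (fun i j => P i * F (i, j))) /=.
by apply: eq_bigr => i _; rewrite mulr_sumr.
Qed.

Lemma sum_snd (I J : finType) (F : I * J -> int) (P : J -> int) :
  \sum_p P p.2 * F p = \sum_j P j * \sum_i F (i, j).
Proof.
rewrite (eq_bigr (fun p => P p.2 * F (p.1, p.2))) => [|[] //].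
rewrite -(pair_bigA _ (fun i j => P j * F (i, j))) exchange_big /=.
by apply: eq_bigr => i _; rewrite mulr_sumr.
Qed.

Definition table_margin (q : 'I_3) (m : {ffun 'I_l * 'I_l * 'I_l -> nat}) :
    {ffun 'I_l -> nat} :=
  match val q with
  | 0%N => marginal1 (marginal1 m) | 1%N => marginal2 (marginal1 m) | _ => marginal2 m
  end.

Lemma sum_axis q a (m : {ffun 'I_l * 'I_l * 'I_l -> nat}) :
  \sum_p (axis p q == a)%:Z * (m p)%:Z = (table_margin q m a)%:Z.
Proof.
rewrite /axis /table_margin; case: (val q) => [|[|k]].
- rewrite (sum_fst (fun p => (m p)%:Z) (fun ij => (ij.1 == a)%:Z)).
  rewrite (sum_fst (fun ij => \sum_k (m (ij, k))%:Z) (fun i => (i == a)%:Z)).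
  rewrite sum_delta !ffunE (raddf_sum Posz) /=; apply: eq_bigr => j _.
  by rewrite ffunE (raddf_sum Posz).
- rewrite (sum_fst (fun p => (m p)%:Z) (fun ij => (ij.2 == a)%:Z)).
  rewrite (sum_snd (fun ij => \sum_k (m (ij, k))%:Z) (fun i => (i == a)%:Z)).
  rewrite sum_delta !ffunE (raddf_sum Posz) /=; apply: eq_bigr => j _.
  by rewrite ffunE (raddf_sum Posz).
rewrite (sum_snd (fun p => (m p)%:Z) (fun k => (k == a)%:Z)).
by rewrite sum_delta !ffunE (raddf_sum Posz).
Qed.

Lemma sum_coefA_margin (m : unknown -> nat) q a :
  \sum_v coefA v (inl (q, a)) * (m v)%:Z =
  (table_margin q [ffun p => m (inl p)] a)%:Z.
Proof.
rewrite big_sumType /= [X in _ + X]big1 ?addr0 => [|d _]; last by rewrite mul0r.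
by rewrite -sum_axis; apply: eq_bigr => p _; rewrite ffunE.
Qed.

Lemma sum_coefA_diff (m : unknown -> nat) d :
  \sum_v coefA v (inr d) * (m v)%:Z = (m (inr d))%:Z.
Proof.
rewrite big_sumType /= big1 ?add0r => [|p _]; last by rewrite mul0r.
exact: sum_delta.
Qed.

Definition table_solves (p : 'S_l * 'S_l * 'S_l) (m : {ffun 'I_l * 'I_l * 'I_l -> nat}) :=
  [forall q, has_content (jt_weight (axis_part q) (axis_perm p q)) (table_margin q m)].

Lemma solvesP p (m : unknown -> nat) : reflect
  (table_solves p [ffun v => m (inl v)] /\
   forall d, (m (inr d) + nth 0 (axis_part d.1) d.2.+1 = parts_value d)%N)
  (solves coefA coefB (fun i => (parts_value i)%:Z) (shift p) (fun v => (m v)%:Z)).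
Proof.
apply: (iffP forallP) => [h|[/forallP h hd] [[q a]|d]].
- split=> [|d].
    apply/forallP => q; apply/forallP => a; have := h (inl (q, a)).
    rewrite sum_coefA_margin sum_coefB_part => /eqP -> /=.
    by rewrite /jt_weight -addrA [_ - _]addrC.
  have := h (inr d); rewrite sum_coefA_diff sum_coefB_diff /= addr0 => /eqP.
  lia.
- rewrite sum_coefA_margin sum_coefB_part (eqP (forallP (h q) a)) /=.
  by rewrite /jt_weight -addrA [- _ + _]addrC.
by rewrite sum_coefA_diff sum_coefB_diff /= addr0 -hd PoszD addrK.
Qed.

(** The slack unknowns must be the differences of consecutive parts. They exist exactly when the
    parts are nonincreasing, and are then unique and below [2 ^ k], so only the array remains
    free. *)
Lemma solution_count_table k p : (forall d, parts_value d < 2 ^ k)%N ->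
  solution_count coefA coefB k parts_value (shift p) =
  if [forall q, nonincreasing (axis_part q)]
  then table_count (2 ^ k) la mu nu p.1.1 p.1.2 p.2 else 0%N.
Proof.
move=> lt_k; case: ifP => [/forallP dec|/negbT /forallPn[q /forallPn[a]]]; last first.
  rewrite -ltnNge => inc; apply: eq_card0 => m; rewrite inE; apply/negP.
  case/(solvesP p (fun v => m v : nat)) => _ /(_ (q, a)) /= E.
  by move: inc; rewrite -[X in (X < _)%N]E ltnNge leq_addl.
have ltd d : (parts_value d - nth 0 (axis_part d.1) d.2.+1 < 2 ^ k)%N.
  exact: leq_ltn_trans (leq_subr _ _) (lt_k d).
pose f (m : {ffun 'I_l * 'I_l * 'I_l -> 'I_(2 ^ k)}) : {ffun unknown -> 'I_(2 ^ k)} :=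
  [ffun v => match v with inl p => m p | inr d => Ordinal (ltd d) end].
have injf : injective f.
  by move=> m m' /ffunP E; apply/ffunP => v; have := E (inl v); rewrite !ffunE.
rewrite -[RHS](card_imset _ injf); apply: eq_card => m; rewrite inE.
have tableE (m1 : {ffun 'I_l * 'I_l * 'I_l -> 'I_(2 ^ k)}) : m1 \in
    [set m0 : {ffun 'I_l * 'I_l * 'I_l -> 'I_(2 ^ k)} |
     let m' := [ffun k0 => m0 k0 : nat] in
     [&& has_content (jt_weight la p.1.1) (marginal1 (marginal1 m')),
         has_content (jt_weight mu p.1.2) (marginal2 (marginal1 m'))
       & has_content (jt_weight nu p.2) (marginal2 m')]] =
   table_solves p [ffun k0 => m1 k0 : nat].
  rewrite inE; apply/and3P/forallP => [[h0 h1 h2] [[|[|[|//]]] ?]|h].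
  - exact: h0.
  - exact: h1.
  - exact: h2.
  split; first exact: (h (@Ordinal 3 0 isT)).
    exact: (h (@Ordinal 3 1 isT)).
  exact: (h (@Ordinal 3 2 isT)).
apply/(solvesP p (fun v => m v : nat))/imsetP => [[hm hd]|[m1 hm1 ->]].
  exists [ffun v => m (inl v)].
    rewrite tableE; congr (is_true (table_solves p _)): hm.
    by apply/ffunP => v; rewrite !ffunE.
  apply/ffunP => -[v|d]; rewrite !ffunE //; apply: ord_inj => /=.
  by rewrite -hd addnK.
rewrite tableE in hm1; split=> [|d].
  congr (is_true (table_solves p _)): hm1.
  by apply/ffunP => v; rewrite !ffunE.
by rewrite ffunE /= subnK //; case: d => q a; apply: (forallP (dec q)).
Qed.

Lemma sum_marginal1 (I J : finType) (m : {ffun I * J -> nat}) :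
  (\sum_i marginal1 m i = \sum_p m p)%N.
Proof.
under eq_bigr do rewrite ffunE.
by rewrite pair_bigA; apply: eq_bigr => -[].
Qed.

Lemma sum_marginal2 (I J : finType) (m : {ffun I * J -> nat}) :
  (\sum_j marginal2 m j = \sum_p m p)%N.
Proof.
under eq_bigr do rewrite ffunE.
by rewrite exchange_big pair_bigA; apply: eq_bigr => -[].
Qed.

(** Each margin sums to the total of the array, and the Jacobi-Trudi shifts cancel in that sum.
    Lists with different sums therefore have no common array. *)
Lemma table_solves_sum p m q : table_solves p m ->
  sumn (axis_part q) = (\sum_v m v)%N.
Proof.
move=> /forallP /(_ q) /forallP h.
have -> : (\sum_v m v = \sum_a table_margin q m a)%N.
  rewrite /table_margin; case: (val q) => [|[|k]];
  by rewrite ?sum_marginal1 ?sum_marginal2 ?sum_marginal1.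
apply/eqP; rewrite -eqz_nat (raddf_sum Posz) /= (eq_bigr _ (fun a _ => eqP (h a))).
by rewrite (sum_jt_weight erefl) ?size_axis_part.
Qed.
Lemma is_partitionE (s : seq nat) : (size s <= l)%N -> 0%N \notin s ->
  is_partition s = nonincreasing s.
Proof.
move=> sl s0; rewrite /is_partition s0 andbT.
apply/(sortedP 0%N)/forallP => h a; last first.
  by move=> al; have := h (Ordinal (ltnW (leq_trans al sl))).
case: (ltnP a.+1 (size s)) => [|ge]; first exact: h.
by rewrite nth_default.
Qed.

Lemma digits_value_lt (X : finType) (ds : seq {ffun X -> bool}) i :
  (digits_value ds i < 2 ^ size ds)%N.
Proof.
by elim: ds => //= r ds IH; rewrite expnS; move: IH; rewrite /digits_value; case: (r i); lia.
Qed.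

Lemma kronecker_counterP ds :
  0%N \notin la -> 0%N \notin mu -> 0%N \notin nu ->
  digits_value ds =1 parts_value ->
  ct_accepts kronecker_counter ds =
  kronecker_instance l la mu nu && (0 < kronecker la mu nu).
Proof.
move=> nla nmu nnu dsE; rewrite kronecker_counter_accepts.
set k := (size ds + l)%N.
have lt_ds d : (parts_value d < 2 ^ size ds)%N by rewrite -dsE digits_value_lt.
have lt_k d : (parts_value d < 2 ^ k)%N.
  by apply: leq_trans (lt_ds d) _; rewrite leq_exp2l ?leq_addr.
have sumE q : sumn (axis_part q) = (\sum_(i < l) parts_value (q, i))%N.
  by rewrite (sum_parts erefl (size_axis_part q)).
under eq_bigr => p _ do rewrite (solution_count_eq _ _ _ dsE (fun=> erefl)) solution_count_table //.
have inst : kronecker_instance l la mu nu =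
    [forall q, nonincreasing (axis_part q)] && ((sumn la == sumn mu) && (sumn mu == sumn nu)).
  rewrite /kronecker_instance zla zmu znu !andbT !is_partitionE //.
  congr (_ && _); apply/and3P/forallP => [[h0 h1 h2] [[|[|[|//]]] ?] //|h].
  by split; [exact: (h (@Ordinal 3 0 isT))|exact: (h (@Ordinal 3 1 isT))|
             exact: (h (@Ordinal 3 2 isT))].
case: (boolP (kronecker_instance l la mu nu)) => [hi|ni] /=.
  move: (hi); rewrite inst => /andP[-> _].
  rewrite (kronecker_tables hi (N := 2 ^ k)) ?ltr0z; last first.
    rewrite (sumE (@Ordinal 3 0 isT)) /k expnD mulnC.
    apply: (@leq_trans (l * 2 ^ size ds).+1); last first.
      by rewrite ltn_pmul2r ?expn_gt0 // ltn_expl.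
    rewrite ltnS -[l in (l * _)%N]card_ord -sum_nat_const; apply: leq_sum => i _.
    exact: ltnW.
  congr (0 < _).
  rewrite pair_bigA /= pair_bigA /=; apply: eq_bigr => -[[s t] u] _ /=.
  by rewrite /perm3_sign /= !signr_addb -!mulrA natz.
(* Outside the instances every single count is zero, so no sign can make the sum positive. *)
apply/negbTE; rewrite -leNgt big1 // => p _.
case: ifP => dec; last by rewrite mulr0.
suff -> : table_count (2 ^ k) la mu nu p.1.1 p.1.2 p.2 = 0%N by rewrite mulr0.
have := solution_count_table p lt_k; rewrite dec => <-.
apply: eq_card0 => m; rewrite inE; apply: contraNF ni.
case/(solvesP p (fun v => m v : nat)) => hm _; rewrite inst dec /=.
have := table_solves_sum (@Ordinal 3 0 isT) hm; have := table_solves_sum (@Ordinal 3 1 isT) hm.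
have := table_solves_sum (@Ordinal 3 2 isT) hm; rewrite /axis_part /= => -> -> ->.
by rewrite eqxx.
Qed.
End Input.
End KroneckerCounter.

(** * Register programs *)

Section StraightLine.
Implicit Types (rho : nat -> int) (code : seq instr).

Inductive expr := EConst of int | EVar of nat | EOp of arith_op & expr & expr.

Fixpoint eval_expr rho e : int :=
  match e with
  | EConst z => z
  | EVar i => rho i
  | EOp o e1 e2 => eval_op o (eval_expr rho e1) (eval_expr rho e2)
  end.

Fixpoint expr_vars_below (v : nat) e : bool :=
  match e with
  | EConst _ => true
  | EVar i => (i < v)%N
  | EOp _ e1 e2 => expr_vars_below v e1 && expr_vars_below v e2
  end.

Lemma expr_vars_belowW v w e : (v <= w)%N -> expr_vars_below v e -> expr_vars_below w e.
Proof.
move=> vw; elim: e => //= [i iv|_ e1 IH1 e2 IH2 /andP[/IH1 -> /IH2 ->] //].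
exact: leq_trans vw.
Qed.

Lemma eval_expr_ext v rho rho' e : expr_vars_below v e ->
  (forall i, (i < v)%N -> rho i = rho' i) -> eval_expr rho e = eval_expr rho' e.
Proof.
elim: e => [z|i|o e1 IH1 e2 IH2] //= => [iv h|/andP[v1 v2] h]; first exact: h.
by rewrite IH1 // IH2.
Qed.

Definition exec1 rho (i : instr) : nat -> int :=
  match i with
  | SetConst i z => set_reg rho i z
  | SetOp i o j k => set_reg rho i (eval_op o (rho j) (rho k))
  | JumpPos _ _ | Halt _ => rho
  end.

Definition straight (i : instr) : bool :=
  if i is (SetConst _ _ | SetOp _ _ _ _) then true else false.

Definition exec code rho := foldl exec1 rho code.

Lemma exec_cat code1 code2 rho :
  exec (code1 ++ code2) rho = exec code2 (exec code1 rho).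
Proof. exact: foldl_cat. Qed.

Definition reg_le (G : nat) rho := forall i, (`|rho i| <= G)%N.

Definition exec_le G code rho :=
  forall k, (k <= size code)%N -> reg_le G (exec (take k code) rho).

Lemma exec_le_cat G code1 code2 rho : exec_le G code1 rho ->
  exec_le G code2 (exec code1 rho) -> exec_le G (code1 ++ code2) rho.
Proof.
move=> h1 h2 k; rewrite size_cat take_cat => ks.
case: ltnP => [k1|k1]; first exact/h1/ltnW.
by rewrite exec_cat; apply: h2; rewrite leq_subLR.
Qed.

Lemma exec_le_end G code rho : exec_le G code rho -> reg_le G (exec code rho).
Proof. by move/(_ (size code) (leqnn _)); rewrite take_size. Qed.

Lemma exec_le1 G i rho : reg_le G rho -> reg_le G (exec1 rho i) -> exec_le G [:: i] rho.
Proof. by move=> h0 h1 [|[|k]] //=. Qed.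

Lemma set_reg_le G rho i z : reg_le G rho -> (`|z| <= G)%N -> reg_le G (set_reg rho i z).
Proof. by move=> h hz j; rewrite /set_reg; case: eqP. Qed.

Fixpoint eval_le (G : nat) rho e : bool :=
  (`|eval_expr rho e| <= G)%N &&
  if e is EOp _ e1 e2 then eval_le G rho e1 && eval_le G rho e2 else true.

(** For variables bounded by some [B >= 2], this power of [B] bounds the value and all intermediate
    values. A constant [z] is less than [2 ^ |z|], whence its weight. *)
Fixpoint expr_degree e : nat :=
  match e with
  | EConst z => `|z|.+1
  | EVar _ => 1
  | EOp _ e1 e2 => (expr_degree e1 + expr_degree e2).+1
  end.

Lemma eval_expr_le v (B : nat) rho e : (2 <= B)%N -> expr_vars_below v e ->
  (forall i, (i < v)%N -> `|rho i| <= B)%N ->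
  (`|eval_expr rho e| <= B ^ expr_degree e)%N.
Proof.
move=> B2 + h; elim: e => [z|i|o e1 IH1 e2 IH2] /=.
- move=> _; apply: leq_trans (ltnW (ltn_expl `|z| B2)) _.
  by rewrite leq_exp2l.
- by move=> iv; rewrite expn1 h.
case/andP => /IH1 {}IH1 /IH2 {}IH2; set a := eval_expr rho e1 in IH1 *.
set b := eval_expr rho e2 in IH2 *; set m := expr_degree e1 in IH1 *.
set n := expr_degree e2 in IH2 *.
have m0 : (0 < B ^ m)%N by rewrite expn_gt0 (leq_trans _ B2).
have n0 : (0 < B ^ n)%N by rewrite expn_gt0 (leq_trans _ B2).
have mul_le : (B ^ m * B ^ n <= B ^ (m + n).+1)%N.
  by rewrite -expnD leq_exp2l.
have add_le : (B ^ m + B ^ n <= B ^ (m + n).+1)%N.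
  rewrite expnS expnD; apply: leq_trans (_ : 2 * (B ^ m * B ^ n) <= _)%N; nia.
case: o => /=.
- by apply: leq_trans add_le; lia.
- by apply: leq_trans add_le; lia.
- by rewrite abszM; apply: leq_trans mul_le; apply: leq_mul.
(* A quotient does not exceed its dividend in absolute value, also when the divisor is zero. *)
apply: leq_trans mul_le; apply: leq_trans (leq_trans IH1 (leq_pmulr _ n0)).
by have := lez_div a b; lia.
Qed.

Lemma eval_le_degree v (B G : nat) rho e : (2 <= B)%N -> expr_vars_below v e ->
  (forall i, (i < v)%N -> `|rho i| <= B)%N -> (B ^ expr_degree e <= G)%N ->
  eval_le G rho e.
Proof.
move=> B2 ve h; have B0 : (0 < B)%N by apply: leq_trans B2.
elim: e ve => [z|i|o e1 IH1 e2 IH2] ve le_G.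
- by rewrite /= andbT; apply: leq_trans (eval_expr_le B2 ve h) le_G.
- by rewrite /= andbT; apply: leq_trans (eval_expr_le B2 ve h) le_G.
rewrite /=; apply/andP; split; first exact: leq_trans (eval_expr_le B2 ve h) le_G.
case/andP: ve => v1 v2; rewrite IH1 ?IH2 //; apply: leq_trans le_G;
by rewrite /= leq_exp2l //; lia.
Qed.

(** The registers from [t] on form a stack: the value is left in [t] and everything below is
    preserved. To copy a variable, [t] is cleared and then added as a zero. *)
Fixpoint compile e (t : nat) : seq instr :=
  match e with
  | EConst z => [:: SetConst t z]
  | EVar i => [:: SetConst t 0; SetOp t OpAdd i t]
  | EOp o e1 e2 => compile e1 t ++ compile e2 t.+1 ++ [:: SetOp t o t t.+1]
  end.

Lemma compile_straight e t : all straight (compile e t).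
Proof. by elim: e t => //= o e1 IH1 e2 IH2 t; rewrite !all_cat IH1 IH2. Qed.

Lemma compileP e t rho : expr_vars_below t e ->
  exec (compile e t) rho t = eval_expr rho e /\
  forall j, (j < t)%N -> exec (compile e t) rho j = rho j.
Proof.
elim: e t rho => [z|i|o e1 IH1 e2 IH2] t rho /=.
- by rewrite /set_reg eqxx; split=> // j jt; rewrite ltn_eqF.
- move=> it; rewrite /set_reg eqxx (ltn_eqF it) addr0; split=> // j jt.
  by rewrite ltn_eqF.
case/andP => v1 v2; rewrite !exec_cat /=.
have v2' : expr_vars_below t.+1 e2.
  exact: expr_vars_belowW (leqnSn t) v2.
have [e1t e1j] := IH1 t rho v1; have [e2t e2j] := IH2 t.+1 (exec (compile e1 t) rho) v2'.
rewrite /set_reg eqxx e2t e2j // e1t; split.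
  by rewrite (eval_expr_ext v2 e1j).
by move=> j jt; rewrite ltn_eqF // e2j ?e1j // ltnW.
Qed.

Lemma compile_le G e t rho : expr_vars_below t e -> eval_le G rho e -> reg_le G rho ->
  exec_le G (compile e t) rho.
Proof.
elim: e t rho => [z|i|o e1 IH1 e2 IH2] t rho /=.
- move=> _; rewrite andbT => zG h; apply: exec_le1 => //; exact: set_reg_le.
- move=> it; rewrite andbT => iG h [|[|[|k]]] //= _; first exact: set_reg_le.
  by apply: set_reg_le; rewrite /set_reg ?eqxx ?(ltn_eqF it) ?addr0 //; apply: set_reg_le.
case/andP => v1 v2 /and3P[oG le1 le2] h.
have v2' : expr_vars_below t.+1 e2.
  exact: expr_vars_belowW (leqnSn t) v2.
have [e1t e1j] := compileP rho v1.
have [e2t e2j] := compileP (exec (compile e1 t) rho) v2'.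
have h1 := IH1 t rho v1 le1 h.
have le2' : eval_le G (exec (compile e1 t) rho) e2.
  elim: e2 v2 le2 {IH2 oG v2' e2t e2j} => //= [k kt|o' f1 hf1 f2 hf2 /andP[k1 k2]].
    by rewrite e1j.
  case/and3P => a b c; rewrite hf1 // hf2 // andbT.
  by rewrite (eval_expr_ext k1 e1j) (eval_expr_ext k2 e1j) a.
have h2 := IH2 t.+1 _ v2' le2' (exec_le_end h1).
apply: (exec_le_cat h1); apply: (exec_le_cat h2).
apply: exec_le1; first exact: exec_le_end h2.
apply: set_reg_le; first exact: exec_le_end h2.
by rewrite e2t e2j // e1t (eval_expr_ext v2 e1j).
Qed.

Variable V : nat.

(* New values are computed in the registers [V], ..., [2V - 1] before any
   variable is overwritten; register [2V] holds zero for the copies. *)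
Definition eval_block (f : nat -> expr) n : seq instr :=
  flatten [seq compile (f j) (V + j) | j <- iota 0 n].

Definition copy_block n : seq instr :=
  SetConst V.*2 0 :: [seq SetOp j OpAdd (V + j) V.*2 | j <- iota 0 n].

Definition assign_block f : seq instr := eval_block f V ++ copy_block V.

Lemma eval_blockS f n : eval_block f n.+1 = eval_block f n ++ compile (f n) (V + n).
Proof. by rewrite /eval_block -addn1 iotaD map_cat flatten_cat /= cats0. Qed.

Lemma copy_blockS n : copy_block n.+1 = copy_block n ++ [:: SetOp n OpAdd (V + n) V.*2].
Proof. by rewrite /copy_block -addn1 iotaD map_cat. Qed.

Lemma assign_straight f : all straight (assign_block f).
Proof.
rewrite all_cat; apply/andP; split; last by rewrite /= all_map; apply/allP.
by elim: {1}V => // n IH; rewrite eval_blockS all_cat IH compile_straight.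
Qed.

Hypothesis V_pos : (0 < V)%N.

Lemma eval_blockP f rho n : (n <= V)%N -> (forall j, expr_vars_below V (f j)) ->
  (forall j, (j < n)%N -> exec (eval_block f n) rho (V + j) = eval_expr rho (f j)) /\
  (forall j, (j < V)%N -> exec (eval_block f n) rho j = rho j).
Proof.
move=> + fV; elim: n => [|n IH] nV; first by split.
have [IH1 IH2] := IH (ltnW nV); rewrite eval_blockS.
have fVn : expr_vars_below (V + n) (f n) by apply: expr_vars_belowW (fV n); apply: leq_addr.
have [et ej] := compileP (exec (eval_block f n) rho) fVn.
split=> j jn; rewrite exec_cat; last by rewrite ej ?IH2 // (leq_trans jn) ?leq_addr.
move: jn; rewrite ltnS leq_eqVlt => /predU1P[->|jn]; last first.
  by rewrite ej ?IH1 // ltn_add2l.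
by rewrite et (eval_expr_ext (fV n) IH2).
Qed.

Lemma copy_blockP rho n : (n <= V)%N ->
  [/\ forall j, (j < n)%N -> exec (copy_block n) rho j = rho (V + j)%N,
      exec (copy_block n) rho V.*2 = 0
    & forall j, (V <= j < V.*2)%N -> exec (copy_block n) rho j = rho j].
Proof.
elim: n => [|n IH] nV.
  split=> //=; rewrite /set_reg ?eqxx // => j /andP[_ h].
  by rewrite ltn_eqF.
have [IH1 IH2 IH3] := IH (ltnW nV); rewrite copy_blockS.
have opE r i j k : exec [:: SetOp i OpAdd j k] r = set_reg r i (r j + r k) by [].
split=> [j jn||j /andP[Vj j2]]; rewrite exec_cat opE /set_reg.
- rewrite IH2 IH3 ?addr0; last by rewrite leq_addr -addnn ltn_add2l.
  case: eqP => [-> //|/eqP nj]; apply: IH1.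
  by rewrite ltn_neqAle nj -ltnS.
- by rewrite gtn_eqF ?IH2 // (leq_trans nV) // -addnn leq_addr.
by rewrite gtn_eqF ?IH3 ?Vj // (leq_trans nV).
Qed.

Lemma assignP f rho j : (forall j, expr_vars_below V (f j)) -> (j < V)%N ->
  exec (assign_block f) rho j = eval_expr rho (f j).
Proof.
move=> fV jV; rewrite exec_cat.
have [copy _ _] := copy_blockP (exec (eval_block f V) rho) (leqnn V).
by have [eval _] := eval_blockP rho (leqnn V) fV; rewrite copy // eval.
Qed.

Lemma assign_le G f rho : (forall j, expr_vars_below V (f j)) ->
  (forall j, (j < V)%N -> eval_le G rho (f j)) -> reg_le G rho ->
  exec_le G (assign_block f) rho.
Proof.
move=> fV fG h.
have h1 n : (n <= V)%N -> exec_le G (eval_block f n) rho.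
  elim: n => [|n IH] nV; first by move=> [|k].
  have [_ ej] := eval_blockP rho (ltnW nV) fV.
  rewrite eval_blockS; apply: (exec_le_cat (IH (ltnW nV))); apply: compile_le.
  - by apply: expr_vars_belowW (fV n); apply: leq_addr.
  - move: (f n) (fV n) (fG n nV); elim=> //= [k kV|o e1 IH1 e2 IH2 /andP[k1 k2]].
      by rewrite ej.
    case/and3P => a b c; rewrite IH1 // IH2 // andbT.
    by rewrite (eval_expr_ext k1 ej) (eval_expr_ext k2 ej) a.
  exact/exec_le_end/IH/ltnW.
apply: (exec_le_cat (h1 V (leqnn V))).
move: (exec _ _) (exec_le_end (h1 V (leqnn V))) => rho' h'.
suff gen n : (n <= V)%N -> exec_le G (copy_block n) rho' by apply: gen.
elim: n => [|n IH] nV.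
  by apply: exec_le1 => //; apply: set_reg_le.
have [_ c1 c2] := copy_blockP rho' (ltnW nV).
rewrite copy_blockS; apply: (exec_le_cat (IH (ltnW nV))).
have hn := exec_le_end (IH (ltnW nV)).
apply: exec_le1 => //; rewrite /exec1; apply: set_reg_le => //.
by rewrite /eval_op c1 addr0 c2 // leq_addr -addnn ltn_add2l.
Qed.
End StraightLine.

(** * Runs with bounded registers *)

Section Machine.
Variables (P : program) (G : nat).

Definition reaches (t : nat) (c c' : ram_config) : Prop :=
  iter t (ram_step P) c = c' /\
  forall s, (s <= t)%N -> reg_le G (ram_reg (iter s (ram_step P) c)).

Lemma reaches0 c : reg_le G (ram_reg c) -> reaches 0 c c.
Proof. by move=> h; split=> // s; rewrite leqn0 => /eqP ->. Qed.

Lemma reaches_trans t1 t2 c1 c2 c3 :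
  reaches t1 c1 c2 -> reaches t2 c2 c3 -> reaches (t2 + t1) c1 c3.
Proof.
move=> [e1 h1] [e2 h2]; split=> [|s st]; first by rewrite iterD e1.
case: (leqP s t1) => [|t1s]; first exact: h1.
by rewrite -(subnK (ltnW t1s)) iterD e1; apply: h2; rewrite leq_subLR addnC.
Qed.

Lemma reaches1 c : reg_le G (ram_reg c) -> reg_le G (ram_reg (ram_step P c)) ->
  reaches 1 c (ram_step P c).
Proof. by move=> h0 h1; split=> // -[|[|s]]. Qed.

Lemma onth_mid (T : Type) (pre : seq T) i post : onth (pre ++ i :: post) (size pre) = Some i.
Proof. by elim: pre. Qed.

Lemma reaches_straight pre code post rho :
  P = pre ++ code ++ post -> all straight code -> exec_le G code rho ->
  reaches (size code) (RamConfig (size pre) rho)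
    (RamConfig (size pre + size code) (exec code rho)).
Proof.
elim: code pre rho => [|i code IH] pre rho PE /=.
  by move=> _ h; rewrite addn0; apply: reaches0; apply: (h 0%N).
case/andP => si sc h.
have h0 : reg_le G rho by apply: (h 0%N).
have h1 : reg_le G (exec1 rho i) by have := h 1%N isT; rewrite /= take0.
have step : ram_step P (RamConfig (size pre) rho) = RamConfig (size pre).+1 (exec1 rho i).
  by rewrite /= PE onth_mid; case: (i) si.
rewrite addnS -addSn -[(size pre).+1](size_rcons pre i) -[(size code).+1]addn1.
apply: (@reaches_trans 1 _ _ (RamConfig (size (rcons pre i)) (exec1 rho i))).
  by rewrite size_rcons -step; apply: reaches1; rewrite ?step.
apply: IH => //; first by rewrite PE cat_rcons.
by move=> k kc; apply: (h k.+1).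
Qed.
End Machine.

Section Loop.
Variables (V y : nat) (init body : nat -> expr) (final : expr).
Hypotheses (y_lt : (y < V)%N) (init_vars : forall j, expr_vars_below V (init j)).
Hypotheses (body_vars : forall j, expr_vars_below V (body j)).
Hypothesis final_vars : expr_vars_below V final.

Let I := assign_block V init.
Let L := assign_block V body.
Let F := compile final V.

(** The test on [y] follows the body, so the body runs at least once. Besides the three blocks, two
    jumps and [Halt false] precede [Halt true], whence the 3 in the last target. *)
Definition loop_program : program :=
  I ++ L ++ [:: JumpPos y (size I)] ++ F ++
  [:: JumpPos V (size I + size L + size F + 3); Halt false; Halt true].

Variables (rho0 : nat -> int) (st : nat -> nat -> int) (K B G : nat).
Hypotheses (K_pos : (0 < K)%N) (B_ge2 : (2 <= B)%N) (BG : (B <= G)%N).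
Hypothesis st0 : forall j, (j < V)%N -> st 0 j = eval_expr rho0 (init j).
Hypothesis stS : forall k j, (j < V)%N -> st k.+1 j = eval_expr (st k) (body j).
Hypothesis y_pos : forall k, (0 < k < K)%N -> 0 < st k y.
Hypothesis y_end : st K y <= 0.
Hypothesis rho0_le : reg_le B rho0.
Hypothesis st_le : forall k j, (k <= K)%N -> (j < V)%N -> (`|st k j| <= B)%N.
Hypothesis init_G : forall j, (j < V)%N -> (B ^ expr_degree (init j) <= G)%N.
Hypothesis body_G : forall j, (j < V)%N -> (B ^ expr_degree (body j) <= G)%N.
Hypothesis final_G : (B ^ expr_degree final <= G)%N.

Let P := loop_program.
Let V_pos : (0 < V)%N := leq_ltn_trans (leq0n y) y_lt.

Let agrees k (rho : nat -> int) := forall j, (j < V)%N -> rho j = st k j.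

Lemma loop_iteration k rho : (k < K)%N -> agrees k rho -> reg_le G rho ->
  exists2 rho', reaches P G (size L) (RamConfig (size I) rho)
    (RamConfig (size I + size L) rho') & agrees k.+1 rho' /\ reg_le G rho'.
Proof.
move=> kK ag hG.
have hL : exec_le G L rho.
  apply: assign_le => // j jV; apply: (@eval_le_degree V B) => //; last exact: body_G.
  by move=> i iV; rewrite ag // st_le // ltnW.
exists (exec L rho).
  by apply: (@reaches_straight P G I L) => //; apply: assign_straight.
split; last exact: exec_le_end hL.
move=> j jV; rewrite assignP // stS //.
by apply: (eval_expr_ext (body_vars j)) => i /ag ->.
Qed.

Lemma jump_step rho : ram_step P (RamConfig (size I + size L) rho) =
  RamConfig (if 0 < rho y then size I else (size I + size L).+1) rho.
Proof. by rewrite /ram_step /P /loop_program catA -size_cat onth_mid. Qed.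

Lemma loop_iterations n k rho : (n + k)%N = K -> (0 < n)%N -> agrees k rho -> reg_le G rho ->
  exists2 rho', reaches P G (n * (size L).+1) (RamConfig (size I) rho)
    (RamConfig (size I + size L).+1 rho') & agrees K rho' /\ reg_le G rho'.
Proof.
elim: n k rho => // n IH k rho nK _ ag hG.
have kK : (k < K)%N by rewrite -nK addSn ltnS leq_addl.
have [rho1 r1 [ag1 h1]] := loop_iteration kK ag hG.
have r2 : reaches P G 1 (RamConfig (size I + size L) rho1)
   (RamConfig (if 0 < rho1 y then size I else (size I + size L).+1) rho1).
  by rewrite -jump_step; apply: reaches1; rewrite ?jump_step.
have := reaches_trans r1 r2; rewrite add1n => {r1 r2}.
case: n IH nK => [|n] IH nK.
  have ag1' : agrees K rho1 by rewrite -nK.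
  rewrite ag1' // ltNge y_end /= => r; exists rho1 => //.
  by rewrite mul1n.
rewrite ag1 // y_pos ?ltnS //; last by rewrite -nK; lia.
move=> r; have [||rho2 r3 [ag2 h2]] := IH k.+1 rho1 _ _ ag1 h1 => //.
  by rewrite -nK; lia.
exists rho2 => //; rewrite mulSn addnC; exact: reaches_trans r r3.
Qed.

(** The variables below [V] follow the prescribed trajectory [st]; of the scratch registers only the
    bound [G] is tracked. *)
Lemma loop_programP : exists t, let c := iter t (ram_step P) (RamConfig 0 rho0) in
  [/\ (t <= K * (size L).+1 + (size I + size F).+1)%N,
      ram_verdict P c = Some (0 < eval_expr (st K) final)
    & forall s, (s <= t)%N -> reg_le G (ram_reg (iter s (ram_step P) (RamConfig 0 rho0)))].
Proof.
have hI : exec_le G I rho0.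
  apply: assign_le => // [j jV|i]; last exact: leq_trans (rho0_le i) BG.
  by apply: (@eval_le_degree V B) => //; exact: init_G.
have r1 : reaches P G (size I) (RamConfig 0 rho0) (RamConfig (size I) (exec I rho0)).
  by apply: (@reaches_straight P G [::] I) => //; apply: assign_straight.
have ag1 : agrees 0 (exec I rho0) by move=> j jV; rewrite assignP // st0.
have [rho2 r2 [ag2 h2]] := loop_iterations (addn0 K) K_pos ag1 (exec_le_end hI).
have hF : exec_le G F rho2.
  apply: compile_le => //; apply: (@eval_le_degree V B) => //.
  by move=> i iV; rewrite ag2 // st_le.
pose pre := I ++ L ++ [:: JumpPos y (size I)].
pose post := [:: JumpPos V (size I + size L + size F + 3); Halt false; Halt true].
have PE : P = pre ++ F ++ post by rewrite /P /loop_program /pre -!catA.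
have size_pre : size pre = (size I + size L).+1 by rewrite !size_cat /=; lia.
have r3 : reaches P G (size F) (RamConfig (size pre) rho2)
    (RamConfig (size pre + size F) (exec F rho2)).
  by apply: reaches_straight PE _ hF; apply: compile_straight.
rewrite -size_pre in r2.
pose b := 0 < exec F rho2 V.
have bE : b = (0 < eval_expr (st K) final).
  rewrite /b (proj1 (compileP _ final_vars)).
  by rewrite (eval_expr_ext final_vars ag2).
have step : ram_step P (RamConfig (size pre + size F) (exec F rho2)) =
    RamConfig (size pre + size F + 1 + b)%N (exec F rho2).
  rewrite /ram_step PE catA -size_cat onth_mid -/b size_cat size_pre.
  by case: (b) => /=; congr RamConfig; lia.
have hE := exec_le_end hF.
have r4 : reaches P G 1 (RamConfig (size pre + size F) (exec F rho2))
    (RamConfig (size pre + size F + 1 + b)%N (exec F rho2)).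
  by rewrite -step; apply: reaches1; rewrite ?step.
have [e h] := reaches_trans (reaches_trans (reaches_trans r1 r2) r3) r4.
eexists; split; last exact: h; first by lia.
rewrite e /ram_verdict /= -bE.
have -> : P = (pre ++ F) ++ post by rewrite PE catA.
rewrite -addnA -size_cat onth_cat ltnNge leq_addr /= addKn.
by case: (b).
Qed.
End Loop.

Definition binary_digits (X : finType) (x : X -> nat) k : seq {ffun X -> bool} :=
  mkseq (fun i => [ffun j => odd (x j %/ 2 ^ i)]) k.

Lemma binary_digitsS (X : finType) (x : X -> nat) k :
  binary_digits x k.+1 = rcons (binary_digits x k) [ffun j => odd (x j %/ 2 ^ k)].
Proof. exact: mkseqS. Qed.

Lemma binary_digits_value (X : finType) (x : X -> nat) k :
  (forall i, x i < 2 ^ k)%N -> digits_value (binary_digits x k) =1 x.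
Proof.
elim: k x => [|k IH] x lt_k i; first by have := lt_k i; case: (x i).
have -> : binary_digits x k.+1 =
    [ffun j => odd (x j)] :: binary_digits (fun j => x j %/ 2)%N k.
  rewrite /binary_digits /mkseq /=; congr cons.
    by apply/ffunP => j; rewrite !ffunE expn0 divn1.
  rewrite -[1%N]addn0 iotaDl -map_comp; apply: eq_map => m /=.
  by apply/ffunP => j; rewrite !ffunE -divnMA expnS.
rewrite /digits_value /= -/(digits_value _ i) IH => [|j]; last first.
  by rewrite ltn_divLR // mulnC -expnS.
by rewrite ffunE divn2 addnC odd_double_half.
Qed.

(** * Evaluating a counter on registers *)

Section CounterProgram.
Variables (X : finType) (D : counter X) (d : nat) (rk : X -> nat).
Hypothesis rk_lt : forall x, (rk x < d)%N.
Local Notation S := (ct_state D).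

Definition esum := foldr (EOp OpAdd) (EConst 0).
Definition eprod := foldr (EOp OpMul) (EConst 1).

Lemma eval_esum rho es : eval_expr rho (esum es) = \sum_(e <- es) eval_expr rho e.
Proof. by elim: es => [|e es IH] /=; rewrite ?big_nil ?big_cons ?IH. Qed.

Lemma eval_eprod rho es : eval_expr rho (eprod es) = \prod_(e <- es) eval_expr rho e.
Proof. by elim: es => [|e es IH] /=; rewrite ?big_nil ?big_cons ?IH. Qed.

Lemma vars_esum v es : expr_vars_below v (esum es) = all (expr_vars_below v) es.
Proof. by elim: es => //= e es ->. Qed.

Lemma vars_eprod v es : expr_vars_below v (eprod es) = all (expr_vars_below v) es.
Proof. by elim: es => //= e es ->. Qed.

(** Registers below [d] hold the inputs, register [d] controls the loop, and the states follow. *)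
Definition state_var (s : S) : nat := (d.+1 + enum_rank s)%N.
Local Notation V := (d.+1 + #|S|)%N.

Definition bit_expr x : expr := EOp OpSub (EVar (rk x))
  (EOp OpMul (EConst 2) (EOp OpDiv (EVar (rk x)) (EConst 2))).

(** The indicator that the lowest bits form the letter [r]. It selects the matrix without branching,
    so that a round is a single simultaneous assignment. *)
Definition letter_expr (r : {ffun X -> bool}) : expr :=
  eprod [seq if r x then bit_expr x else EOp OpSub (EConst 1) (bit_expr x) | x <- enum X].

Definition next_expr (s' : S) : expr :=
  esum [seq EOp OpMul (letter_expr r)
          (esum [seq EOp OpMul (EConst (ct_matrix r s s')%:Z) (EVar (state_var s)) | s <- enum S])
       | r <- enum {ffun X -> bool}].

Definition state_at (j : nat) : option S := omap enum_val (insub (j - d.+1)%N : option 'I_#|S|).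

(** Register [d] starts with the sum of the inputs and is halved along with them: it stays positive
    at least as long as any input does, and so tells when all digits have been read. *)
Definition counter_init (j : nat) : expr :=
  if (j < d)%N then EVar j else
  if j == d then esum [seq EVar i | i <- iota 0 d] else
  EConst (oapp (fun s => (ct_init s)%:Z) 0 (state_at j)).

Definition counter_body (j : nat) : expr :=
  if (j <= d)%N then (if (j < V)%N then EOp OpDiv (EVar j) (EConst 2) else EConst 0)
  else oapp next_expr (EConst 0) (state_at j).

Definition counter_final : expr :=
  esum [seq EOp OpMul (EConst ((ct_pos s)%:Z - (ct_neg s)%:Z)) (EVar (state_var s))
       | s <- enum S].

Lemma state_at_var s : state_at (state_var s) = Some s.
Proof.
rewrite /state_at /state_var addKn; case: insubP => [o _ oE|]; last by rewrite ltn_ord.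
by rewrite /= (ord_inj oE : o = enum_rank s) enum_rankK.
Qed.

Lemma state_varP j : (d < j < V)%N -> exists s, j = state_var s.
Proof.
case/andP => dj jV; have lt : (j - d.+1 < #|S|)%N by lia.
by exists (enum_val (Ordinal lt)); rewrite /state_var enum_valK /=; lia.
Qed.

Lemma state_var_lt s : (state_var s < V)%N.
Proof. by rewrite ltn_add2l. Qed.

Lemma counter_init_vars j : expr_vars_below V (counter_init j).
Proof.
rewrite /counter_init; case: ltnP => [jd|_]; first by rewrite /=; lia.
case: eqP => // _; rewrite vars_esum all_map; apply/allP => i.
by rewrite mem_iota /=; lia.
Qed.

Lemma letter_expr_vars r : expr_vars_below V (letter_expr r).
Proof.
rewrite vars_eprod all_map; apply/allP => x _ /=.
by have := rk_lt x; case: (r x) => /= ?; rewrite andbT andbb; lia.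
Qed.

Lemma counter_body_vars j : expr_vars_below V (counter_body j).
Proof.
rewrite /counter_body; case: (leqP j d) => _; first by case: (ltnP j V) => //= ->.
case: state_at => [s'|] //=; rewrite vars_esum all_map; apply/allP => r _ /=.
rewrite letter_expr_vars vars_esum all_map; apply/allP => s _ /=.
exact: state_var_lt.
Qed.

Lemma counter_final_vars : expr_vars_below V counter_final.
Proof.
rewrite vars_esum all_map; apply/allP => s _ /=; exact: state_var_lt.
Qed.

Section Run.
Variables (inp : seq nat).
Local Notation x := (fun i => nth 0%N inp (rk i)).
Definition input_sum : nat := (\sum_(i < d) nth 0%N inp i)%N.

Definition counter_value k j : int :=
  if (j < d)%N then (nth 0%N inp j %/ 2 ^ k)%N%:Z else
  if j == d then (input_sum %/ 2 ^ k)%N%:Z else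
  oapp (fun s => (ct_run D (binary_digits x k) s)%:Z) 0 (state_at j).

Lemma counter_value_var k s :
  counter_value k (state_var s) = (ct_run D (binary_digits x k) s)%:Z.
Proof.
rewrite /counter_value state_at_var /= /state_var.
by rewrite ltnNge gtn_eqF ?addSn ?ltnS ?leq_addr // ltnW // ltnS leq_addr.
Qed.

Lemma counter_value0 j : (j < V)%N ->
  counter_value 0 j = eval_expr (fun i => (nth 0%N inp i)%:Z) (counter_init j).
Proof.
move=> jV; rewrite /counter_value /counter_init; case: ltnP => jd; first by rewrite divn1.
case: eqP => // _; rewrite divn1 eval_esum big_map /input_sum (raddf_sum Posz) /=.
by rewrite -(big_mkord xpredT (fun i => (nth 0%N inp i)%:Z)) /index_iota subn0.
Qed.

Lemma eval_bit k i : eval_expr (counter_value k) (bit_expr i) = (odd (x i %/ 2 ^ k))%:Z.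
Proof.
rewrite /= /counter_value rk_lt divz_nat divn2.
by set m := (_ %/ _)%N; rewrite -{1}(odd_double_half m) PoszD -mul2n PoszM addrK.
Qed.

Lemma eval_letter k r : eval_expr (counter_value k) (letter_expr r) =
  (r == [ffun i => odd (x i %/ 2 ^ k)])%:Z.
Proof.
have litE i : eval_expr (counter_value k)
    (if r i then bit_expr i else EOp OpSub (EConst 1) (bit_expr i)) =
    (r i == odd (x i %/ 2 ^ k))%:Z.
  move: (bit_expr i) (eval_bit k i) => e bE.
  by case: (r i) => /=; rewrite bE; case: odd.
rewrite eval_eprod big_map big_enum /= (eq_bigr _ (fun i _ => litE i)).
case: eqP => [->|nr]; first by rewrite big1 // => i _; rewrite ffunE eqxx.
have [i ri] : exists i, r i != odd (x i %/ 2 ^ k).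
  apply/existsP; rewrite -negb_forall; apply/negP => /forallP h; apply: nr.
  by apply/ffunP => i; rewrite ffunE; apply/eqP; rewrite h.
by rewrite (bigD1 i) //= (negbTE ri) mul0r.
Qed.

Lemma counter_valueS k j : (j < V)%N ->
  counter_value k.+1 j = eval_expr (counter_value k) (counter_body j).
Proof.
move=> jV; rewrite /counter_body; case: (leqP j d) => jd.
  rewrite jV /= /counter_value expnSr; case: ltnP => jd'; first by rewrite divz_nat divnMA.
  have -> : j == d by rewrite eqn_leq jd jd'.
  by rewrite divz_nat divnMA.
have [s' ->] : exists s, j = state_var s by apply: state_varP; rewrite jd jV.
rewrite counter_value_var state_at_var /= eval_esum big_map big_enum /=.
set r := [ffun i => odd (x i %/ 2 ^ k)].
rewrite (bigD1 r) //= eval_letter -/r eqxx mul1r big1 ?addr0 => [|r' nr]; last first.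
  by rewrite eval_letter -/r (negbTE nr) mul0r.
rewrite binary_digitsS /ct_run foldl_rcons -/(ct_run _ _) -/r /ct_step.
rewrite (raddf_sum Posz) /= eval_esum big_map big_enum /=; apply: eq_bigr => s _.
by rewrite counter_value_var PoszM mulrC.
Qed.

Lemma counter_final_value k : (0 < eval_expr (counter_value k) counter_final) =
  ct_accepts D (binary_digits x k).
Proof.
rewrite /ct_accepts -ltz_nat -[RHS]subr_gt0 !(raddf_sum Posz) /= -sumrB.
rewrite eval_esum big_map big_enum /=; congr (0 < _); apply: eq_bigr => s _.
by rewrite counter_value_var !PoszM; ring.
Qed.

Definition growth : nat := (\sum_(r : {ffun X -> bool}) \sum_s \sum_s' ct_matrix (c := D) r s s')%N.
Definition start_size : nat := (\sum_s ct_init (c := D) s)%N.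

Lemma ct_run_le ds : (\sum_s ct_run D ds s <= start_size * growth ^ size ds)%N.
Proof.
elim/last_ind: ds => [|ds r IH]; first by rewrite muln1.
rewrite /ct_run foldl_rcons -/(ct_run _ _) size_rcons expnSr mulnA.
apply: leq_trans (leq_mul IH (leqnn _)).
rewrite /ct_step exchange_big big_distrl /=; apply: leq_sum => s _.
rewrite -big_distrr /=; apply: leq_mul => //.
rewrite /growth (bigD1 r) //= [X in (_ <= X + _)%N](bigD1 s) //=.
exact: leq_trans (leq_addr _ _) (leq_addr _ _).
Qed.

Variable N : nat.
Hypotheses (N_ge2 : (2 <= N)%N) (inp_le : forall i, (nth 0 inp i <= N)%N).

Definition rounds : nat := (trunc_log 2 input_sum).+1.

Lemma input_sum_le : (input_sum <= N ^ d.+1)%N.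
Proof.
apply: (@leq_trans (d * N)); last first.
  by rewrite expnSr leq_mul // ltnW // ltn_expl.
by rewrite -[d in (d * _)%N]card_ord -sum_nat_const; apply: leq_sum => i _.
Qed.

Lemma input_lt_rounds : (input_sum < 2 ^ rounds)%N.
Proof. exact: trunc_log_ltn. Qed.

(** The sum of the inputs is at most [d * N <= N ^ d.+1], and [2 <= N] absorbs the factor 2 of the
    additional round. *)
Lemma rounds_pow_le : (2 ^ rounds <= N ^ d.+2)%N.
Proof.
rewrite /rounds expnS [(N ^ _.+2)%N]expnS; apply: leq_mul => //.
case: (posnP input_sum) => [->|s0]; first by rewrite trunc_log0 expn_gt0 ltnW.
exact: leq_trans (trunc_logP _ s0) input_sum_le.
Qed.

(** As [trunc_log 2 N] is positive, [N < 2 ^ (trunc_log 2 N).+1] is at most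
    [2 ^ (2 * trunc_log 2 N)]; this is the factor 2. *)
Lemma rounds_le : (rounds <= d.+2 * 2 * trunc_log 2 N)%N.
Proof.
have L0 : (0 < trunc_log 2 N)%N by rewrite trunc_log_gt0.
rewrite -(leq_exp2l _ _ (isT : 1 < 2)%N); apply: leq_trans rounds_pow_le _.
rewrite -mulnA mulnC expnM leq_exp2r //; apply: ltnW.
apply: leq_trans (trunc_log_ltn N (isT : 1 < 2)%N) _.
by rewrite leq_exp2l //; lia.
Qed.

(** The essential estimate is [growth ^ rounds <= (2 ^ rounds) ^ growth], whose right side is
    polynomial in [N] because the number of rounds is logarithmic. *)
Lemma counter_value_le k j : (k <= rounds)%N ->
  (`|counter_value k j| <= N ^ (d.+1 + start_size + d.+2 * growth))%N.
Proof.
move=> kK; have N0 : (0 < N)%N by apply: ltnW.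
rewrite /counter_value; case: ltnP => _ /=.
  apply: leq_trans (leq_div _ _) _; apply: leq_trans (inp_le j) _.
  by rewrite -[X in (X <= _)%N]expn1 leq_pexp2l // !addSn.
case: eqP => _ /=.
  apply: leq_trans (leq_div _ _) _; apply: leq_trans input_sum_le _.
  by rewrite leq_pexp2l // -addnA leq_addr.
case: state_at => [s|] //=.
apply: (@leq_trans (\sum_s ct_run D (binary_digits x k) s)).
  by rewrite (bigD1 s) //= leq_addr.
apply: leq_trans (ct_run_le _) _; rewrite size_mkseq -addnA expnD.
apply: leq_trans (leq_pmull _ _); last by rewrite expn_gt0 N0.
rewrite expnD; apply: leq_mul; first exact: ltnW (ltn_expl _ _).
case: (posnP growth) => [->|g0].
  by rewrite muln0 expn0; case: k {kK} => [|k]; rewrite ?expn0 ?exp0n.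
apply: (@leq_trans (growth ^ rounds)); first by rewrite leq_pexp2l.
apply: (@leq_trans ((2 ^ growth) ^ rounds)).
  by rewrite leq_exp2r // ltnW // ltn_expl.
by rewrite -expnM mulnC expnM expnM leq_exp2r // rounds_pow_le.
Qed.
End Run.

Theorem counter_ram : exists (P : program) (C : nat), forall (N : nat) (inp : seq nat),
  (2 <= N)%N -> (forall i, nth 0 inp i <= N)%N ->
  exists2 k, (forall x, nth 0 inp (rk x) < 2 ^ k)%N &
    ram_run P inp (C * trunc_log 2 N) (N ^ C)
      (ct_accepts D (binary_digits (fun x => nth 0%N inp (rk x)) k)).
Proof.
pose I := assign_block V counter_init; pose L := assign_block V counter_body.
pose F := compile counter_final V.
pose M := (\sum_(j < V) (expr_degree (counter_init j) + expr_degree (counter_body j)) +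
  (expr_degree counter_final).+1)%N.
pose e := (d.+1 + start_size + d.+2 * growth)%N.
exists (loop_program V d counter_init counter_body counter_final).
(* One constant serves both for time and for register size, as the sum of the two requirements. *)
exists (d.+2 * 2 * (size L).+1 + (size I + size F).+1 + e * M)%N => N inp N2 inp_le.
set C := (_ + e * M)%N; set K := rounds inp; exists K => [x|].
  apply: leq_ltn_trans (input_lt_rounds inp).
  by rewrite /input_sum (bigD1 (Ordinal (rk_lt x))) //= leq_addr.
have N0 : (0 < N)%N by apply: ltnW.
have B2 : (2 <= N ^ e)%N.
  by apply: leq_trans N2 _; rewrite -[X in (X <= _)%N]expn1 leq_pexp2l.
have degG m : (m <= M)%N -> ((N ^ e) ^ m <= (N ^ e) ^ M)%N by rewrite leq_exp2l.
have degV (j : nat) : (j < V)%N ->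
    (expr_degree (counter_init j) + expr_degree (counter_body j) <= M)%N.
  move=> jV; rewrite /M (bigD1 (Ordinal jV)) //= -addnA; exact: leq_addr.
have GC : ((N ^ e) ^ M <= N ^ C)%N by rewrite -expnM leq_pexp2l // leq_addl.
have dV : (d < V)%N by rewrite addSn ltnS leq_addr.
have dE k : counter_value inp k d = (input_sum inp %/ 2 ^ k)%N.
  by rewrite /counter_value ltnn eqxx.
have [||||||||||||t [tT vE hG]] := @loop_programP V d counter_init counter_body counter_final
  dV counter_init_vars counter_body_vars counter_final_vars
  (fun i => (nth 0%N inp i)%:Z) (counter_value inp) K (N ^ e) ((N ^ e) ^ M).
- by [].
- exact: B2.
- by rewrite -[X in (X <= _)%N]expn1; apply: degG; rewrite /M addnS.
- exact: counter_value0.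
- exact: counter_valueS.
- move=> k /andP[k0 kK]; rewrite dE ltz_nat divn_gt0 ?expn_gt0 //.
  (* If the inputs sum to zero there is a single round, and no [k] lies strictly between 0 and
     [K]. *)
  have s0 : (0 < input_sum inp)%N.
    by case: (posnP (input_sum inp)) kK => // s0; rewrite /K /rounds s0 trunc_log0; case: k k0.
  by apply: leq_trans (trunc_logP (isT : 1 < 2)%N s0); rewrite leq_exp2l.
- by rewrite dE divn_small // input_lt_rounds.
- move=> i; apply: leq_trans (inp_le i) _.
  by rewrite -[X in (X <= _)%N]expn1 leq_pexp2l.
- by move=> k j kK jV; apply: counter_value_le.
- by move=> j jV; apply/degG/leq_trans/degV/jV; apply: leq_addr.
- by move=> j jV; apply/degG/leq_trans/degV/jV; apply: leq_addl.
- by apply: degG; rewrite /M addnS ltnW // ltnS leq_addl.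
exists t; split.
- apply: leq_trans tT _; rewrite -/I -/L -/F /C.
  have L0 : (0 < trunc_log 2 N)%N by rewrite trunc_log_gt0.
  have := rounds_le N2 inp_le; rewrite -/K => KL.
  apply: (@leq_trans (d.+2 * 2 * trunc_log 2 N * (size L).+1 +
                      (size I + size F).+1 * trunc_log 2 N)).
    by apply: leq_add; [rewrite leq_mul2r KL orbT|rewrite leq_pmulr].
  by rewrite [X in (X + _ <= _)%N]mulnAC -mulnDl leq_mul2r leq_addr orbT.
- by rewrite vE counter_final_value.
by move=> s i st; apply: leq_trans (hG s st i) GC.
Qed.
End CounterProgram.

(** * The Turing machine *)

Section BinaryTapes.
Variable Sigma : finType.
Local Notation A := (Sigma + bool)%type.
Local Notation tape := (tape A).
Implicit Types (t : tape) (ls rs : seq bool).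

Definition dig (b : bool) : option A := Some (inr b).
Definition dval (c : option A) : bool := if c is Some (inr b) then b else false.

Definition act (a : option A * move) t : tape := tape_move a.2 (tape_write a.1 t).

(** The digits [ls] lie to the left of the head, nearest first, and [rs] from the head on. Visited
    blanks stay in the lists, so contents are fixed only up to trailing blanks. *)
Definition holds t ls rs : Prop := exists a b,
  tape_left t = map dig ls ++ nseq a None /\
  tape_head t :: tape_right t = map dig rs ++ nseq b None.

Definition holds_before t rs : Prop := exists a b,
  [/\ tape_left t = nseq a None, tape_head t = None
    & tape_right t = map dig rs ++ nseq b None].

(** The input tapes are consumed leftwards from the least significant digit, and this describes what
    is still to be read. *)
Definition holds_left t ls : Prop := exists a,
  tape_head t :: tape_left t = map dig ls ++ nseq a None.

Lemma holds_head_nil t ls : holds t ls [::] -> tape_head t = None.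
Proof. by case=> a [[|b] [_ //]] [-> _]. Qed.

Lemma holds_head_cons t ls b rs : holds t ls (b :: rs) -> tape_head t = dig b.
Proof. by case=> a [k [_ [-> _]]]. Qed.

Lemma dval_head t ls rs : holds t ls rs -> dval (tape_head t) = head false rs.
Proof.
case: rs => [|b rs] h; first by rewrite (holds_head_nil h).
by rewrite (holds_head_cons h).
Qed.

Lemma holds_write_right t ls rs b : holds t ls rs ->
  holds (act (dig b, MoveRight) t) (b :: ls) (behead rs).
Proof.
case: t => l c r [a [k [/= -> E]]].
have [k' rE] : exists k', r = map dig (behead rs) ++ nseq k' None.
  case: rs E => [|b' rs] [] /=; last by move=> _ ->; exists k.
  by case: k => // k [_ ->]; exists k.
case: r {E} rE => [|x r] rE.
  exists a, 1%N; split=> //=; case: (behead rs) rE => [|? ?] //.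
exists a, k'; split=> //=.
Qed.

Lemma holds_keep_right t ls b rs : holds t ls (b :: rs) ->
  holds (act (tape_head t, MoveRight) t) (b :: ls) rs.
Proof. by move=> h; rewrite (holds_head_cons h); apply: holds_write_right h. Qed.

Lemma holds_keep_left t b ls rs : holds t (b :: ls) rs ->
  holds (act (tape_head t, MoveLeft) t) ls (b :: rs).
Proof. by case: t => l c r [a [k [/= -> E]]]; exists a, k; rewrite /= E. Qed.

Lemma holds_before_start t rs : holds t [::] rs ->
  holds_before (act (tape_head t, MoveLeft) t) rs.
Proof.
case: t => l c r [a [k [/= -> E]]]; case: a => [|a] /=.
  by exists 0%N, k; split.
by exists a, k; split.
Qed.

Lemma holds_start t rs : holds_before t rs ->
  holds (act (tape_head t, MoveRight) t) [::] rs.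
Proof.
case: t => l c r [a [k [/= -> -> E]]]; case: r E => [|x r] E.
  exists a.+1, 1%N; split=> //=; by case: rs E.
by exists a.+1, k; split.
Qed.

Lemma holds_left_head t ls : holds_left t ls ->
  dval (tape_head t) = head false ls /\ (tape_head t == None) = (ls == [::]).
Proof. by case: ls => [|b ls] [a] /=; [case: a => //= a|] => -[-> _]. Qed.

Lemma holds_left_move t ls : holds_left t ls ->
  holds_left (act (tape_head t, MoveLeft) t) (behead ls).
Proof.
case: t => l c r [a /= E].
have [a' lE] : exists a', l = map dig (behead ls) ++ nseq a' None.
  case: ls E => [|b ls] [] /=; last by move=> _ ->; exists a.
  by case: a => // a [_ ->]; exists a.
case: l {E} lE => [|x l] lE; last by exists a'.
by exists 1%N; case: (behead ls) lE.
Qed.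

Lemma holds_left_of_holds t ls : holds t ls [::] ->
  holds_left (act (tape_head t, MoveLeft) t) ls.
Proof.
case: t => l c r [a [k [/= -> _]]]; case: ls => [|b ls]; last by exists a.
by case: a => [|a]; [exists 1%N|exists a.+1].
Qed.

Lemma act_keep t : act (tape_head t, Stay) t = t.
Proof. by case: t. Qed.
End BinaryTapes.

(** * The machine and its passes *)

Definition letter (l : nat) : finType := {ffun 'I_3 * 'I_l -> bool}.

Section Machine.
Variables (l : nat) (U : finType).
Local Notation X := ('I_3 * 'I_l)%type.
(* [None] loads the initial vector, [Some None] computes the two numbers to be
   compared. *)
Local Notation pass := (option (option (letter l))).
Variables (pmat : pass -> U -> U -> nat) (pinit : pass -> U -> nat) (o1 o2 : U).

(** If the carries are within this bound, a column total is at most its double, and the next carry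
    is within the bound again. [pinit] is included because the added vector enters as the first
    carry. *)
Definition carry_max : nat :=
  (\sum_(p : pass) \sum_d (\sum_c pmat p c d + pinit p d))%N.

Lemma carry_max_large p d : (\sum_c pmat p c d + pinit p d <= carry_max)%N.
Proof.
rewrite /carry_max (bigD1 p) //= [X in (_ <= X + _)%N](bigD1 d) //=.
exact: leq_trans (leq_addr _ _) (leq_addr _ _).
Qed.

Definition carries : finType := {ffun U -> 'I_carry_max.+1}.

Definition machine_state : finType :=
  (('I_4 * 'I_l.+1 * bool) + ((pass * carries) +
   ((bool * bool) + (unit + (bool + bool)))))%type.

Definition Parse (q i : nat) (b : bool) : machine_state := inl (inord q, inord i, b).
Definition Sweep (p : pass) (k : carries) : machine_state := inr (inl (p, k)).
Definition Rewind (first last_pass : bool) : machine_state :=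
  inr (inr (inl (first, last_pass))).
Definition Read : machine_state := inr (inr (inr (inl tt))).
Definition Compare (b : bool) : machine_state := inr (inr (inr (inr (inl b)))).
Definition Halted (b : bool) : machine_state := inr (inr (inr (inr (inr b)))).

Definition start_carry (p : pass) : carries := [ffun d => inord (pinit p d)].

Local Notation cell := (cell symbol bool).
Local Notation action := (cell * move)%type.

(** Schoolbook multiplication of a vector by a constant matrix: the coordinates lie on parallel
    tapes, and one column of their digits is processed at a time, with a bounded carry for each
    coordinate. *)
Definition column_total (p : pass) (k : carries) (col : {ffun U -> bool}) (d : U) : nat :=
  (\sum_c col c * pmat p c d + k d)%N.

Definition next_carry p k col : carries := [ffun d => inord (column_total p k col d)./2].
Definition out_column p k col : {ffun U -> bool} := [ffun d => odd (column_total p k col d)].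

Definition keep_all (I : finType) (h : {ffun I -> cell}) (m : move) : {ffun I -> action} :=
  [ffun i => (h i, m)].

Definition reject (h0 : cell) (hx : {ffun X -> cell}) (hu : {ffun U -> cell}) :
    machine_state * action * {ffun X -> action} * {ffun U -> action} :=
  (Halted false, (h0, Stay), keep_all hx Stay, keep_all hu Stay).

(** In [Parse], [q] counts the finished partitions, [i] the finished parts of the current one, and
    [b] tells whether a part has been begun; [b || bit] refuses a leading zero. A sweep ends when
    digits and carries are exhausted. [Rewind] first leaves the blank at the right end, and then
    looks for the blank at the left end. Testing the tape [o1] suffices because all vector tapes
    have the same length. *)
Definition delta (s : machine_state) (h0 : cell) (hx : {ffun X -> cell})
    (hu : {ffun U -> cell}) :
    machine_state * action * {ffun X -> action} * {ffun U -> action} :=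
  match s with
  | inl (q, i, b) =>
      match h0 with
      | Some (inl (inl bit)) =>
          if [&& q < 3, i < l & b || bit]%N then
            (Parse q i true, (h0, MoveRight),
             [ffun x : X => if (x.1 == q :> nat) && (x.2 == i :> nat)
                        then (dig symbol bit, MoveRight) else (hx x, Stay)],
             keep_all hu Stay)
          else reject h0 hx hu
      | Some (inl (inr false)) =>
          if (q < 3)%N && b then
            (Parse q i.+1 false, (h0, MoveRight), keep_all hx Stay, keep_all hu Stay)
          else reject h0 hx hu
      | Some (inl (inr true)) =>
          if (q < 3)%N && ~~ b then
            (Parse q.+1 0 false, (h0, MoveRight), keep_all hx Stay, keep_all hu Stay)
          else reject h0 hx hu
      | None =>
          if (q < 3)%N then reject h0 hx hu else
          (Sweep None (start_carry None), (h0, Stay), keep_all hx MoveLeft,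
           keep_all hu Stay)
      | _ => reject h0 hx hu
      end
  | inr (inl (p, k)) =>
      if (hu o1 == None) && (k == [ffun=> ord0]) then
        (Rewind true (p == Some None), (h0, Stay), keep_all hx Stay, keep_all hu Stay)
      else
        let col := [ffun c => dval (hu c)] in
        (Sweep p (next_carry p k col), (h0, Stay), keep_all hx Stay,
         [ffun d => (dig symbol (out_column p k col d), MoveRight)])
  | inr (inr (inl (first, last_pass))) =>
      if ~~ first && (hu o1 == None) then
        (if last_pass then Compare false else Read, (h0, Stay), keep_all hx Stay,
         keep_all hu MoveRight)
      else (Rewind false last_pass, (h0, Stay), keep_all hx Stay, keep_all hu MoveLeft)
  | inr (inr (inr (inl tt))) =>
      let p := if [forall x, hx x == None] then Some None
               else Some (Some [ffun x => dval (hx x)]) in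
      (Sweep p (start_carry p), (h0, Stay), keep_all hx MoveLeft, keep_all hu Stay)
  | inr (inr (inr (inr (inl b)))) =>
      if hu o1 == None then
        (Halted b, (h0, Stay), keep_all hx Stay, keep_all hu Stay)
      else
        (Compare (if dval (hu o1) == dval (hu o2) then b else dval (hu o2)),
         (h0, Stay), keep_all hx Stay, keep_all hu MoveRight)
  | inr (inr (inr (inr (inr b)))) =>
      (s, (h0, Stay), keep_all hx Stay, keep_all hu Stay)
  end.

Definition tape_index (y : option (X + U)) : 'I_#|{: X + U}|.+1 :=
  oapp (fun z => lift ord0 (enum_rank z)) ord0 y.

Definition tape_kind (i : 'I_#|{: X + U}|.+1) : option (X + U) :=
  omap enum_val (unlift ord0 i).

Lemma tape_indexK : cancel tape_index tape_kind.
Proof.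
by case=> [z|]; rewrite /tape_kind /= ?liftK /= ?enum_rankK // unlift_none.
Qed.

Definition machine_verdict (s : machine_state) : option bool :=
  if s is inr (inr (inr (inr (inr b)))) then Some b else None.

Definition machine : tm symbol :=
  @TM symbol #|{: X + U}| bool machine_state (Parse 0 0 false) machine_verdict
    (fun s h =>
       let: (s', a0, ax, au) := delta s (h (tape_index None))
         [ffun x => h (tape_index (Some (inl x)))]
         [ffun c => h (tape_index (Some (inr c)))] in
       (s', [ffun i => match tape_kind i with
                       | None => a0 | Some (inl x) => ax x | Some (inr c) => au c
                       end])).

Local Notation tape := (tape (symbol + bool)%type).

Definition config (s : machine_state) (t0 : tape) (tx : X -> tape) (tu : U -> tape) :
    tm_config machine :=
  @TMConfig _ machine s [ffun i => match tape_kind i with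
                       | None => t0 | Some (inl x) => tx x | Some (inr c) => tu c
                       end].

Lemma stepE s t0 tx tu : machine_verdict s = None ->
  tm_step (config s t0 tx tu) =
  let: (s', a0, ax, au) := delta s (tape_head t0) [ffun x => tape_head (tx x)]
    [ffun c => tape_head (tu c)] in
  config s' (act a0 t0) (fun x => act (ax x) (tx x)) (fun c => act (au c) (tu c)).
Proof.
move=> vs; rewrite /tm_step /= vs.
set h := (X in delta s (X (tape_index None))).

have -> : h (tape_index None) = tape_head t0 by rewrite /h !ffunE tape_indexK.
have -> : [ffun x => h (tape_index (Some (inl x)))] = [ffun x => tape_head (tx x)].
  by apply/ffunP => x; rewrite /h !ffunE tape_indexK.
have -> : [ffun c => h (tape_index (Some (inr c)))] = [ffun c => tape_head (tu c)].
  by apply/ffunP => c; rewrite /h !ffunE tape_indexK.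
case: delta => [[[s' a0] ax] au]; congr TMConfig; apply/ffunP => i.
by rewrite !ffunE; case: (tape_kind i) => [[x|c]|].
Qed.

Local Notation step := (@tm_step _ machine).

Lemma config_ext s t0 tx tx' tu tu' : tx =1 tx' -> tu =1 tu' ->
  config s t0 tx tu = config s t0 tx' tu'.
Proof.
move=> Ex Eu; congr TMConfig; apply/ffunP => i; rewrite !ffunE.
by case: (tape_kind i) => [[x|c]|].
Qed.

Lemma keep_stay (I : finType) (t : I -> tape) i :
  act (keep_all [ffun j => tape_head (t j)] Stay i) (t i) = t i.
Proof. by rewrite /keep_all !ffunE act_keep. Qed.

Definition columns (tu : U -> tape) (lcols rcols : seq {ffun U -> bool}) : Prop :=
  forall c, holds (tu c) [seq col c | col : {ffun U -> bool} <- lcols]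
                         [seq col c | col : {ffun U -> bool} <- rcols].

Lemma columns_end tu lcols rcols : columns tu lcols rcols ->
  (tape_head (tu o1) == None) = (rcols == [::]).
Proof.
move=> /(_ o1); case: rcols => [|col rcols] h; first by rewrite (holds_head_nil h).
by rewrite (holds_head_cons h).
Qed.

Lemma start_carryE p d : start_carry p d = pinit p d :> nat.
Proof.
rewrite ffunE inordK // ltnS; apply: leq_trans (carry_max_large p d).
exact: leq_addl.
Qed.

Lemma column_total_le p (k : carries) col d :
  (column_total p k col d <= carry_max.*2)%N.
Proof.
rewrite -addnn; apply: leq_add; last by rewrite -ltnS.
apply: leq_trans (carry_max_large p d); apply: leq_trans (leq_addr _ _).
by apply: leq_sum => c _; case: (col c); rewrite ?mul1n ?mul0n.
Qed.

Lemma next_carryE p (k : carries) col d :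
  next_carry p k col d = (column_total p k col d)./2 :> nat.
Proof.
rewrite ffunE inordK // ltnS -[carry_max]doubleK; apply: half_leq.
exact: column_total_le.
Qed.

Lemma zero_carryP (k : carries) : reflect (forall d, k d = 0%N :> nat) (k == [ffun=> ord0]).
Proof.
apply: (iffP eqP) => [-> d|h]; first by rewrite ffunE.
by apply/ffunP => d; apply: ord_inj; rewrite ffunE h.
Qed.

Definition head_column (rcols : seq {ffun U -> bool}) : {ffun U -> bool} :=
  head [ffun=> false] rcols.

Lemma sweep_step p (k : carries) lcols rcols t0 tx tu : columns tu lcols rcols ->
  ~~ ((rcols == [::]) && (k == [ffun=> ord0])) ->
  exists2 tu', step (config (Sweep p k) t0 tx tu) =
      config (Sweep p (next_carry p k (head_column rcols))) t0 tx tu' &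
    columns tu' (out_column p k (head_column rcols) :: lcols) (behead rcols).
Proof.
move=> hu nend; rewrite stepE //= ffunE (columns_end hu) (negbTE nend).
have -> : [ffun c => dval ([ffun c => tape_head (tu c)] c)] = head_column rcols.
  apply/ffunP => c; rewrite !ffunE (dval_head (hu c)).
  by case: rcols {hu nend} => [|col rcols] /=; rewrite ?ffunE.
rewrite act_keep; set au := [ffun d => _].
exists (fun c => act (au c) (tu c)).
  by apply: config_ext => // x; rewrite keep_stay.
move=> c; rewrite /au ffunE /= -behead_map; apply: holds_write_right; exact: hu.
Qed.

Lemma sweep_end p (k : carries) lcols t0 tx tu : columns tu lcols [::] ->
  k == [ffun=> ord0] ->
  step (config (Sweep p k) t0 tx tu) = config (Rewind true (p == Some None)) t0 tx tu.
Proof.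
move=> hu k0; rewrite stepE //= ffunE (columns_end hu) k0 /= act_keep.
by apply: config_ext => i; rewrite keep_stay.
Qed.

(** Past the last column every step halves the carries, so they vanish within [m] further
    columns. *)
Lemma sweep_carry m p (k : carries) lcols t0 tx tu : columns tu lcols [::] ->
  (forall d, k d <= m)%N ->
  exists out tu', [/\ iter (size out).+1 step (config (Sweep p k) t0 tx tu) =
      config (Rewind true (p == Some None)) t0 tx tu',
    columns tu' (rev out ++ lcols) [::],
    forall d, digits_value out d = k d & (size out <= m)%N].
Proof.
elim: m k lcols tu => [|m IH] k lcols tu hu km; case: (boolP (k == [ffun=> ord0])) => k0.
- exists [::], tu; split=> //; first exact: sweep_end hu k0.
  by move=> d; rewrite (zero_carryP _ k0).
- by case/zero_carryP: k0 => d; apply/eqP; rewrite -leqn0.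
- exists [::], tu; split=> //; first exact: sweep_end hu k0.
  by move=> d; rewrite (zero_carryP _ k0).
have [|tu1 e1 hu1] := @sweep_step p k lcols [::] t0 tx tu hu; first by rewrite (negbTE k0).
have totE d : column_total p k (head_column [::]) d = k d.
  by rewrite /column_total big1 // => c _; rewrite ffunE mul0n.
have [|out [tu2 [e2 hu2 v2 s2]]] := IH (next_carry p k (head_column [::])) _ tu1 hu1.
  by move=> d; rewrite next_carryE totE; have := km d; lia.
exists (out_column p k (head_column [::]) :: out), tu2; split=> //.
- by rewrite iterSr e1.
- by rewrite rev_cons cat_rcons.
move=> d; rewrite /digits_value /= -/(digits_value _ d) v2 next_carryE totE ffunE totE.
by rewrite addnC odd_double_half.
Qed.

Lemma sweep_run p (k : carries) lcols rcols t0 tx tu : columns tu lcols rcols ->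
  exists out tu', [/\ iter (size out).+1 step (config (Sweep p k) t0 tx tu) =
      config (Rewind true (p == Some None)) t0 tx tu',
    columns tu' (rev out ++ lcols) [::],
    forall d, digits_value out d = (\sum_c digits_value rcols c * pmat p c d + k d)%N
    & (size out <= size rcols + carry_max)%N].
Proof.
elim: rcols k lcols tu => [|col rcols IH] k lcols tu hu.
  have [d|out [tu' [e h v s]]] := @sweep_carry carry_max p k lcols t0 tx tu hu.
    by rewrite -ltnS.
  exists out, tu'; split=> // d; rewrite v big1 // => c _.
have [//|tu1 e1 hu1] := @sweep_step p k lcols (col :: rcols) t0 tx tu hu.
have [out [tu2 [e2 hu2 v2 s2]]] := IH (next_carry p k col) _ tu1 hu1.
exists (out_column p k col :: out), tu2; split=> //.
- by rewrite iterSr e1.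
- by rewrite rev_cons cat_rcons.
move=> d; rewrite /digits_value /= -/(digits_value _ d) v2 next_carryE ffunE.
have -> : (\sum_c ((digits_value rcols c).*2 + col c) * pmat p c d =
    (\sum_c digits_value rcols c * pmat p c d).*2 + \sum_c col c * pmat p c d)%N.
  rewrite -mul2n big_distrr -big_split /=; apply: eq_bigr => c _.
  by rewrite -mul2n mulnDl mulnA.
rewrite doubleD -!addnA; congr addn.
by rewrite [in RHS]addnC addnC odd_double_half /column_total addnC.
Qed.

Lemma rewind_run lcols rcols last_pass t0 tx tu :
  match lcols with
  | [::] => forall c, holds_before (tu c) [seq col c | col : {ffun U -> bool} <- rcols]
  | col :: lcols' => columns tu lcols' (col :: rcols)
  end ->
  exists2 tu', iter (size lcols).+1 step (config (Rewind false last_pass) t0 tx tu) =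
      config (if last_pass then Compare false else Read) t0 tx tu' &
    columns tu' [::] (rev lcols ++ rcols).
Proof.
elim: lcols rcols tu => [|col lcols IH] rcols tu hu.
  exists (fun c => act (tape_head (tu c), MoveRight) (tu c)).
    rewrite /= stepE //= ffunE; have [_ [_ [_ -> _]]] := hu o1; rewrite eqxx act_keep.
    by apply: config_ext => i; rewrite ?keep_stay // /keep_all !ffunE.
  by move=> c; apply: holds_start (hu c).
rewrite iterSr [step _]stepE //= ffunE (columns_end hu) /= act_keep.
set au := keep_all _ MoveLeft.
have [|tu' e h] := IH (col :: rcols) (fun c => act (au c) (tu c)).
  case: lcols {IH} hu => [|col' lcols] hu c; rewrite /au /keep_all !ffunE.
    exact: holds_before_start.
  exact: holds_keep_left.
exists tu'; last by rewrite rev_cons cat_rcons.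
by rewrite -e iterS; congr (step (iter _ _ _)); apply: config_ext => // x; rewrite keep_stay.
Qed.

Lemma rewind_all lcols last_pass t0 tx tu : columns tu lcols [::] ->
  exists2 tu', iter (size lcols).+2 step (config (Rewind true last_pass) t0 tx tu) =
      config (if last_pass then Compare false else Read) t0 tx tu' &
    columns tu' [::] (rev lcols).
Proof.
move=> hu; rewrite iterSr [step _]stepE //= act_keep; set au := keep_all _ MoveLeft.
have [|tu' e h] := @rewind_run lcols [::] last_pass t0 tx (fun c => act (au c) (tu c)).
  case: lcols hu => [|col' lcols] hu c; rewrite /au /keep_all !ffunE.
    exact: holds_before_start.
  exact: holds_keep_left.
exists tu'; last by rewrite cats0 in h.
by rewrite -e iterS; congr (step (iter _ _ _)); apply: config_ext => // x; rewrite keep_stay.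
Qed.

Definition pass_step p (u : U -> nat) d : nat := (\sum_c u c * pmat p c d + pinit p d)%N.

Lemma pass_run p cols t0 tx tu : columns tu [::] cols ->
  exists n out tu', [/\ iter n step (config (Sweep p (start_carry p)) t0 tx tu) =
      config (if p == Some None then Compare false else Read) t0 tx tu',
    columns tu' [::] out, digits_value out =1 pass_step p (digits_value cols),
    (size out <= size cols + carry_max)%N
    & (n <= (size cols + carry_max).*2 + 3)%N].
Proof.
move=> hu; have [out [tu1 [e1 h1 v1 s1]]] := sweep_run p (start_carry p) t0 tx hu.
rewrite cats0 in h1; have [tu2 e2 h2] := rewind_all (p == Some None) t0 tx h1.
exists ((size (rev out)).+2 + (size out).+1)%N, out, tu2; split=> //.
- by rewrite iterD e1.
- by rewrite revK in h2.
- by move=> d; rewrite v1 start_carryE.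
by rewrite size_rev; lia.
Qed.

(** Digits come least significant first, so the verdict is revised at each difference and the last
    one decides. *)
Lemma compare_run cols b t0 tx tu lcols : columns tu lcols cols ->
  exists c', iter (size cols).+1 step (config (Compare b) t0 tx tu) = c' /\
    tm_cur c' = Halted (if digits_value cols o1 == digits_value cols o2 then b
                        else digits_value cols o1 < digits_value cols o2)%N.
Proof.
elim: cols b tu lcols => [|col cols IH] b tu lcols hu.
  eexists; split; first by reflexivity.
  by rewrite /= stepE //= ffunE (columns_end hu).
rewrite iterSr [step _]stepE //= !ffunE (columns_end hu) /=.
rewrite !(dval_head (hu _)) /=; set b' := if col o1 == _ then _ else _.
rewrite act_keep; set tu1 := fun c : U => act (keep_all _ MoveRight c) _.
have [|c' [e hc]] := IH b' tu1 (col :: lcols).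
  by move=> c; rewrite /tu1 /keep_all !ffunE; apply: holds_keep_right (hu c).
exists c'; split.
  rewrite -e iterS; congr (step (iter _ _ _)).
  by apply: config_ext => // x; rewrite keep_stay.
rewrite hc; congr Halted; rewrite /b' /digits_value /= -!/(digits_value _ _).
by case: (col o1) (col o2) => -[]; rewrite /=; do !case: ifP => /eqP; lia.
Qed.

Lemma pass_step_ext p u v : u =1 v -> pass_step p u =1 pass_step p v.
Proof. by move=> uv d; congr addn; apply: eq_bigr => c _; rewrite uv. Qed.

Definition output (u : U -> nat) (ds : seq (letter l)) : U -> nat :=
  pass_step (Some None) (foldl (fun v r => pass_step (Some (Some r)) v) u ds).

Lemma output_ext u v ds : u =1 v -> output u ds =1 output v ds.
Proof.
rewrite /output; elim: ds u v => [|r ds IH] u v uv; first exact: pass_step_ext.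
exact/IH/pass_step_ext.
Qed.

Definition bits_value (bs : seq bool) : nat := foldr (fun (b : bool) z => z.*2 + b)%N 0%N bs.

(** At most [n + 1] passes remain, each adding at most [carry_max] digits to the vector and taking
    time linear in its length. *)
Definition run_bound (n s : nat) : nat := (n.+1 * (3 * (s + n.+1 * carry_max) + 10))%N.

Lemma read_end (xb : X -> seq bool) cols t0 tx tu :
  (forall x, holds_left (tx x) (xb x)) -> columns tu [::] cols ->
  (forall x, xb x = [::]) ->
  exists n c', [/\ iter n step (config Read t0 tx tu) = c',
    tm_cur c' = Halted (output (digits_value cols) [::] o1 < output (digits_value cols) [::] o2)%N
    & (n <= run_bound 0 (size cols))%N].
Proof.
move=> hx hu x0; have e0 : exists tx', step (config Read t0 tx tu) =
    config (Sweep (Some None) (start_carry (Some None))) t0 tx' tu.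
  rewrite stepE //=; have -> : [forall x, [ffun x => tape_head (tx x)] x == None].
    by apply/forallP => x; rewrite ffunE (proj2 (holds_left_head (hx x))) x0.
  by eexists; rewrite act_keep; apply: config_ext => // c; rewrite keep_stay.
have [tx' e1] := e0.
have [n [out [tu' [e2 hu' v2 s2 n2]]]] := pass_run (Some None) t0 tx' hu.
have [c' [e3 hc]] := compare_run false t0 tx' hu'.
exists ((size out).+1 + (n + 1))%N, c'; split.
- by rewrite iterD iterD [iter 1 _ _]/= e1 e2 e3.
- rewrite hc; congr Halted; rewrite !v2 /output /=.
  by case: eqP => [->|//]; rewrite ltnn.
by rewrite /run_bound; lia.
Qed.

(** Parts may have different lengths: an exhausted input tape shows a blank, which [dval] reads as
    the digit zero, and reading stops once all input tapes show blanks. *)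
Lemma read_run n (xb : X -> seq bool) cols t0 tx tu :
  (forall x, size (xb x) <= n)%N ->
  (forall x, holds_left (tx x) (xb x)) -> columns tu [::] cols ->
  exists t ds c', [/\ iter t step (config Read t0 tx tu) = c',
    tm_cur c' = Halted (output (digits_value cols) ds o1 < output (digits_value cols) ds o2)%N,
    forall x, digits_value ds x = bits_value (xb x)
    & (t <= run_bound n (size cols))%N].
Proof.
elim: n xb cols tx tu => [|n IH] xb cols tx tu sx hx hu;
    case: (boolP [forall x, xb x == [::]]) => [/forallP x0|].
- have {}x0 x : xb x = [::] by apply/eqP.
  have [t [c' [e h b]]] := read_end t0 hx hu x0.
  by exists t, [::], c'; split=> // x; rewrite x0.
- by case/forallPn => x; rewrite -size_eq0 -leqn0 sx.
- have {}x0 x : xb x = [::] by apply/eqP.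
  have [t [c' [e h b]]] := read_end t0 hx hu x0.
  exists t, [::], c'; split=> //; first by move=> x; rewrite x0.
  by apply: leq_trans b _; rewrite /run_bound; nia.
case/forallPn => x1 nx1; pose r : letter l := [ffun x => head false (xb x)].
have e1 : step (config Read t0 tx tu) =
    config (Sweep (Some (Some r)) (start_carry (Some (Some r)))) t0
      (fun x => act (tape_head (tx x), MoveLeft) (tx x)) tu.
  rewrite stepE //=; have -> : [forall x, [ffun x => tape_head (tx x)] x == None] = false.
    apply/forallP => /(_ x1); rewrite ffunE (proj2 (holds_left_head (hx x1))).
    by rewrite (negbTE nx1).
  have -> : [ffun x => dval ([ffun x => tape_head (tx x)] x)] = r.
    by apply/ffunP => x; rewrite !ffunE (proj1 (holds_left_head (hx x))).
  by rewrite act_keep; apply: config_ext => i; rewrite ?keep_stay // /keep_all !ffunE.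
have [m [out [tu' [e2 hu' v2 s2 m2]]]] := pass_run (Some (Some r)) t0
  (fun x => act (tape_head (tx x), MoveLeft) (tx x)) hu.
have [||t [ds [c' [e3 hc vd tb]]]] := IH (fun x => behead (xb x)) out
  (fun x => act (tape_head (tx x), MoveLeft) (tx x)) tu' _ _ hu'.
- by move=> x; rewrite size_behead; have := sx x; lia.
- by move=> x; apply: holds_left_move.
exists (t + (m + 1))%N, (r :: ds), c'; split.
- by rewrite iterD iterD [iter 1 _ _]/= e1 e2 e3.
- by rewrite hc; congr Halted; rewrite !(output_ext ds v2).
- move=> x; rewrite /digits_value /= -/(digits_value _ x) vd ffunE.
  by case: (xb x).
move: tb; rewrite /run_bound => tb; nia.
Qed.

(* Digits come most significant first, so pushing them leaves the least
   significant one on top. *)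
Definition push (lx : {ffun X -> seq bool}) (q i : nat) (bit : bool) : {ffun X -> seq bool} :=
  [ffun x : X => if (x.1 == q :> nat) && (x.2 == i :> nat) then bit :: lx x else lx x].

(** The function computed by the [Parse] states, which separates the correctness of the encoding
    from the tapes. *)
Fixpoint decode_word (q i : nat) (b : bool) lx (w : seq symbol) : option {ffun X -> seq bool} :=
  match w with
  | [::] => if (q < 3)%N then None else Some lx
  | inl bit :: w' =>
      if [&& q < 3, i < l & b || bit]%N then decode_word q i true (push lx q i bit) w' else None
  | inr false :: w' => if (q < 3)%N && b then decode_word q i.+1 false lx w' else None
  | inr true :: w' => if (q < 3)%N && ~~ b then decode_word q.+1 0 false lx w' else None
  end.

Definition holds_input (t : tape) (w : seq symbol) : Prop :=
  exists k, tape_head t :: tape_right t = [seq Some (inl x) | x <- w] ++ nseq k None.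

Lemma holds_input_right t x w : holds_input t (x :: w) ->
  tape_head t = Some (inl x) /\ holds_input (act (tape_head t, MoveRight) t) w.
Proof.
case: t => lt c r [k [/= -> E]]; split=> //.
case: r E => [|y r] E; last by exists k.
by exists 1%N; case: w E.
Qed.

Lemma holds_input_nil t : holds_input t [::] -> tape_head t = None.
Proof. by case=> [[|k] // [->]]. Qed.

Lemma reject_run s t0 tx tu : machine_verdict s = None ->
  delta s (tape_head t0) [ffun x => tape_head (tx x)] [ffun c => tape_head (tu c)] =
    reject (tape_head t0) [ffun x => tape_head (tx x)] [ffun c => tape_head (tu c)] ->
  tm_cur (step (config s t0 tx tu)) = Halted false.
Proof. by move=> vs E; rewrite stepE // E. Qed.

Lemma decode_run w (q i : nat) (b : bool) (lx : {ffun X -> seq bool}) t0 tx tu :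
  (q <= 3)%N -> (i <= l)%N -> (b ==> (i < l))%N -> holds_input t0 w ->
  (forall x, holds (tx x) (lx x) [::]) ->
  exists n c', [/\ iter n step (config (Parse q i b) t0 tx tu) = c', (n <= (size w).+1)%N &
    match decode_word q i b lx w with
    | Some lx' => exists t0' tx', c' = config (Sweep None (start_carry None)) t0' tx' tu /\
                    forall x, holds_left (tx' x) (lx' x)
    | None => tm_cur c' = Halted false
    end].
Proof.
elim: w q i b lx t0 tx => [|x w IH] q i b lx t0 tx q3 il bi ht hx.
  exists 1%N, (step (config (Parse q i b) t0 tx tu)); split=> //=.
  case: ltnP => q3'.
    by apply: reject_run => //=; rewrite (holds_input_nil ht) inordK // q3'.
  exists t0, (fun x => act (tape_head (tx x), MoveLeft) (tx x)); split; last first.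
    by move=> x; apply: holds_left_of_holds.
  rewrite stepE //= {1}(holds_input_nil ht) inordK // ltnNge q3' /= act_keep.
  by apply: config_ext => j; rewrite ?keep_stay // /keep_all !ffunE.
have [hd ht'] := holds_input_right ht.
have reject_case : decode_word q i b lx (x :: w) = None ->
    delta (Parse q i b) (tape_head t0) [ffun x => tape_head (tx x)]
      [ffun c => tape_head (tu c)] =
    reject (tape_head t0) [ffun x => tape_head (tx x)] [ffun c => tape_head (tu c)] ->
    exists n c', [/\ iter n step (config (Parse q i b) t0 tx tu) = c',
      (n <= (size (x :: w)).+1)%N &
      match decode_word q i b lx (x :: w) with
      | Some lx' => exists t0' tx', c' = config (Sweep None (start_carry None)) t0' tx' tu /\
                      forall x, holds_left (tx' x) (lx' x)
      | None => tm_cur c' = Halted false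
      end].
  move=> -> E; exists 1%N, (step (config (Parse q i b) t0 tx tu)); split=> //.
  exact: reject_run.
have advance q' i' b' lx' tx' :
    step (config (Parse q i b) t0 tx tu) =
      config (Parse q' i' b') (act (tape_head t0, MoveRight) t0) tx' tu ->
    decode_word q i b lx (x :: w) = decode_word q' i' b' lx' w ->
    (q' <= 3)%N -> (i' <= l)%N -> (b' ==> (i' < l))%N ->
    (forall x, holds (tx' x) (lx' x) [::]) ->
    exists n c', [/\ iter n step (config (Parse q i b) t0 tx tu) = c',
      (n <= (size (x :: w)).+1)%N &
      match decode_word q i b lx (x :: w) with
      | Some lx' => exists t0' tx', c' = config (Sweep None (start_carry None)) t0' tx' tu /\
                      forall x, holds_left (tx' x) (lx' x)
      | None => tm_cur c' = Halted false
      end].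
  move=> e -> q3' il' bi' hx'.
  have [n [c' [e2 nb h]]] := IH q' i' b' lx' _ tx' q3' il' bi' ht' hx'.
  by exists n.+1, c'; split=> //; rewrite iterSr e.
have kq : (inord q : 'I_4) = q :> nat by rewrite inordK.
have ki : (inord i : 'I_l.+1) = i :> nat by rewrite inordK.
case: x hd {ht} reject_case advance => [bit|[]] hd reject_case advance.
- case: (boolP [&& q < 3, i < l & b || bit]%N) => ok; last first.
    by apply: reject_case; rewrite /= ?hd ?kq ?ki (negbTE ok).
  have [q3' il' _] := and3P ok.
  apply: (advance q i true (push lx q i bit)
    (fun x : X => if (x.1 == q :> nat) && (x.2 == i :> nat)
      then act (dig symbol bit, MoveRight) (tx x) else tx x)) => //=.
  + rewrite stepE //= hd kq ki ok -hd; apply: config_ext => j; rewrite ?keep_stay //.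
    by rewrite ffunE; case: ifP => _ //; rewrite ffunE act_keep.
  + by rewrite ok.
  move=> x; rewrite /push ffunE; case: ifP => _ //.
  exact: (holds_write_right bit (hx x)).
- case: (boolP ((q < 3)%N && ~~ b)) => ok; last first.
    by apply: reject_case; rewrite /= ?hd ?kq (negbTE ok).
  have [q3' _] := andP ok.
  apply: (advance q.+1 0%N false lx tx) => //=; last by rewrite ok.
  rewrite stepE //= hd kq ok -hd.
  by apply: config_ext => j; rewrite keep_stay.
case: (boolP ((q < 3)%N && b)) => ok; last first.
  by apply: reject_case; rewrite /= ?hd ?kq (negbTE ok).
have [q3' bt] := andP ok; rewrite bt in bi.
apply: (advance q i.+1 false lx tx) => //=; last by rewrite ok.
rewrite stepE //= hd kq ok ki -hd.
by apply: config_ext => j; rewrite keep_stay.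
Qed.

Lemma decode_size w q i b lx lx' : decode_word q i b lx w = Some lx' ->
  forall x, (size (lx' x) <= size (lx x) + size w)%N.
Proof.
elim: w q i b lx => [|a w IH] q i b lx /=.
  by case: ifP => // _ [<-] x; rewrite addn0.
case: a => [bit|[]]; case: ifP => // _ /IH h x; apply: leq_trans (h x) _; rewrite ?addnS //.
by rewrite /push ffunE -addSn leq_add2r; case: ifP.
Qed.

Lemma tm_initE w : tm_init machine w =
  config (Parse 0 0 false) (tape_of_word [seq inl x | x <- w])
    (fun=> Tape [::] None [::]) (fun=> Tape [::] None [::]).
Proof.
congr TMConfig; apply/ffunP => i; rewrite !ffunE /tape_kind.
by case: unliftP => [j ->|->] //=; case: (enum_val j).
Qed.

Lemma blank_holds : holds (Tape [::] None [::] : tape) [::] [::].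
Proof. by exists 0%N, 1%N. Qed.

Lemma run_bound_le n s : (s <= carry_max)%N ->
  (run_bound n s + (carry_max.*2 + 3) + n.+1 <= (14 * carry_max + 30) * (n ^ 2).+1)%N.
Proof.
move=> sC; rewrite /run_bound -mulnn; move: carry_max sC => C sC.
have h1 : (n <= n * n)%N by case: n => // n; rewrite leq_pmulr.
have h2 : (C * n <= C * (n * n))%N by rewrite leq_mul2l h1 orbT.
have h3 : (n.+1 * (3 * (s + n.+1 * C) + 10) <= n.+1 * (3 * (C + n.+1 * C) + 10))%N.
  by rewrite leq_mul2l leq_add2r leq_mul2l leq_add2r sC.
by apply: leq_trans (leq_add (leq_add h3 (leqnn _)) (leqnn _)) _; lia.
Qed.

Lemma machine_run w : exists t b,
  [/\ (t <= (14 * carry_max + 30) * (size w ^ 2).+1)%N,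
      tm_verdict (tm_cur (iter t step (tm_init machine w))) = Some b &
      match decode_word 0 0 false [ffun=> [::]] w with
      | Some lx => exists ds : seq (letter l),
          (forall x, digits_value ds x = bits_value (lx x)) /\
          b = (output (pass_step None (fun=> 0%N)) ds o1 <
               output (pass_step None (fun=> 0%N)) ds o2)%N
      | None => b = false
      end].
Proof.
rewrite tm_initE; have [||t1 [c1 [e1 b1 h1]]] := @decode_run w 0 0 false [ffun=> [::]]
  (tape_of_word [seq inl x | x <- w]) (fun=> Tape [::] None [::]) (fun=> Tape [::] None [::])
  isT isT isT.
- by case: w => [|a w]; [exists 1%N|exists 0%N; rewrite /= cats0 -map_comp].
- by move=> x; rewrite ffunE; apply: blank_holds.
case E: decode_word h1 => [lx|] h1; last first.
  exists t1, false; rewrite e1 h1; split=> //.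
  apply: leq_trans b1 _; apply: leq_trans (run_bound_le _ (leq0n _)).
  exact: leq_addl.
have [t0 [tx [cE hx]]] := h1.
have [|n [out [tu [e2 hu v2 s2 b2]]]] := @pass_run None [::] t0 tx (fun=> Tape [::] None [::]).
  by move=> c; apply: blank_holds.
have sx x : (size (lx x) <= size w)%N by have := decode_size E x; rewrite ffunE.
have [t3 [ds [c3 [e3 h3 vd b3]]]] := read_run t0 sx hx hu.
exists (t3 + (n + t1))%N, (output (digits_value out) ds o1 < output (digits_value out) ds o2)%N.
split.
- apply: leq_trans (run_bound_le _ (s2 : size out <= carry_max)%N).
  by rewrite addnA; apply: leq_add b1; apply: leq_add b3 b2.
- by rewrite iterD iterD e1 cE e2 e3 h3.
exists ds; split=> //; have v2' : digits_value out =1 pass_step None (fun=> 0%N) by exact: v2.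
by rewrite !(output_ext ds v2').
Qed.
End Machine.

(** * Words accepted by the parser *)

Section Decoding.
Variable l : nat.
Local Notation X := ('I_3 * 'I_l)%type.
Implicit Types (lx : {ffun X -> seq bool}) (w : seq symbol) (bs : seq bool).

Lemma bits_value_mkseq p k : (p < 2 ^ k)%N ->
  bits_value (mkseq (fun i => odd (p %/ 2 ^ i)) k) = p.
Proof.
move=> pk; rewrite -[RHS](@binary_digits_value unit (fun=> p) k (fun=> pk) tt).
rewrite /bits_value /digits_value /binary_digits /mkseq.
by elim: (iota 0 k) => //= i s ->; rewrite ffunE.
Qed.

Lemma bits_value_binary p : bits_value (rev (binary p)) = p.
Proof. by rewrite /binary revK bits_value_mkseq // trunc_log_ltn. Qed.

Lemma mkseq_bits bs :
  mkseq (fun i => odd (bits_value bs %/ 2 ^ i)) (size bs) = bs.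
Proof.
elim: bs => // b bs IH; rewrite /mkseq /= divn1 oddD odd_double oddb; congr cons.
rewrite -[in RHS]IH /mkseq -[1%N]addn0 iotaDl -map_comp; apply: eq_map => i /=.
by rewrite expnS divnMA divn2 addnC half_bit_double.
Qed.

Lemma bits_value_rcons bs :
  (2 ^ size bs <= bits_value (rcons bs true) < 2 ^ (size bs).+1)%N.
Proof.
by elim: bs => //= b bs /andP[h1 h2]; rewrite !expnS in h2 *; case: b; lia.
Qed.

Lemma binary_bits bs : binary (bits_value (rev (true :: bs))) = true :: bs.
Proof.
rewrite rev_cons; have E := @trunc_log_eq 2 (size (rev bs)) _ isT (bits_value_rcons (rev bs)).
by rewrite /binary E -(size_rcons (rev bs) true) mkseq_bits rev_rcons revK.
Qed.

Lemma bits_value_gt0 bs : (0 < bits_value (rev (true :: bs)))%N.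
Proof.
rewrite rev_cons; have /andP[h _] := bits_value_rcons (rev bs).
by apply: leq_trans h; rewrite expn_gt0.
Qed.

Lemma binary_cons p : (0 < p)%N -> exists bs, binary p = true :: bs.
Proof.
move=> p0; rewrite /binary mkseqS rev_rcons; set k := trunc_log 2 p.
have -> : (p %/ 2 ^ k = 1)%N.
  have /andP[h1 h2] : (2 ^ k <= p < 2 ^ k.+1)%N by rewrite trunc_logP // trunc_log_ltn.
  apply/eqP; rewrite eqn_leq -ltnS ltn_divLR ?expn_gt0 // -expnS h2.
  by rewrite leq_divRL ?expn_gt0 // mul1n.
by eexists.
Qed.

Definition push_all lx q i bs := foldl (fun lx b => push lx q i b) lx bs.

Lemma push_allE lx q i bs (x : X) : push_all lx q i bs x =
  if (x.1 == q :> nat) && (x.2 == i :> nat) then rev bs ++ lx x else lx x.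
Proof.
elim: bs lx => [|b bs IH] lx /=; first by case: ifP.
by rewrite IH /push ffunE rev_cons cat_rcons; case: (_ && _).
Qed.

Fixpoint fill (q i : nat) (ps : seq nat) lx : {ffun X -> seq bool} :=
  if ps is p :: ps' then fill q i.+1 ps' (push_all lx q i (binary p)) else lx.

Lemma fillE q i ps lx (x : X) : fill q i ps lx x =
  if [&& x.1 == q :> nat, i <= x.2 & x.2 < i + size ps]%N
  then rev (binary (nth 0%N ps (x.2 - i))) ++ lx x else lx x.
Proof.
elim: ps i lx => [|p ps IH] i lx /=.
  by rewrite addn0 ltnNge andbN andbF.
rewrite IH push_allE addnS -addSn; case: (x.1 == q :> nat) => //=.
case: (ltngtP i x.2) => [ix|xi|E].
- case: ifP => // h; congr (rev (binary _) ++ _).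
  by have -> : (x.2 - i = (x.2 - i.+1).+1)%N by lia.
- by [].
by rewrite E ltnS leq_addr subnn.
Qed.

Lemma decode_digits q i lx bs w : (q < 3)%N -> (i < l)%N ->
  decode_word q i true lx ([seq inl b | b <- bs] ++ w) =
  decode_word q i true (push_all lx q i bs) w.
Proof. by move=> q3 il; elim: bs lx => //= b bs IH lx; rewrite q3 il /= IH. Qed.

Lemma decode_part q i lx p w : (q < 3)%N -> (i < l)%N -> (0 < p)%N ->
  decode_word q i false lx (rcons [seq inl b | b <- binary p] (inr false) ++ w) =
  decode_word q i.+1 false (push_all lx q i (binary p)) w.
Proof.
move=> q3 il /binary_cons [bs ->]; rewrite cat_rcons /= q3 il /=.
by rewrite decode_digits //= q3.
Qed.

Lemma decode_partition q i lx ps w : (q < 3)%N -> 0%N \notin ps -> (i + size ps <= l)%N ->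
  decode_word q i false lx (encode_partition ps ++ w) = decode_word q.+1 0 false (fill q i ps lx) w.
Proof.
move=> q3; elim: ps i lx => [|p ps IH] i lx /=; first by rewrite q3.
rewrite inE negb_or eq_sym -lt0n => /andP[p0 ps0]; rewrite addnS => il.
rewrite /encode_partition /= rcons_cat -catA decode_part //; last first.
  by apply: leq_trans il; rewrite ltnS leq_addr.
exact: IH.
Qed.

Lemma decode_digits_inv q i lx w : (q < 3)%N -> (i < l)%N -> decode_word q i true lx w <> None ->
  exists bs w', w = [seq inl b | b <- bs] ++ inr false :: w' /\
    decode_word q i.+1 false (push_all lx q i bs) w' <> None.
Proof.
move=> q3 il; elim: w lx => [|a w IH] lx /=; first by rewrite q3.
case: a => [b|[]]; rewrite q3 ?il //=; last by move=> h; exists [::], w.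
by case/IH => bs [w' [-> h]]; exists (b :: bs), w'.
Qed.

(** An accepted part begins with the digit one, so it is positive and its digits are the [binary]
    form of its value. The induction is on the length of the word, as a whole part is removed at a
    time. *)
Lemma decode_partition_inv q i lx w : (q < 3)%N -> (i <= l)%N ->
  decode_word q i false lx w <> None ->
  exists ps w', [/\ w = encode_partition ps ++ w', 0%N \notin ps & (i + size ps <= l)%N].
Proof.
move=> q3; move: {2}(size w) (leqnn (size w)) => m.
elim: m i lx w => [|m IH] i lx [|a w] //=; rewrite ?q3 // => wm il.
case: a => [b|[]]; rewrite //=; last by exists [::], w; rewrite addn0.
case: ifP => // /andP[il' ->] /(decode_digits_inv q3 il') [bs [w1 [wE h]]].
have [||ps [w2 [w1E ps0 sz]]] := IH i.+1 _ w1 _ _ h => //.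
  by move: wm; rewrite wE size_cat /=; lia.
exists (bits_value (rev (true :: bs)) :: ps), w2; split.
- rewrite /encode_partition /= binary_bits rcons_cat -catA /=; congr cons.
  by rewrite wE w1E cat_rcons.
- by rewrite inE negb_or eq_sym -lt0n bits_value_gt0.
by rewrite /= addnS.
Qed.

Definition fill_triple (la mu nu : seq nat) : {ffun X -> seq bool} :=
  fill 2 0 nu (fill 1 0 mu (fill 0 0 la [ffun=> [::]])).

Lemma decode_triple la mu nu :
  (size la <= l)%N -> (size mu <= l)%N -> (size nu <= l)%N ->
  0%N \notin la -> 0%N \notin mu -> 0%N \notin nu ->
  decode_word 0 0 false [ffun=> [::]] (encode_triple la mu nu) = Some (fill_triple la mu nu).
Proof.
move=> zla zmu znu nla nmu nnu; rewrite /encode_triple.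
by rewrite decode_partition // decode_partition // -[encode_partition nu]cats0 decode_partition.
Qed.

Lemma decode_triple_inv w : decode_word (l := l) 0 0 false [ffun=> [::]] w <> None ->
  exists la mu nu, [/\ w = encode_triple la mu nu,
    [&& size la <= l, size mu <= l & size nu <= l]%N &
    [&& 0%N \notin la, 0%N \notin mu & 0%N \notin nu]].
Proof.
move=> h0; have [//|//|la [w1 [E1 nla zla]]] := decode_partition_inv _ _ h0.
rewrite E1 decode_partition // in h0.
have [//|//|mu [w2 [E2 nmu zmu]]] := decode_partition_inv _ _ h0.
rewrite E2 decode_partition // in h0.
have [//|//|nu [w3 [E3 nnu znu]]] := decode_partition_inv _ _ h0.
rewrite E3 decode_partition // in h0.
exists la, mu, nu; rewrite zla zmu znu nla nmu nnu; split=> //.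
rewrite E1 E2 E3 /encode_triple; congr (_ ++ (_ ++ _)).
(* After three partitions every further symbol is rejected, so nothing is left of the word. *)
by case: w3 h0 {E3} => [|[b|[]] w3] //=; rewrite cats0.
Qed.

Lemma fill_triple_value la mu nu (x : X) :
  (size la <= l)%N -> (size mu <= l)%N -> (size nu <= l)%N ->
  bits_value (fill_triple la mu nu x) = parts_value la mu nu x.
Proof.
move=> zla zmu znu; rewrite /fill_triple !fillE ffunE /parts_value /axis_part.
have val_nth (ps : seq nat) a : bits_value
    (if (a < size ps)%N then rev (binary (nth 0%N ps a)) ++ [::] else [::]) = nth 0%N ps a.
  by rewrite cats0; case: ltnP => [_|h]; [apply: bits_value_binary|rewrite nth_default].
by case: x => [[[|[|[|//]]] ?] a] /=; rewrite subn0 -[RHS]val_nth.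
Qed.
End Decoding.

(** * Counters as passes of the machine *)

Section CounterMachine.
Variables (l : nat) (D : counter ('I_3 * 'I_l)%type).
Local Notation U := (bool + ct_state D)%type.

(** Two tapes are added to those of the states: the last pass puts the positive total on [inl true]
    and the negative one on [inl false]. *)
Definition pass_matrix (p : option (option (letter l))) (c d : U) : nat :=
  match p, c, d with
  | Some (Some r), inr c, inr d => ct_matrix r c d
  | Some None, inr c, inl b => if b then ct_pos c else ct_neg c
  | _, _, _ => 0%N
  end.

Definition pass_init (p : option (option (letter l))) (d : U) : nat :=
  match p, d with None, inr d => ct_init d | _, _ => 0%N end.

Lemma output_counter ds b :
  output pass_matrix pass_init (pass_step pass_matrix pass_init None (fun=> 0%N)) ds (inl b) =
  (\sum_c ct_run D ds c * (if b then ct_pos c else ct_neg c))%N.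
Proof.
rewrite /output.
suff run u v : (forall c, u (inl c) = 0%N) -> (forall c, u (inr c) = v c) -> forall c,
    foldl (fun u r => pass_step pass_matrix pass_init (Some (Some r)) u) u ds (inr c) =
    foldl (@ct_step _ D) v ds c.
  rewrite {1}/pass_step big_sumType /= big1 => [|c _]; last by rewrite muln0.
  rewrite add0n addn0; apply: eq_bigr => c _; congr (_ * _)%N; apply: run => d.
    by rewrite /pass_step big1 // => c' _; rewrite muln0.
  by rewrite /pass_step big1 // => c' _; rewrite muln0.
elim: ds u v => [|r ds IH] u v u0 uv c //=.
apply: IH => [b'|d]; first by rewrite /pass_step big1 // => -[c'|c'] _; rewrite muln0.
rewrite /pass_step big_sumType /= big1 => [|c' _]; last by rewrite muln0.
by rewrite add0n addn0; apply: eq_bigr => c' _; rewrite uv.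
Qed.

Lemma output_accepts ds :
  let u := pass_step pass_matrix pass_init None (fun=> 0%N) in
  (output pass_matrix pass_init u ds (inl false) <
   output pass_matrix pass_init u ds (inl true))%N = ct_accepts D ds.
Proof. by rewrite /= !output_counter. Qed.
End CounterMachine.

(** A word refused by the parser encodes no three lists of at most [l] nonzero parts. An accepted
    word encodes such lists, and the counter decides both whether they form an instance and whether
    the coefficient is positive. *)
Theorem kronecker_positivity_in_P (l : nat) : in_P (kronecker_positivity l).
Proof.
pose D := kronecker_counter l.
pose M := machine (pass_matrix (D := D)) (pass_init (D := D)) (inl false) (inl true).
exists M, (14 * carry_max (pass_matrix (D := D)) (pass_init (D := D)) + 30)%N, 2%N => w.
have [t [b [tT vE out]]] := machine_run (pass_matrix (D := D)) (pass_init (D := D))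
  (inl false) (inl true) w.
exists t, b; split=> //.
have accepts la mu nu ds : [&& size la <= l, size mu <= l & size nu <= l]%N ->
    [&& 0%N \notin la, 0%N \notin mu & 0%N \notin nu] ->
    (forall x : 'I_3 * 'I_l, digits_value ds x = bits_value (fill_triple l la mu nu x)) ->
    ct_accepts D ds = kronecker_instance l la mu nu && (0 < kronecker la mu nu).
  move=> /and3P[zla zmu znu] /and3P[nla nmu nnu] dsE; apply: kronecker_counterP => // x.
  by rewrite dsE fill_triple_value.
split=> [|[la [mu [nu [hi wE kpos]]]]].
  case E: (decode_word _ _ _ _ _) out => [lx|]; last by move=> ->.
  case=> ds [dsE ->].
  rewrite output_accepts.
  have [|la [mu [nu [wE hz hn]]]] := @decode_triple_inv l w; first by rewrite E.
  move: (hz) (hn) => /and3P[zla zmu znu] /and3P[nla nmu nnu].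
  rewrite wE decode_triple // in E; case: E => lxE.
  rewrite (accepts la mu nu) // => [/andP[hi kpos]|x]; last by rewrite dsE lxE.
  by exists la, mu, nu.
have [/and3P[pla pmu pnu] _ _ hz] := and4P hi.
have [zla zmu znu] := and3P hz.
have hn : [&& 0%N \notin la, 0%N \notin mu & 0%N \notin nu].
  by move: pla pmu pnu => /andP[_ ->] /andP[_ ->] /andP[_ ->].
have [nla nmu nnu] := and3P hn.
move: out; rewrite wE decode_triple // => -[ds [dsE ->]].
by rewrite output_accepts (accepts la mu nu) // hi.
Qed.

(** * The bound on arithmetic operations *)

Lemma nth_part_le_head la i : is_partition la -> (nth 0 la i <= head 0 la)%N.
Proof. by move=> hp; rewrite -nth0; apply: nth_part_anti. Qed.

Lemma nth_ram_input l la mu nu (x : 'I_3 * 'I_l) :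
  nth 0%N (ram_input l la mu nu) (x.1 * l + x.2)%N = parts_value la mu nu x.
Proof.
case: x => [[q q3] a]; rewrite /ram_input /= cats0 /parts_value /axis_part /=.
have sz (p : seq nat) : size [seq nth 0%N p i | i <- iota 0 l] = l by rewrite size_map size_iota.
have nthE (p : seq nat) : nth 0%N [seq nth 0%N p i | i <- iota 0 l] a = nth 0%N p a.
  by rewrite (nth_map 0%N) ?size_iota ?nth_iota.
case: q q3 => [|[|[|//]]] _; rewrite !nth_cat ?sz /=.
- by rewrite mul0n add0n ltn_ord nthE.
- by rewrite mul1n ltnNge leq_addr addKn ltn_ord nthE.
rewrite mul2n -addnn -addnA ltnNge leq_addr addKn /= ltnNge leq_addr addKn /=.
exact: nthE.
Qed.

Lemma ram_input_le l la mu nu N i : kronecker_instance l la mu nu ->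
  (head 0%N la <= N)%N -> (head 0%N mu <= N)%N -> (head 0%N nu <= N)%N ->
  (nth 0%N (ram_input l la mu nu) i <= N)%N.
Proof.
case/and4P => /and3P[pla pmu pnu] _ _ _ hla hmu hnu.
have le_N (p : seq nat) : is_partition p -> (head 0%N p <= N)%N ->
    all (fun z => z <= N)%N [seq nth 0%N p i | i <- iota 0 l].
  move=> hp hN; rewrite all_map; apply/allP => j _ /=.
  exact: leq_trans (nth_part_le_head j hp) hN.
have : all (fun z => z <= N)%N (ram_input l la mu nu) by rewrite !all_cat !le_N.
move/allP => h; case: (ltnP i (size (ram_input l la mu nu))) => si.
  by apply: h; apply: mem_nth.
by rewrite nth_default.
Qed.

Theorem theorem6p1 (l : nat) (hl : (1 <= l)%N) :
  in_P (kronecker_positivity l) /\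
  exists (P : program) (C : nat),
    forall (N : nat) (la mu nu : seq nat),
      (2 <= N)%N ->
      kronecker_instance l la mu nu ->
      (head 0%N la <= N)%N -> (head 0%N mu <= N)%N -> (head 0%N nu <= N)%N ->
      exists b : bool,
        ram_run P (ram_input l la mu nu) (C * trunc_log 2 N) (N ^ C) b /\
        (b <-> 0 < kronecker la mu nu).
Proof.
split; first exact: kronecker_positivity_in_P.
(* Part [a] of the partition numbered [q] stands in register [q * l + a], one of [3 * l] inputs. *)
have rk_lt (x : 'I_3 * 'I_l) : (x.1 * l + x.2 < 3 * l)%N.
  by have := ltn_ord x.1; have := ltn_ord x.2; nia.
have [P [C run]] := counter_ram (kronecker_counter l) rk_lt.
exists P, C => N la mu nu N2 hi hla hmu hnu.
have [k lt_k hrun] := run N (ram_input l la mu nu) N2 (fun i => ram_input_le i hi hla hmu hnu).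
eexists; split; first exact: hrun.
have [/and3P[/andP[_ nla] /andP[_ nmu] /andP[_ nnu]] _ _ /and3P[zla zmu znu]] := and4P hi.
rewrite (@kronecker_counterP l la mu nu) // ?hi //.
move=> x; rewrite binary_digits_value ?nth_ram_input // => y; exact: lt_k.
Qed.
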